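(* Let $\nu>0$, $f\in H$, and let $u$ be a strong solution of the periodic two-dimensional Navier--Stokes equations $u_t+\nu Au+B(u,u)=f$, $u(0)=u_0\in V$. Fix $t_0\ge0$ and assume $U_0:=\operatorname*{ess\,sup}_{t\ge t_0}|u(t)|<\infty$ and $U_1:=\operatorname*{ess\,sup}_{t\ge t_0}\|\nabla u(t)\|_{L^2}<\infty$. Let $m=a\in\mathbb S^1$ be a constant rational direction, i.e. $a^\perp=\pm\ell/|\ell|$ for some primitive $\ell\in\mathbb Z^2\setminus\{0\}$. Then $m$ admits a controlled adapted covering, while $\mathcal A_m=0$. Hence the shear-defect condition $K_m\lambda_1^{-1/2}U_0\|\mathcal A_m\|_{L^\infty}\le\nu/4$ is automatic, and for every gain $\mu>0$ satisfying $\mu\ge B_*/2$, where $$A_*:=\frac{2K_m}{\nu}U_1^2,\qquad B_*:=A_*\Bigl[1+\log\Bigl(1+\frac{2C_{\rm fr}A_*}{\nu}\Bigr)\Bigr],$$ every strong solution $v$ of $$v_t+\nu Av+B(v,v)=f-\mu P_\sigma\bigl(((v-u)\cdot m)\,m\bigr),\qquad v(0)=v_0\in V,$$ synchronizes exponentially with $u$ in $H$: $$|v(t)-u(t)|^2\le\exp\Bigl(-\frac{\nu\lambda_1}{2}(t-t_0)\Bigr)|v(t_0)-u(t_0)|^2,\qquad t\ge t_0 .$$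
   Context: Functional setting. $\mathbb T^2=(\mathbb R/2\pi\mathbb Z)^2$. $H$ is the space of divergence-free, mean-zero fields in $L^2(\mathbb T^2)^2$, and $V=H^1(\mathbb T^2)^2\cap H$. $|\cdot|$ is the $L^2$ norm; $\|u\|=\|\nabla u\|_{L^2}$ for $u\in V$. $\lambda_1>0$ is a fixed Poincaré constant: $\lambda_1|u|^2\le\|u\|^2$ for $u\in V$ (one may take $\lambda_1=1$). $P_\sigma:L^2(\mathbb T^2)^2\to H$ is the orthogonal projection, $A=-P_\sigma\Delta$ with $D(A)=H^2(\mathbb T^2)^2\cap H$, $B(u,v)=P_\sigma((u\cdot\nabla)v)$, $b(u,v,w)=\int_{\mathbb T^2}(u\cdot\nabla v)\cdot w\,dx$. A strong solution (of either system) is one that for every $T>0$ lies in $C([0,T];V)\cap L^2(0,T;D(A))$ with time derivative in $L^2(0,T;H)$. For $w\in\mathbb R^2$, $w^\perp=(-w_2,w_1)$. For a unit field $m$, $n:=m^\perp$, $D_nF:=n\cdot\nabla F$ (componentwise on vectors), and $\mathcal A_m:=D_nn-(\nabla\cdot n)n$. A unit field $m\in W^{2,\infty}(\mathbb T^2;\mathbb R^2)$ admits a controlled adapted covering if there exist $L_y,L_s>0$, the torus $\widehat{\mathbb T}^2=(\mathbb R/L_y\mathbb Z)\times(\mathbb R/L_s\mathbb Z)$ with periodic coordinates $Y=(y,s)$, a smooth finite covering map $\Phi:\widehat{\mathbb T}^2\to\mathbb T^2$, and a positive function $q\in W^{2,\infty}(\widehat{\mathbb T}^2)$ such that $\partial_s\Phi=q\,(n\circ\Phi)$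 and, with $\Gamma(Y):=(D\Phi(Y))^{-1}$, $\mathfrak C_\Phi:=\|D\Phi\|_{W^{2,\infty}}+\|\Gamma\|_{W^{2,\infty}}+\|q\|_{W^{2,\infty}}+\|q^{-1}\|_{W^{2,\infty}}<\infty$. One such covering is fixed. Constants. For $r\in H^1(\mathbb T^2)$ let $\mathcal L_m(r)=1+\log\bigl(1+\|r\|_{H^1(\mathbb T^2)}^2/|r|_{L^2}^2\bigr)$ if $r\not\equiv0$ and $\mathcal L_m(r)=1$ if $r\equiv0$. $K_m>0$ is a fixed constant, depending only on the chosen covering and $\|m\|_{W^{2,\infty}}$, with the following property (such a constant exists): for all $\nu>0$ and all $u,e\in V$ with $K_m\lambda_1^{-1/2}\|u\|_{L^2}\|\mathcal A_m\|_{L^\infty}\le\nu/4$, putting $r=e\cdot m$, one has $|b(e,u,e)|\le\frac{\nu}{2}\|\nabla e\|_{L^2}^2+\frac{K_m}{\nu}\|\nabla u\|_{L^2}^2\mathcal L_m(r)|r|_{L^2}^2$. $C_{\rm fr}$ is a fixed constant, depending only on $\|m\|_{W^{1,\infty}}$ and the Poincaré constant, such that $\|e\cdot m\|_{H^1(\mathbb T^2)}^2\le C_{\rm fr}\|\nabla e\|_{L^2}^2$ for all $e\in V$. *)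

(* Defs.v *)
From HB Require Import structures.
From mathcomp Require Import all_boot all_order all_algebra.
From mathcomp Require Import all_classical all_reals all_analysis.
From mathcomp Require Import ess_sup_inf.

Set Implicit Arguments.
Unset Strict Implicit.
Unset Printing Implicit Defensive.

Import Order.TTheory GRing.Theory Num.Theory.
Import numFieldNormedType.Exports.

Local Open Scope classical_set_scope.
Local Open Scope ring_scope.

(* A flat torus (R / L_1 Z) x (R / L_2 Z) is handled through its universal cover:
functions on it are L-periodic functions on the plane, integrals are taken over
the fundamental cell [0, L_1[ x [0, L_2[.  Elements of Lebesgue and Sobolev
spaces are represented by (Borel, everywhere periodic) functions, and equality
of such elements is equality almost everywhere. *)

Section Plane.
Context {R : realType}.

Definition pt : Type := (R * R)%type.
Definition field : Type := pt -> pt.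

Definition crd (i : 'I_2) (p : pt) : R := if i == 0 then p.1 else p.2.
Definition mkpt (c : 'I_2 -> R) : pt := (c 0, c 1).
Definition ebase (i : 'I_2) : pt := mkpt (fun j => (j == i)%:R).

(* The library norm on [R * R] is the sup norm, hence the Euclidean one here. *)
Definition dotp (p q : pt) : R := \sum_(i < 2) crd i p * crd i q.
Definition enorm (p : pt) : R := Num.sqrt (dotp p p).
Definition perp (w : pt) : pt := (- w.2, w.1).

Definition leb2 := (@lebesgue_measure R \x @lebesgue_measure R)%E.

Definition aeq (u v : field) : Prop := {ae leb2, forall x, u x = v x}.

Definition tequiv (L p q : pt) : Prop :=
  exists k : int * int, p = q + (k.1%:~R * L.1, k.2%:~R * L.2).

Definition periodic (T : Type) (L : pt) (f : pt -> T) : Prop :=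
  forall p q, tequiv L p q -> f p = f q.

Definition cell (L : pt) : set pt := `[0, L.1[ `*` `[0, L.2[.

Definition T2 : pt := (2 * pi, 2 * pi).

Definition pder (s : seq 'I_2) (f : pt -> R) : pt -> R :=
  foldr (fun j g => 'D_(ebase j) g) f s.

Definition smooth2 (f : pt -> R) : Prop :=
  forall s : seq 'I_2, continuous (pder s f) /\
    forall (j : 'I_2) x, derivable (pder s f) x (ebase j).

Definition test_fun (L : pt) (phi : pt -> R) : Prop :=
  smooth2 phi /\ periodic L phi.

Definition L1 (L : pt) (f : pt -> R) : Prop :=
  [/\ periodic L f, measurable_fun setT f &
      leb2.-integrable (cell L) (EFin \o f)].

Definition is_wd (L : pt) (j : 'I_2) (f g : pt -> R) : Prop :=
  [/\ L1 L f, L1 L g & forall phi, test_fun L phi ->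
    \int[leb2]_(x in cell L) (f x * 'D_(ebase j) phi x) =
    - \int[leb2]_(x in cell L) (g x * phi x)].

(* A weak derivative of [f] if there is one, the junk value 0 otherwise. *)
Definition wd (L : pt) (j : 'I_2) (f : pt -> R) : pt -> R :=
  xget (fun=> 0) [set g | is_wd L j f g].

Definition has_wd (L : pt) (j : 'I_2) (f : pt -> R) : Prop :=
  is_wd L j f (wd L j f).

Definition L2 (L : pt) (f : pt -> R) : Prop :=
  L1 L f /\ leb2.-integrable (cell L) (fun x => (f x ^+ 2)%:E).

Definition H1 (L : pt) (f : pt -> R) : Prop :=
  L2 L f /\ forall j, has_wd L j f /\ L2 L (wd L j f).

Definition H2 (L : pt) (f : pt -> R) : Prop :=
  H1 L f /\ forall j, H1 L (wd L j f).

Definition l2norm (L : pt) (f : pt -> R) : R :=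
  Num.sqrt (\int[leb2]_(x in cell L) (f x ^+ 2)).

Definition h1norm (L : pt) (f : pt -> R) : R :=
  Num.sqrt (l2norm L f ^+ 2 + \sum_(j < 2) l2norm L (wd L j f) ^+ 2).

Definition h2norm (L : pt) (f : pt -> R) : R :=
  Num.sqrt (h1norm L f ^+ 2 +
    \sum_(j < 2) \sum_(k < 2) l2norm L (wd L k (wd L j f)) ^+ 2).

(* For a periodic function the L^oo norm over the plane is the L^oo norm over
   the torus. *)
Definition linfnorm (f : pt -> R) : \bar R := 'N[leb2]_(+oo%E)[EFin \o f]%E.

(* Set to +oo when weak derivatives are missing, lest the junk values of [wd]
   make the norm finite outside of W^{2,oo}. *)
Definition w2infnorm (L : pt) (f : pt -> R) : \bar R :=
  if `[< L1 L f /\ forall j, has_wd L j f /\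
           forall k, has_wd L k (wd L j f) >]
  then (linfnorm f + \sum_(j < 2) linfnorm (wd L j f) +
        \sum_(j < 2) \sum_(k < 2) linfnorm (wd L k (wd L j f)))%E
  else +oo%E.

Definition L2v (u : field) : Prop := forall i, L2 T2 (crd i \o u).

Definition ip (u v : field) : R :=
  \int[leb2]_(x in cell T2) dotp (u x) (v x).

Definition norm_H (u : field) : R := Num.sqrt (ip u u).

Definition space_H (u : field) : Prop :=
  [/\ L2v u,
      forall i, \int[leb2]_(x in cell T2) crd i (u x) = 0 &
      forall phi, test_fun T2 phi ->
        \int[leb2]_(x in cell T2)
          (\sum_(i < 2) crd i (u x) * 'D_(ebase i) phi x) = 0].

Definition space_V (u : field) : Prop :=
  space_H u /\ forall i, H1 T2 (crd i \o u).

Definition dom_A (u : field) : Prop :=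
  space_H u /\ forall i, H2 T2 (crd i \o u).

Definition norm_V (u : field) : R :=
  Num.sqrt (\sum_(i < 2) \sum_(j < 2) l2norm T2 (wd T2 j (crd i \o u)) ^+ 2).

Definition norm_DA (u : field) : R :=
  Num.sqrt (\sum_(i < 2) h2norm T2 (crd i \o u) ^+ 2).

(* The orthogonal projection P_sigma : L^2 -> H is given by its graph, since
   P_sigma g is only determined up to equality almost everywhere. *)
Definition is_leray (g h : field) : Prop :=
  [/\ L2v g, space_H h & forall w, space_H w -> ip (g \- h) w = 0].

Definition laplacian (u : field) : field := fun x =>
  mkpt (fun i => \sum_(j < 2) wd T2 j (wd T2 j (crd i \o u)) x).

Definition advection (u v : field) : field := fun x =>
  mkpt (fun i => \sum_(j < 2) crd j (u x) * wd T2 j (crd i \o v) x).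

Definition is_A (u h : field) : Prop :=
  dom_A u /\ is_leray (fun x => - laplacian u x) h.

Definition is_B (u v h : field) : Prop := is_leray (advection u v) h.

Definition trilinear (u v w : field) : R := ip (advection u v) w.

Definition leb1 := @lebesgue_measure R.

Definition cont_V (T : R) (u : R -> field) : Prop :=
  forall t : R, t \in `[0, T] -> space_V (u t) /\
    norm_V (u s \- u t) @[s --> within `[0, T] (nbhs t)] --> (0 : R).

Definition simple_in (X : field -> Prop) (s : R -> field) : Prop :=
  exists (k : nat) (E : 'I_k -> set R) (w : 'I_k -> field),
    [/\ forall i, measurable (E i), forall i, X (w i) &
        forall t x, s t x = \sum_(i < k) (\1_(E i) t : R) *: (w i x : R * R)].

(* Square-integrable functions ]0, T[ -> (X, N), strongly measurable in the
   sense of Bochner, as everywhere defined functions... *)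
Definition bochner_L2 (X : field -> Prop) (N : field -> R) (T : R)
    (u : R -> field) : Prop :=
  [/\ forall t : R, t \in `]0, T[ -> X (u t),
      exists s : nat -> R -> field, (forall n, simple_in X (s n)) /\
        forall t : R, t \in `]0, T[ -> N (s n t \- u t) @[n --> \oo] --> (0 : R) &
      leb1.-integrable `]0, T[ (fun t : R => (N (u t) ^+ 2)%:E)].

(* ... and up to equality for almost every time. *)
Definition in_bochner_L2 (X : field -> Prop) (N : field -> R) (T : R)
    (u : R -> field) : Prop :=
  exists w, bochner_L2 X N T w /\
    {ae leb1, forall t : R, t \in `]0, T[ -> aeq (u t) (w t)}.

Definition test_time (T : R) (phi : R -> R) : Prop :=
  (forall k t, derivable (derive1n k phi) t 1) /\
  exists a b : R, [/\ 0 < a, b < T & forall t, t \notin `[a, b] -> phi t = 0].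

(* Distributional derivative in time of an H-valued function, the H-valued
   integrals being identified by their inner products with all w in H. *)
Definition is_time_deriv (T : R) (u ut : R -> field) : Prop :=
  forall phi, test_time T phi -> forall w, space_H w ->
    \int[leb1]_(t in `]0, T[) (derive1 phi t * ip (u t) w) =
    - \int[leb1]_(t in `]0, T[) (phi t * ip (ut t) w).

Definition strong_class (u ut : R -> field) : Prop :=
  forall T : R, 0 < T ->
    [/\ cont_V T u, in_bochner_L2 dom_A norm_DA T u,
        bochner_L2 space_H norm_H T ut & is_time_deriv T u ut].

Definition strong_NS (nu : R) (f u0 : field) (u : R -> field) : Prop :=
  exists ut, [/\ strong_class u ut, aeq (u 0) u0 &
    {ae leb1, forall t : R, 0 < t -> exists a b,
      [/\ is_A (u t) a, is_B (u t) (u t) b &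
          aeq (fun x => ut t x + nu *: (a x : R * R) + b x) f]}].

Definition strong_nudged (nu mu : R) (f : field) (m : field)
    (u : R -> field) (v0 : field) (v : R -> field) : Prop :=
  exists vt, [/\ strong_class v vt, aeq (v 0) v0 &
    {ae leb1, forall t : R, 0 < t -> exists a b p,
      [/\ is_A (v t) a, is_B (v t) (v t) b,
          is_leray (fun x => dotp (v t x - u t x) (m x) *: (m x : R * R)) p &
          aeq (fun x => vt t x + nu *: (a x : R * R) + b x)
              (fun x => f x - mu *: (p x : R * R))]}].

Definition ess_sup_from (t0 : R) (g : R -> R) : \bar R :=
  ess_sup (mrestr leb1 (measurable_itv `[t0, +oo[)) (EFin \o g).

(* Fields in W^{2,oo} are represented by their (unique) continuous
representative, which is C^1; classical partial derivatives are therefore used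
in the shear defect, and the identity defining q holds pointwise. *)

Definition shear_defect (m : field) : field := fun x =>
  let n : field := perp \o m in
  let dn (j i : 'I_2) : R := 'D_(ebase j) (crd i \o n) x in
  mkpt (fun i => \sum_(j < 2) crd j (n x) * dn j i -
                 (\sum_(j < 2) dn j j) * crd i (n x)).

Definition unit_W2inf (m : field) : Prop :=
  [/\ continuous m, periodic T2 m, forall x, enorm (m x) = 1 &
      forall i, (w2infnorm T2 (crd i \o m) < +oo)%E].

Definition topen (L : pt) (A : set pt) : Prop :=
  open A /\ forall p q, tequiv L p q -> A p -> A q.

(* The L-periodic open set V (an open subset of the source torus) is mapped
   homeomorphically onto the T2-periodic open set U: the induced map on classes
   is bijective from V to U and open; continuity comes from that of Phi. *)
Definition sheet (L : pt) (Phi : field) (V U : set pt) : Prop :=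
  [/\ forall Y Y', V Y -> V Y' -> tequiv T2 (Phi Y) (Phi Y') -> tequiv L Y Y',
      forall x, U x -> exists2 Y, V Y & tequiv T2 (Phi Y) x,
      forall Y, V Y -> U (Phi Y) &
      forall W, topen L W -> W `<=` V ->
        open [set x | exists2 Y, W Y & tequiv T2 (Phi Y) x]].

(* Phi is a lift to the plane of a map between tori, which is smooth, a local
   diffeomorphism, and evenly covers each point by finitely many sheets. *)
Definition jac (Phi : field) (Y : pt) : 'M[R]_2 :=
  \matrix_(i, j) 'D_(ebase j) (crd i \o Phi) Y.

Definition smooth_finite_covering (L : pt) (Phi : field) : Prop :=
  [/\ forall i, smooth2 (crd i \o Phi),
      forall Y Y', tequiv L Y Y' -> tequiv T2 (Phi Y) (Phi Y'),
      forall Y, jac Phi Y \in unitmx &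
      forall x, exists U, [/\ topen T2 U, U x &
        exists (k : nat) (V : 'I_k.+1 -> set pt),
          [/\ forall i, topen L (V i), trivIset setT V,
              Phi @^-1` U = \bigcup_i V i &
              forall i, sheet L Phi (V i) U]]].

Definition covering_const (L : pt) (Phi : field) (q : pt -> R) : \bar R :=
  (\sum_(i < 2) \sum_(j < 2) w2infnorm L (fun Y => jac Phi Y i j) +
   \sum_(i < 2) \sum_(j < 2) w2infnorm L (fun Y => invmx (jac Phi Y) i j) +
   w2infnorm L q + w2infnorm L (fun Y => (q Y)^-1)%R)%E.

(* The coordinates on the source torus are Y = (y, s), so that d/ds is the
   derivative along [ebase 1]. *)
Definition adapted_covering (m : field) (L : pt) (Phi : field)
    (q : pt -> R) : Prop :=
  [/\ 0 < L.1 /\ 0 < L.2,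
      smooth_finite_covering L Phi,
      [/\ continuous q, periodic L q & forall Y, 0 < q Y],
      forall i Y, 'D_(ebase 1) (crd i \o Phi) Y =
                  q Y * crd i (perp (m (Phi Y))) &
      (covering_const L Phi q < +oo)%E].

Definition admits_controlled_covering (m : field) : Prop :=
  unit_W2inf m /\ exists L Phi q, adapted_covering m L Phi q.

Definition poincare_const (lam : R) : Prop :=
  0 < lam /\ forall u, space_V u -> lam * norm_H u ^+ 2 <= norm_V u ^+ 2.

Definition proj_on (m e : field) : pt -> R := fun x => dotp (e x) (m x).

Definition log_factor (r : pt -> R) : R :=
  if l2norm T2 r == 0 then 1
  else 1 + ln (1 + h1norm T2 r ^+ 2 / l2norm T2 r ^+ 2).

Definition shear_small (lam nu K a : R) (m : field) : Prop :=
  ((K * (Num.sqrt lam)^-1 * a)%R%:E * linfnorm (enorm \o shear_defect m)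
    <= (nu / 4)%R%:E)%E.

Definition trilinear_const (lam : R) (m : field) (K : R) : Prop :=
  0 < K /\ forall nu : R, 0 < nu -> forall u e, space_V u -> space_V e ->
    shear_small lam nu K (norm_H u) m ->
    let r := proj_on m e in
    `|trilinear e u e| <= nu / 2 * norm_V e ^+ 2 +
      K / nu * norm_V u ^+ 2 * log_factor r * l2norm T2 r ^+ 2.

Definition friction_const (m : field) (C : R) : Prop :=
  forall e, space_V e -> h1norm T2 (proj_on m e) ^+ 2 <= C * norm_V e ^+ 2.

Definition rational_direction (a : pt) : Prop :=
  exists l : int * int, [/\ l != (0, 0), coprimez l.1 l.2 &
    exists sg : bool,
      perp a = ((-1) ^+ sg / enorm (l.1%:~R, l.2%:~R)) *:
               ((l.1%:~R, l.2%:~R) : R * R)].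

End Plane.

Arguments pt : clear implicits.
Arguments field : clear implicits.

(* Main.v *)
Require Import Defs.
From HB Require Import structures.
From mathcomp Require Import all_boot all_order all_algebra.
From mathcomp Require Import all_classical all_reals all_analysis.
From mathcomp Require Import ess_sup_inf measurable_realfun.
From mathcomp Require Import ring lra.
Import Order.TTheory GRing.Theory Num.Theory.
Import numFieldNormedType.Exports.
Local Open Scope classical_set_scope.
Local Open Scope ring_scope.

(** Let [e = v - u].  Subtract the two equations and pair the difference with [e]
in H.  The Stokes term gives [nu |grad e|^2]; the inertial terms leave only
[b(e, u, e)], because [B(v,v) - B(u,u) = B(v,e) + B(e,u)] and [b(v, e, e) = 0]
for a divergence-free [v] ([transport_int0], [advection_ip]).  For almost every
time this reads ([energy_identity])

  (e_t, e) = - nu |grad e|^2 - b(e, u, e) - mu |e . a|^2.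

Since the shear defect of a constant direction is zero, the estimate that
defines [K_m] applies at almost every time.  It bounds
[b(e, u, e)] by half of the dissipation plus
[A_*/2 (1 + log (1 + X)) |e . a|^2], with [X] the ratio of the squared H^1 and
L^2 norms of [e . a].  By concavity [log (1 + X) <= log (1 + X0) + X / X0];
for [X0 = 2 C_fr A_* / nu] the first part together with the 1 is what [mu >= B_*/2]
pays for, and the second part, through the friction constant, costs another
quarter of the dissipation ([ln_gain], [dissipation]).  Poincare's inequality
turns the remaining quarter into [(e_t, e) <= - nu lambda_1 / 4 |e|^2], and
the exponential decay follows.

Three points have to be settled from the definitions.

Integration by parts for weak derivatives.  The trigonometric system is
complete ([trig_complete]); testing against products of trigonometric functions
therefore shows that a function with a weak derivative is absolutely continuous
on almost every line parallel to the corresponding axis ([wd_abscont]).  The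
product rule, integration by parts and the embedding of H^1 into L^4
([H1_L4]), which makes [b] integrable, are then one-dimensional facts combined
with Fubini's theorem.

The energy as a function of time.  Only the distributional derivative of [u]
and [v] with values in H is given.  For a fixed [w] in H it yields
[(e(t) - e(s), w)] as the integral of [(e_t, w)] ([increment]).  Taking
[w = e(t) + e(s)] gives [|e(t)|^2 - |e(s)|^2], and on a short interval this [w]
is [2 e(r)] up to an error that continuity in H makes small; a Gronwall
inequality which tolerates such errors ([gronwall_local]) concludes
([energy_decay]).

The covering.  With [perp a = +- l / |l|] and [l] primitive, Bezout's identity
completes [+- l] to an integer matrix of determinant one.  It induces a
diffeomorphism of the torus, that is a covering with a single sheet, and its
second column is [|l| perp a] ([rational_covering]). *)

Set Implicit Arguments.
Unset Strict Implicit.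
Unset Printing Implicit Defensive.

(** * Smooth functions of one variable and their tensor products *)

Section smooth1.
Context {R : realType}.
Implicit Types f g : R -> R.

(** Recursion through the first derivative rather than through iterated
derivatives, so that the closure properties below are inductions on [n] for all
functions at once. *)
Fixpoint Cn (n : nat) f : Prop :=
  if n is m.+1 then (forall x, derivable f x 1) /\ Cn m (derive1 f) else True.

Definition smooth1 f := forall n, Cn n f.

Lemma CnW n f : Cn n.+1 f -> Cn n f.
Proof. by elim: n f => [|n IH] f //= [df [ddf ?]]; split => //; apply: IH. Qed.

(** The form in which smoothness is asked of test functions in time. *)
Lemma smooth1P f : smooth1 f <-> forall k t, derivable (derive1n k f) t 1.
Proof.
split=> [sf k t|H n].
  have {sf}: Cn k.+1 f by exact: sf.
  elim: k f => [|k IH] f; first by case.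
  by move=> [df cf]; rewrite derive1Sn; exact: IH.
elim: n f H => [//|n IH] f H; split; first exact: (H 0%N).
by apply: IH => k t; rewrite -derive1Sn.
Qed.

Lemma smooth1_derivable f x : smooth1 f -> derivable f x 1.
Proof. by move=> /(_ 1%N)[]. Qed.

Lemma smooth1_continuous f : smooth1 f -> continuous f.
Proof.
move=> sf x; apply/differentiable_continuous/derivable1_diffP.
exact: smooth1_derivable.
Qed.

Lemma smooth1_derive f : smooth1 f -> smooth1 (derive1 f).
Proof. by move=> sf n; case: (sf n.+1). Qed.

Lemma smooth1_derive1n f k : smooth1 f -> smooth1 (derive1n k f).
Proof. by move=> sf; elim: k => [//|k IH]; rewrite derive1nS; exact: smooth1_derive. Qed.

Lemma derive1_fun f (df : R -> R) : (forall x : R, is_derive x 1 f (df x)) -> (derive1 f) = df.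
Proof. by move=> H; apply/funext => x; rewrite derive1E derive_val. Qed.

Lemma Cn_intro n f (df : R -> R) : (forall x : R, is_derive x 1 f (df x)) -> Cn n df -> Cn n.+1 f.
Proof.
by move=> H Hdf; split; [move=> x; apply: ex_derive; exact: H|rewrite (derive1_fun H)].
Qed.

Lemma is_derive_Cn n f : Cn n.+1 f -> forall x : R, is_derive x 1 f ((derive1 f) x).
Proof. by move=> [df _] x; rewrite derive1E; exact: derivableP. Qed.

Lemma Cn_cst n (c : R) : Cn n (fun=> c).
Proof.
elim: n c => [//|n IH] c; apply: (@Cn_intro _ _ (fun=> 0)) => //.
Qed.

Lemma Cn_id n : Cn n (fun x : R => x).
Proof.
case: n => [//|n]; apply: (@Cn_intro _ _ (fun=> 1)); last exact: Cn_cst.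
Qed.

Lemma Cn_add n f g : Cn n f -> Cn n g -> Cn n (fun x => f x + g x).
Proof.
elim: n f g => [//|n IH] f g Hf Hg.
apply: (@Cn_intro _ _ (fun x => (derive1 f) x + (derive1 g) x)); last by apply: IH; [case: Hf|case: Hg].
move=> x; have ? := is_derive_Cn Hf x; have ? := is_derive_Cn Hg x.
exact: is_deriveD.
Qed.

Lemma Cn_mul n f g : Cn n f -> Cn n g -> Cn n (fun x => f x * g x).
Proof.
elim: n f g => [//|n IH] f g Hf Hg.
apply: (@Cn_intro _ _ (fun x => f x * (derive1 g) x + g x * (derive1 f) x)).
  move=> x; have ? := is_derive_Cn Hf x; have ? := is_derive_Cn Hg x.
  exact: is_deriveM.
by apply: Cn_add; apply: IH => //; try exact: CnW; [case: Hg|case: Hf].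
Qed.

Lemma Cn_comp n f g : Cn n f -> Cn n g -> Cn n (fun x => f (g x)).
Proof.
elim: n f g => [//|n IH] f g Hf Hg.
apply: (@Cn_intro _ _ (fun x => (derive1 f) (g x) * (derive1 g) x)).
  move=> x; have ? := is_derive_Cn Hf (g x); have ? := is_derive_Cn Hg x.
  exact: is_derive1_comp.
apply: Cn_mul; last by case: Hg.
by apply: IH; [case: Hf|exact: CnW].
Qed.

Lemma smooth1_cst (c : R) : smooth1 (fun=> c). Proof. by move=> n; exact: Cn_cst. Qed.
Lemma smooth1_id : smooth1 (fun x : R => x). Proof. by move=> n; exact: Cn_id. Qed.
Lemma smooth1_add f g : smooth1 f -> smooth1 g -> smooth1 (fun x => f x + g x).
Proof. by move=> sf sg n; exact: Cn_add. Qed.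
Lemma smooth1_mul f g : smooth1 f -> smooth1 g -> smooth1 (fun x => f x * g x).
Proof. by move=> sf sg n; exact: Cn_mul. Qed.
Lemma smooth1_comp f g : smooth1 f -> smooth1 g -> smooth1 (fun x => f (g x)).
Proof. by move=> sf sg n; exact: Cn_comp. Qed.

Lemma smooth1_cos_sin : smooth1 (@cos R) /\ smooth1 (@sin R).
Proof.
suff H n : Cn n (@cos R) /\ Cn n (@sin R) by split=> n; case: (H n).
elim: n => [//|n [Hc Hs]]; split.
  apply: (@Cn_intro _ _ (fun x => (-1) * sin x)); last exact: Cn_mul (Cn_cst _ _) Hs.
  by move=> x; apply: is_derive_eq; rewrite mulN1r.
by apply: (@Cn_intro _ _ (@cos R)) => // x; exact: is_derive_sin.
Qed.

Lemma smooth1_cosM k : smooth1 (fun x : R => cos (k * x)).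
Proof.
apply: smooth1_comp; first by case: smooth1_cos_sin.
exact: smooth1_mul (smooth1_cst _) smooth1_id.
Qed.

Lemma smooth1_sinM k : smooth1 (fun x : R => sin (k * x)).
Proof.
apply: smooth1_comp; first by case: smooth1_cos_sin.
exact: smooth1_mul (smooth1_cst _) smooth1_id.
Qed.

End smooth1.

Section smooth2.
Context {R : realType}.
Implicit Types (f g : R -> R) (p : pt R).

Lemma crd_lineareq i (h : R) (v x : pt R) : crd i (h *: v + x) = h * crd i v + crd i x.
Proof. by rewrite /crd; case: ifP. Qed.

(** A directional derivative in the plane is the derivative of a function of one
variable along a line, to which the chain rule on R applies. *)
Lemma is_derive_crd f i (p v : pt R) : derivable f (crd i p) 1 ->
  is_derive p v (fun q => f (crd i q)) (crd i v * (derive1 f) (crd i p)).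
Proof.
move=> df.
have H : is_derive (0 : R) 1 (fun h : R => f (crd i (h *: v + p))) (crd i v * (derive1 f) (crd i p)).
  have -> : (fun h : R => f (crd i (h *: v + p))) = f \o (fun h : R => h * crd i v + crd i p).
    by apply/funext => h /=; rewrite crd_lineareq.
  have Hi : is_derive (0 : R) 1 (fun h : R => h * crd i v + crd i p) (crd i v).
    have -> : (fun h : R => h * crd i v + crd i p) = (crd i v \*: id) + cst (crd i p).
      by apply/funext => h /=; rewrite mulrC.
    have : is_derive (0 : R) (1 : R) ((crd i v \*: (@id R)) + cst (crd i p)) (crd i v *: (1 : R) + 0).
      exact: is_deriveD.
    by rewrite addr0 /GRing.scale/= mulr1.
  have Hf : is_derive ((fun h : R => h * crd i v + crd i p) 0) 1 f ((derive1 f) (crd i p)).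
    rewrite mul0r add0r derive1E; exact: derivableP.
  by rewrite mulrC; exact: is_derive1_comp.
have dv : derivable (fun q => f (crd i q)) p v by apply/derivable1P; exact: ex_derive.
split=> //.
rewrite -(@derive_val _ _ _ _ _ _ _ H) /derive /=.
match goal with |- lim (?X @ _) = lim (?Y @ _) => have -> : X = Y end => //.
apply/funext => h.
by rewrite !crd_lineareq /= !addr0 !mul0r add0r /GRing.scale/= mulr1.
Qed.

Lemma continuous_crd i : continuous (crd i : pt R -> R).
Proof.
by rewrite /crd => p; case: (i == 0); [exact: cvg_fst|exact: cvg_snd].
Qed.

Lemma crd_ebase i j : crd i (ebase j : pt R) = (i == j)%:R.
Proof. by rewrite /crd /ebase /mkpt; case: i => [[|[|]]] //= ?; case: j => [[|[|]]] //= ?. Qed.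

Definition tens f g (p : pt R) : R := f p.1 * g p.2.

Lemma is_derive_tens f g (p v : pt R) : smooth1 f -> smooth1 g ->
  is_derive p v (tens f g) (v.1 * derive1 f p.1 * g p.2 + v.2 * f p.1 * derive1 g p.2).
Proof.
move=> sf sg.
have Hf := @is_derive_crd f 0 p v (smooth1_derivable (x:=_) sf).
have Hg := @is_derive_crd g 1 p v (smooth1_derivable (x:=_) sg).
have H := is_deriveM Hf Hg.
have -> : tens f g = (fun q => f (crd 0 q)) * (fun q => g (crd 1 q)) by [].
apply: (is_derive_eq H).
by rewrite /crd /= /GRing.scale/=; ring.
Qed.

(** Partial derivatives keep the product form, which reduces smoothness in the plane
to smoothness of the two factors. *)
Lemma pder_tens f g s : smooth1 f -> smooth1 g ->
  pder s (tens f g) =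
  tens (derive1n (count (pred1 0) s) f) (derive1n (count (pred1 1) s) g).
Proof.
move=> sf sg; elim: s => [//|j s /= ->]; apply/funext => p.
have := @is_derive_tens _ _ p (ebase j) (smooth1_derive1n (count (pred1 0) s) sf)
  (smooth1_derive1n (count (pred1 1) s) sg).
move=> H; rewrite derive_val /tens /ebase /mkpt /=.
rewrite -!derive1nS.
by case: j {H} => [[|[|]]] //= j; rewrite ?add0n ?add1n; ring.
Qed.

Lemma smooth2_tens f g : smooth1 f -> smooth1 g -> smooth2 (tens f g).
Proof.
move=> sf sg s; rewrite pder_tens//; split=> [p|j p].
  apply: (@cvgM _ _ _ _ (fun q : pt R => derive1n _ f q.1) (fun q => derive1n _ g q.2)).
    apply: (@continuous_comp _ _ _ fst); first exact: cvg_fst.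
    exact/smooth1_continuous/smooth1_derive1n.
  apply: (@continuous_comp _ _ _ snd); first exact: cvg_snd.
  exact/smooth1_continuous/smooth1_derive1n.
have := @is_derive_tens _ _ p (ebase j) (smooth1_derive1n (count (pred1 0) s) sf)
  (smooth1_derive1n (count (pred1 1) s) sg).
by move=> H; exact: ex_derive.
Qed.

End smooth2.

(** * Integrals of real-valued functions *)

Section ae.
Context d (T : measurableType d) (R : realType) (m : {measure set T -> \bar R}).
Implicit Types P Q : T -> Prop.

Lemma aeS P Q : {ae m, forall x, P x} -> (forall x, P x -> Q x) -> {ae m, forall x, Q x}.
Proof. by move=> H PQ; apply: filterS H. Qed.

Lemma aeS2 P Q S : {ae m, forall x, P x} -> {ae m, forall x, Q x} ->
  (forall x, P x -> Q x -> S x) -> {ae m, forall x, S x}.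
Proof. by move=> HP HQ PQ; apply: filterS2 HP HQ. Qed.

End ae.

Section integrability.
Context d (T : measurableType d) (R : realType) (m : {measure set T -> \bar R}).
Variables (D : set T) (mD : measurable D).
Implicit Types f g h : T -> R.

Local Notation intb f := (m.-integrable D (EFin \o f)).

Lemma intb_meas f : intb f -> measurable_fun D f.
Proof. by move=> /measurable_int /measurable_EFinP. Qed.

Lemma ae_forall_nat (P : nat -> T -> Prop) :
  (forall n, {ae m, forall x, P n x}) -> {ae m, forall x, forall n, P n x}.
Proof.
move=> H.
have /(negligibleS _) := negligible_bigcup (fun n => H n); apply.
move=> x /= /existsNP[n Pn]; by exists n.
Qed.

Lemma ae_forall_ord k (P : 'I_k -> T -> Prop) :
  (forall n, {ae m, forall x, P n x}) -> {ae m, forall x, forall n, P n x}.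
Proof.
move=> H.
have : {ae m, forall x, forall n : nat, forall h : (n < k)%N, P (Ordinal h) x}.
  apply: ae_forall_nat => n; case: (pselect (n < k)%N) => h; last by apply: aeW => x h'; case: h.
  by apply: filterS (H (Ordinal h)) => x Px h'; rewrite (bool_irrelevance h' h).
by apply: filterS => x Px [n h].
Qed.

Lemma intb_le f g : measurable_fun D f -> (forall x, D x -> `|f x| <= g x) ->
  intb g -> intb f.
Proof.
move=> mf fg gi; apply: (le_integrable mD _ _ gi); first exact/measurable_EFinP.
by move=> x Dx; rewrite lee_fin (le_trans (fg x Dx))// ler_norm.
Qed.

Lemma intb_le_ae f g : measurable_fun D f ->
  {ae m, forall x, D x -> `|f x| <= g x} -> intb g -> intb f.
Proof.
move=> mf fg /integrableP[mg ig]; apply/integrableP; split; first exact/measurable_EFinP.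
apply: le_lt_trans ig; apply: ae_ge0_le_integral => //.
- by apply/measurableT_comp => //; exact/measurable_EFinP.
- by apply/measurableT_comp.
- apply: filterS fg => x /[apply]; rewrite /= !lee_fin => /le_trans; apply.
  exact: ler_norm.
Qed.

Lemma intb_ae f g : measurable_fun D f ->
  {ae m, forall x, D x -> f x = g x} -> intb g -> intb f.
Proof.
move=> mf fg ig; apply: (@intb_le_ae f (fun x => `|g x|)) => //.
  by apply: filterS fg => x /[apply] ->.
exact: integrable_norm.
Qed.

Lemma Rint_ae f g : measurable_fun D f -> measurable_fun D g ->
  {ae m, forall x, D x -> f x = g x} ->
  \int[m]_(x in D) f x = \int[m]_(x in D) g x.
Proof.
move=> mf mg fg; congr fine; apply: ae_eq_integral => //; try exact/measurable_EFinP.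
by apply: filterS fg => x /[apply] ->.
Qed.

Lemma intbD f g : intb f -> intb g -> intb (fun x => f x + g x).
Proof. by move=> fi gi; have := integrableD mD fi gi. Qed.

Lemma intbB f g : intb f -> intb g -> intb (fun x => f x - g x).
Proof. by move=> fi gi; have := integrableB mD fi gi. Qed.

Lemma intbZ c f : intb f -> intb (fun x => c * f x).
Proof. by move=> fi; have := integrableZl mD c fi. Qed.

Lemma intbN f : intb f -> intb (fun x => - f x).
Proof. by move=> fi; have := integrableN fi. Qed.

Lemma intb0 : intb (fun=> 0).
Proof. exact: integrable0. Qed.

Lemma intb_sum k (F : 'I_k -> T -> R) : (forall i, intb (F i)) ->
  intb (fun x => \sum_(i < k) F i x).
Proof.
move=> H; elim: k F H => [|k IH] F H.
  by under eq_fun do rewrite big_ord0; exact: intb0.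
under eq_fun do rewrite big_ord_recr /=.
by apply: intbD => //; apply: IH.
Qed.

Lemma Rint_sum k (F : 'I_k -> T -> R) : (forall i, intb (F i)) ->
  \int[m]_(x in D) (\sum_(i < k) F i x) = \sum_(i < k) \int[m]_(x in D) F i x.
Proof.
move=> H; elim: k F H => [|k IH] F H.
  rewrite big_ord0; under eq_Rintegral do rewrite big_ord0.
  by rewrite /Rintegral integral0.
rewrite big_ord_recr /= -IH//.
under eq_Rintegral do rewrite big_ord_recr /=.
by rewrite RintegralD//; exact: intb_sum.
Qed.

Lemma RintN f : intb f -> \int[m]_(x in D) (- f x) = - \int[m]_(x in D) f x.
Proof.
move=> fi; under eq_Rintegral do rewrite -mulN1r.
by rewrite RintegralZl// mulN1r.
Qed.

Lemma intb_cst c : (m D < +oo)%E -> intb (fun=> c).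
Proof.
move=> mDoo; apply: measurable_bounded_integrable => //.
by exists `|c|; split; [exact: num_real|move=> M cM x _; exact: ltW].
Qed.

Lemma intb_bd f M : (m D < +oo)%E -> measurable_fun D f ->
  (forall x, D x -> `|f x| <= M) -> intb f.
Proof. by move=> mDoo mf fM; apply: (intb_le mf fM); exact: intb_cst. Qed.

Lemma intbM_bd f g M : intb f -> measurable_fun D g ->
  (forall x, D x -> `|g x| <= M) -> intb (fun x => f x * g x).
Proof.
move=> fi mg gM; apply: (@intb_le _ (fun x => M * `|f x|)).
- by apply: measurable_funM => //; exact: intb_meas.
- by move=> x Dx; rewrite normrM mulrC ler_wpM2r// gM.
- by apply: intbZ; exact: integrable_norm.
Qed.

Lemma Rint_dct (fn : nat -> T -> R) f g : (forall n, measurable_fun D (fn n)) ->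
  intb g -> (forall n x, D x -> `|fn n x| <= g x) ->
  (forall x, D x -> fn n x @[n --> \oo] --> f x) ->
  intb f /\ \int[m]_(x in D) fn n x @[n --> \oo] --> \int[m]_(x in D) f x.
Proof.
move=> mfn gi fg fnf.
have mf : measurable_fun D f by apply: (measurable_fun_cvg mfn).
have [] := @dominated_convergence _ _ _ m D mD (fun n => EFin \o fn n) (EFin \o f) (EFin \o g).
- by move=> n; exact/measurable_EFinP.
- exact/measurable_EFinP.
- by apply: aeW => x Dx; apply/fine_cvgP; split; [exact: nearW|exact: fnf].
- exact: gi.
- by apply: aeW => x Dx n; rewrite lee_fin fg.
move=> fi _ H; split=> //.
rewrite /Rintegral; apply: fine_cvg.
by rewrite fineK ?integrable_fin_num.
Qed.

End integrability.

(** * Fubini's theorem along lines parallel to the axes *)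

Section lines.
Context {R : realType}.
Notation mu := (@lebesgue_measure R).
Implicit Types (f g : pt R -> R) (P : pt R -> Prop) (j : 'I_2).

(** The first argument runs in direction [j], the second one is the transverse
coordinate: each statement about lines covers both directions. *)
Definition line j (s r : R) : pt R := if j == 0 then (s, r) else (r, s).

Lemma measurable_line j r : measurable_fun setT (fun s : measurableTypeR R => line j s r).
Proof. by rewrite /line; case: (j == 0); exact: measurable_fun_pair. Qed.

Lemma measurable_line_comp j f r : measurable_fun setT f ->
  measurable_fun setT (fun s => f (line j s r)).
Proof. by move=> mf; apply: (measurableT_comp mf); exact: measurable_line. Qed.

Lemma tonelli_line j (F : pt R -> \bar R) : measurable_fun setT F ->
  (forall p, 0 <= F p)%E ->
  (measurable_fun setT (fun r => \int[mu]_s F (line j s r)) /\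
  \int[leb2]_p F p = \int[mu]_r \int[mu]_s F (line j s r))%E.
Proof.
move=> mF F0; rewrite /line; case: (j == 0).
  split; first exact: (@measurable_fun_fubini_tonelli_G _ _ _ _ R mu F mF F0).
  exact: (@fubini_tonelli2 _ _ _ _ R mu mu F mF F0).
split; first exact: (@measurable_fun_fubini_tonelli_F _ _ _ _ R mu F mF F0).
exact: (@fubini_tonelli1 _ _ _ _ R mu mu F mF F0).
Qed.

Lemma ae_line j P : {ae leb2, forall p, P p} ->
  {ae mu, forall r, {ae mu, forall s, P (line j s r)}}.
Proof.
move=> [N [mN N0 PN]].
have m1 : measurable_fun [set: pt R] (fun p => (\1_N p : R)%:E) by exact/measurable_EFinP.
have p1 (p : pt R) : (0 <= (\1_N p : R)%:E)%E by rewrite lee_fin.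
have [mI] := tonelli_line j m1 p1.
have -> : (\int[leb2]_p (\1_N p : R)%:E = 0)%E by rewrite integral_indic// setIT; exact: N0.
move=> /esym I0.
have [+ _] := @ae_eq_integral_abs _ _ R mu setT measurableT _ mI.
have -> : (\int[mu]_r `|\int[mu]_s (\1_N (line j s r))%:E| = 0)%E.
  rewrite -[RHS]I0; apply: eq_integral => r _; rewrite gee0_abs//.
  by apply: integral_ge0 => s _; rewrite lee_fin.
move=> /(_ erefl); apply: filterS => r /(_ I) /= Ir.
have mNr : measurable ((line j ^~ r) @^-1` N).
  by rewrite -[X in measurable X]setTI; exact: (@measurable_line j r).
exists ((line j ^~ r) @^-1` N); split => //.
- have := @integral_indic _ _ _ mu setT measurableT _ mNr.
  by rewrite setIT => <-; exact: Ir.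
- by move=> s /= nP; apply: PN.
Qed.

(** Passing from null slices back to a null set goes through Tonelli's theorem,
whence the measurability of [A]. *)
Lemma line_ae j (D : set R) (A : set (pt R)) : measurable D -> measurable A ->
  {ae mu, forall r, D r -> {ae mu, forall s, D s -> ~ A (line j s r)}} ->
  {ae leb2, forall p, (D `*` D) p -> ~ A p}.
Proof.
move=> mD mA H.
have mB : measurable (A `&` (D `*` D)) by apply: measurableI => //; exact: measurableX.
exists (A `&` (D `*` D)); split => //; last first.
  by move=> p /= /not_implyP[Dp /contrapT Ap].
have m1 : measurable_fun [set: pt R] (fun p => (\1_(A `&` (D `*` D)) p : R)%:E).
  exact/measurable_EFinP.
have p1 (p : pt R) : (0 <= (\1_(A `&` (D `*` D)) p : R)%:E)%E by rewrite lee_fin.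
have [mI] := tonelli_line j m1 p1.
rewrite integral_indic// setIT => E; apply: etrans E _.
transitivity (\int[mu]_r (cst 0 : R -> \bar R) r)%E; last by rewrite integral0.
apply: ge0_ae_eq_integral => //.
  by move=> x _; apply: integral_ge0 => s _; rewrite lee_fin.
apply: (aeS H) => r Hr _ /=.
have [Dr|nDr] := pselect (D r); last first.
  rewrite (eq_integral (cst 0%E)) ?integral0// => s _.
  rewrite indicE memNset// => -[_].
  by rewrite /line; case: (j == 0) => -[].
transitivity (\int[mu]_s (cst 0 : R -> \bar R) s)%E; last by rewrite integral0.
apply: ge0_ae_eq_integral; [by []| |by []| |by []|].
- apply/measurable_EFinP.
  exact: (@measurable_line_comp j (\1_(A `&` (D `*` D)) : pt R -> R)).
- by move=> x _; rewrite lee_fin.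
apply: (aeS (Hr Dr)) => s Hs _ /=.
rewrite indicE memNset// => -[+ Ds].
by apply: Hs; move: Ds; rewrite /line; case: (j == 0) => -[].
Qed.

Section fubini_line.
Variables (j : 'I_2) (D : set R).
Hypothesis mD : measurable D.
Variable f : pt R -> R.
Hypothesis fi : leb2.-integrable (D `*` D) (EFin \o f).

Let F : pt R -> \bar R := (EFin \o f) \_ (D `*` D).

Let Fi : leb2.-integrable setT F.
Proof. by apply/(integrable_mkcond _ _).1 => //; exact: measurableX. Qed.

Let Fline r : D r -> (fun s => F (line j s r)) = (EFin \o (fun s => f (line j s r))) \_ D.
Proof.
move=> Dr; apply/funext => s; rewrite /F /patch /line.
have -> : ((if j == 0 then (s, r) else (r, s)) \in D `*` D) = (s \in D).
  by case: (j == 0); apply/idP/idP; rewrite !inE /= => //; case.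
by [].
Qed.

Let FlineN r : ~ D r -> (fun s => F (line j s r)) = cst 0%E.
Proof.
move=> Dr; apply/funext => s; rewrite /F /patch /line memNset//.
by case: (j == 0) => -[].
Qed.

Lemma ae_integrable_line :
  {ae mu, forall r, D r -> mu.-integrable D (EFin \o (fun s => f (line j s r)))}.
Proof.
have : {ae mu, forall r, mu.-integrable setT (fun s => F (line j s r))}.
  by rewrite /line; case: (j == 0); [exact: (ae_integrable2 Fi)|exact: (ae_integrable1 Fi)].
move=> H0; apply: (aeS H0) => r + Dr; rewrite Fline// => H.
by have [_ K] := @integrable_mkcond _ _ R mu D (EFin \o (fun s => f (line j s r))) mD; exact: (K H).
Qed.

Let G r := (\int[mu]_s F (line j s r))%E.

Let Gi : mu.-integrable setT G.
Proof.
have mF := measurable_int _ Fi.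
have maF : measurable_fun setT (abse \o F) by exact: measurableT_comp.
have [mI I] := tonelli_line j maF (fun p => abse_ge0 _).
apply/integrableP; split.
  rewrite /G /line; case: (j == 0); first exact: (measurable_fubini_G Fi).
  exact: (measurable_fubini_F Fi).
have /integrableP[_] := Fi.
rewrite (_ : (\int[leb2]_x `|F x|)%E = \int[leb2]_p (abse \o F) p)%E// I.
apply: le_lt_trans; apply: ge0_le_integral => //.
- apply: measurableT_comp => //.
  rewrite /G /line; case: (j == 0); first exact: (measurable_fubini_G Fi).
  exact: (measurable_fubini_F Fi).
- move=> r _; apply: le_abse_integral => //.
  by apply: (measurableT_comp mF); exact: measurable_line.
Qed.

Let GE r : D r -> G r = (\int[mu]_(s in D) (f (line j s r))%:E)%E.
Proof. by move=> Dr; rewrite /G Fline// [RHS]integral_mkcond. Qed.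

Let Gfin : {ae mu, forall r, D r -> G r = (\int[mu]_(s in D) f (line j s r))%:E}.
Proof.
apply: (aeS ae_integrable_line) => r + Dr => /(_ Dr) H.
by rewrite GE// /Rintegral fineK// integrable_fin_num.
Qed.

Lemma integrable_Rint_line :
  mu.-integrable D (EFin \o (fun r => \int[mu]_(s in D) f (line j s r))).
Proof.
have GiD : mu.-integrable D G by exact: integrableS Gi.
have /integrableP[mG iG] := GiD.
have mF : measurable_fun D (fun r => \int[mu]_(s in D) f (line j s r)).
  apply: (@eq_measurable_fun _ _ _ _ D (fine \o G)).
    by move=> r; rewrite inE => Dr /=; rewrite GE.
  by apply: measurableT_comp => //; exact: (measurable_int _ GiD).
apply/integrableP; split; first exact/measurable_EFinP.
apply: le_lt_trans iG; apply: ae_ge0_le_integral => //.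
- by apply: measurableT_comp => //; exact/measurable_EFinP.
- exact: measurableT_comp.
- by apply: (aeS Gfin) => r /[apply] ->.
Qed.

Lemma Rfubini_line :
  \int[leb2]_(p in D `*` D) f p = \int[mu]_(r in D) \int[mu]_(s in D) f (line j s r).
Proof.
transitivity (fine (\int[leb2]_p F p)%E).
  by rewrite /Rintegral integral_mkcond.
have -> : (\int[leb2]_p F p = \int[mu]_r G r)%E.
  rewrite /G /line; case: (j == 0); last by rewrite -(integral12_prod_meas1 Fi).
  by rewrite -(integral21_prod_meas1 Fi).
rewrite /Rintegral.
congr fine; rewrite [RHS]integral_mkcond; apply: ae_eq_integral => //.
- by have /measurable_int := Gi.
- have [K _] := @integrable_mkcond _ _ R mu D
    (EFin \o (fun r => \int[mu]_(s in D) f (line j s r))) mD.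
  have := measurable_int _ (K integrable_Rint_line).
  by [].
apply: (aeS Gfin) => r Hr _.
rewrite /patch; case: ifPn; first by move=> /set_mem/Hr.
by move=> /negP; rewrite inE => nDr; rewrite /G FlineN// integral0.
Qed.

End fubini_line.
End lines.

(** * Completeness of the trigonometric system *)

Section exp_moments.
Context d (T : measurableType d) (R : realType) (m : {measure set T -> \bar R}).
Variables (D : set T) (mD : measurable D).
Implicit Types h P : T -> R.

Lemma series_exp_le (M y : R) n : `|y| <= M -> `|series (exp_coeff y) n| <= expR M.
Proof.
move=> yM; apply: (@le_trans _ _ (series (exp_coeff M) n)).
  rewrite /series /= (le_trans (ler_norm_sum _ _ _))// ler_sum// => k _.
  rewrite /exp_coeff /= normrM normrX normfV normr_nat.
  by rewrite ler_wpM2r ?invr_ge0// lerXn2r// nnegrE// (le_trans _ yM).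
apply: nondecreasing_cvgn_le; last exact: is_cvg_series_exp_coeff.
apply/nondecreasing_seqP => k.
rewrite /series /= big_nat_recr//= lerDl.
by apply: exp_coeff_ge0; rewrite (le_trans _ yM).
Qed.

(** The exponential series converges boundedly, so that vanishing moments against
the powers of [P] pass to [expR P].  Used twice, this reaches double exponentials of
trigonometric polynomials without a density theorem. *)
Lemma exp_moments h P M : m.-integrable D (EFin \o h) -> measurable_fun D P ->
  (forall x, D x -> `|P x| <= M) ->
  (forall j : nat, \int[m]_(x in D) (h x * P x ^+ j) = 0) ->
  \int[m]_(x in D) (h x * expR (P x)) = 0.
Proof.
move=> hi mP PM H.
pose fn n x := h x * series (exp_coeff (P x)) n.
have mXP k : measurable_fun D (fun x => P x ^+ k) by exact: measurable_funX.
have hPi k : m.-integrable D (EFin \o (fun x => h x * P x ^+ k)).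
  apply: (@intbM_bd _ _ _ _ _ mD _ _ (M ^+ k)) => // x Dx.
  by rewrite normrX lerXn2r// ?nnegrE ?PM// (le_trans _ (PM x Dx)).
have fnE n x : fn n x = \sum_(k < n) (k`!%:R)^-1 * (h x * P x ^+ k).
  rewrite /fn /series /= big_mkord mulr_sumr; apply: eq_bigr => k _.
  by rewrite /exp_coeff /= mulrA mulrC.
have In n : \int[m]_(x in D) fn n x = 0.
  under eq_Rintegral do rewrite fnE.
  rewrite Rint_sum//; last by move=> i; exact: intbZ.
  by rewrite big1// => i _; rewrite RintegralZl// H mulr0.
have [||||_] := @Rint_dct _ _ _ m D mD fn (fun x => h x * expR (P x)) (fun x => `|h x| * expR M).
- move=> n; rewrite (_ : fn n = (fun x => \sum_(k < n) (k`!%:R)^-1 * (h x * P x ^+ k))).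
    by apply: measurable_sum => k; apply: measurable_funM => //; exact: (intb_meas (hPi k)).
  by apply/funext => x; exact: fnE.
- have := intbZ mD (expR M) (integrable_norm hi).
  by apply: eq_integrable => // x _; rewrite /= mulrC.
- by move=> n x Dx; rewrite /fn normrM ler_wpM2l// series_exp_le// PM.
- move=> x Dx; apply: cvgM; first exact: cvg_cst.
  exact: is_cvg_series_exp_coeff.
rewrite (_ : (fun n => _) = cst 0); last by apply/funext.
by move=> /cvg_lim <-//; rewrite lim_cst.
Qed.
End exp_moments.

Section trig.
Context {R : realType}.
Notation mu := (@lebesgue_measure R).
Local Notation I := (`[0, 2 * pi[%classic : set R).

Lemma measurable_I : @measurable _ (measurableTypeR R) I. Proof. exact: measurable_itv. Qed.

Lemma mu_I : (mu I < +oo)%E.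
Proof. by rewrite lebesgue_measure_itv /=; case: ifP => _; rewrite -?EFinB ltry. Qed.

Lemma measurable_cosD (D : set R) (k t : R) : measurable_fun D (fun x => cos (k * x + t)).
Proof.
apply: measurable_funTS; apply: continuous_measurable_fun; apply: smooth1_continuous.
apply: smooth1_comp; first by case: (@smooth1_cos_sin R).
apply: smooth1_add; last exact: smooth1_cst.
exact: smooth1_mul (smooth1_cst _) (@smooth1_id _).
Qed.

Variable h : R -> R.
Hypothesis hi : mu.-integrable I (EFin \o h).
Hypothesis hc : forall k : nat, \int[mu]_(x in I) (h x * cos (k%:R * x)) = 0.
Hypothesis hs : forall k : nat, \int[mu]_(x in I) (h x * sin (k%:R * x)) = 0.

Let hcosi (k t : R) : mu.-integrable I (EFin \o (fun x => h x * cos (k * x + t))).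
Proof.
apply: (@intbM_bd _ _ _ mu I measurable_I h (fun x => cos (k * x + t)) 1) => //.
  exact: measurable_cosD.
by move=> x _; exact: cos_max.
Qed.

Let hcos_nat (k : nat) (t : R) : \int[mu]_(x in I) (h x * cos (k%:R * x + t)) = 0.
Proof.
have ic : mu.-integrable I (EFin \o (fun x => h x * cos (k%:R * x))).
  have := hcosi k%:R 0; apply: eq_integrable => //.
  by move=> x _; rewrite /= addr0.
have is_ : mu.-integrable I (EFin \o (fun x => h x * sin (k%:R * x))).
  have := hcosi k%:R (- (pi / 2)); apply: eq_integrable => //.
  by move=> x _; rewrite /= cosBpihalf.
transitivity (\int[mu]_(x in I) (cos t * (h x * cos (k%:R * x)) - sin t * (h x * sin (k%:R * x)))).
  by apply: eq_Rintegral => x _; rewrite cosD; ring.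
have mI := measurable_I.
rewrite RintegralB//; [|exact: intbZ|exact: intbZ].
by rewrite !RintegralZl// hc hs !mulr0 subrr.
Qed.

Let hcos (k : int) (t : R) : \int[mu]_(x in I) (h x * cos (k%:~R * x + t)) = 0.
Proof.
case: k => k; first exact: hcos_nat.
rewrite -[RHS](hcos_nat k.+1 (- t)); apply: eq_Rintegral => x _.
by rewrite NegzE -[in RHS]cosN opprD opprK mulrNz mulNr.
Qed.

Let moments (a b g : R) (j : nat) : forall (k : int) (t : R),
  mu.-integrable I (EFin \o (fun x => h x * (a + b * cos (x - g)) ^+ j * cos (k%:~R * x + t))) /\
  \int[mu]_(x in I) (h x * (a + b * cos (x - g)) ^+ j * cos (k%:~R * x + t)) = 0.
Proof.
elim: j => [|j IH] k t.
  split.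
    have := hcosi k%:~R t; apply: eq_integrable => //.
    by move=> x _ /=; rewrite expr0 mulr1.
  by rewrite -[RHS](hcos k t); apply: eq_Rintegral => x _; rewrite expr0 mulr1.
pose X k t x := h x * (a + b * cos (x - g)) ^+ j * cos (k%:~R * x + t).
have E x : h x * (a + b * cos (x - g)) ^+ j.+1 * cos (k%:~R * x + t) =
    a * X k t x + (b / 2 * X (k + 1) (t - g) x + b / 2 * X (k - 1) (t + g) x).
  have -> : b / 2 * X (k + 1) (t - g) x + b / 2 * X (k - 1) (t + g) x =
    h x * (a + b * cos (x - g)) ^+ j * (b / 2 * (cos ((k%:~R * x + t) + (x - g)) + cos ((k%:~R * x + t) - (x - g)))).
    rewrite /X !intrD !mulrDl /=.
    have -> : k%:~R * x + 1 * x + (t - g) = k%:~R * x + t + (x - g) by ring.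
    have -> : k%:~R * x + (-1)%:~R * x + (t + g) = k%:~R * x + t - (x - g) by ring.
    ring.
  rewrite /X exprSr; move: (k%:~R * x + t) (x - g) => y z.
  by rewrite cosD cosB; field.
have i1 := (IH k t).1; have i2 := (IH (k + 1) (t - g)).1; have i3 := (IH (k - 1) (t + g)).1.
split.
  have := intbD measurable_I (intbZ measurable_I a i1)
     (intbD measurable_I (intbZ measurable_I (b / 2) i2) (intbZ measurable_I (b / 2) i3)).
  by apply: eq_integrable => // x _ /=; rewrite E.
under eq_Rintegral do rewrite E.
have mI := measurable_I.
rewrite RintegralD//; [|exact: intbZ|by apply: intbD => //; exact: intbZ].
rewrite RintegralD//; [|exact: intbZ|exact: intbZ].
by rewrite !RintegralZl// (IH k t).2 (IH (k + 1) (t - g)).2 (IH (k - 1) (t + g)).2 !mulr0 !addr0.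
Qed.

Let mP (a b g : R) : measurable_fun I (fun x => a + b * cos (x - g)).
Proof.
apply: measurable_funD => //; apply: measurable_funM => //.
have := @measurable_cosD I 1 (- g).
by apply: eq_measurable_fun => x _; rewrite mul1r.
Qed.

Let bP (a b g x : R) : `|a + b * cos (x - g)| <= `|a| + `|b|.
Proof.
by rewrite (le_trans (ler_normD _ _))// lerD2l normrM ler_piMr// cos_max.
Qed.

Let exp1 (a b g : R) : \int[mu]_(x in I) (h x * expR (a + b * cos (x - g))) = 0.
Proof.
apply: (@exp_moments _ _ _ mu I measurable_I h (fun x => a + b * cos (x - g)) (`|a| + `|b|));
  [exact: hi|exact: mP|by move=> x _; exact: bP|move=> j].
rewrite -[RHS](moments a b g j 0 0).2; apply: eq_Rintegral => x _.
by rewrite mul0r add0r cos0 mulr1.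
Qed.

Let exp2 (a b g : R) : \int[mu]_(x in I) (h x * expR (- expR (a + b * cos (x - g)))) = 0.
Proof.
apply: (@exp_moments _ _ _ mu I measurable_I h
  (fun x => - expR (a + b * cos (x - g))) (expR (`|a| + `|b|))); first exact: hi.
- apply: measurableT_comp => //; apply: measurableT_comp; last exact: mP.
  exact: measurable_expR.
- move=> x _; rewrite normrN ger0_norm ?expR_ge0// ler_expR.
  exact: le_trans (ler_norm _) (bP _ _ _ _).
move=> j.
have mI := measurable_I.
transitivity ((-1) ^+ j * \int[mu]_(x in I) (h x * expR (j%:R * a + j%:R * b * cos (x - g)))).
  rewrite -RintegralZl//; last first.
    apply: (@intbM_bd _ _ _ mu I measurable_I h
      (fun x => expR (j%:R * a + j%:R * b * cos (x - g))) (expR (`|j%:R * a| + `|j%:R * b|))); first exact: hi.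
      by apply: measurableT_comp; [exact: measurable_expR|exact: mP].
    move=> x _; rewrite ger0_norm ?expR_ge0// ler_expR.
    exact: le_trans (ler_norm _) (bP _ _ _ _).
  apply: eq_Rintegral => x _.
  rewrite [(- expR _) ^+ j]exprNn -expRM_natl mulrDr [j%:R * (b * _)]mulrA.
  by rewrite mulrCA.
by rewrite exp1 mulr0.
Qed.

(** Within a period this product of sines is positive exactly between [p] and [q], and it is
a trigonometric polynomial of degree one, within reach of the moments of [h]. *)
Lemma sin_arc (p q x : R) :
  sin ((x - p) / 2) * sin ((q - x) / 2) = (cos (x - (p + q) / 2) - cos ((q - p) / 2)) / 2.
Proof.
have -> : x - (p + q) / 2 = (x - p) / 2 - (q - x) / 2 by field.
have -> : (q - p) / 2 = (x - p) / 2 + (q - x) / 2 by field.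
move: ((x - p) / 2) ((q - x) / 2) => y z.
by rewrite cosB cosD; field.
Qed.

Lemma sin_arc_le0 (p q x : R) : 0 <= p -> p < q -> q <= 2 * pi -> I x -> ~ `]p, q[%classic x ->
  sin ((x - p) / 2) * sin ((q - x) / 2) <= 0.
Proof.
move=> p0 pq q2 /=; rewrite !in_itv/= => /andP[x0 x2] /negP; rewrite negb_and -!leNgt => /orP[xp|qx].
  rewrite -[(x - p) / 2]opprK sinN mulNr oppr_le0 mulr_ge0//; apply: sin_ge0_pi; lra.
rewrite -[(q - x) / 2]opprK sinN mulrN oppr_le0 mulr_ge0//; apply: sin_ge0_pi; lra.
Qed.

Lemma sin_arc_gt0 (p q x : R) : 0 <= p -> p < q -> q <= 2 * pi -> `]p, q[%classic x ->
  0 < sin ((x - p) / 2) * sin ((q - x) / 2).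
Proof.
move=> p0 pq q2 /=; rewrite !in_itv/= => /andP[x0 x2].
by rewrite mulr_gt0//; apply: sin_gt0_pi; lra.
Qed.

(** The term [n] in the exponent decides the borderline case [t = 0], in which the
limit is 0. *)
Lemma cvg_expexp (t : R) :
  expR (- expR (n%:R - n%:R ^+ 2 * t)) @[n --> \oo] --> ((0 < t)%R%:R : R).
Proof.
have [t0|t0] := ltP 0 t; last first.
  apply: (@squeeze_cvgr _ _ _ _ (fun=> 0) (fun n : nat => expR (- n%:R))).
  - apply: nearW => n; rewrite expR_ge0/= ler_expR lerN2.
    apply: (@le_trans _ _ (expR n%:R)); first by rewrite (le_trans _ (expR_ge1Dx _))// lerDr.
    rewrite ler_expR lerBrDl gerDr.
    by rewrite mulr_ge0_le0// exprn_ge0.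
  - exact: cvg_cst.
  - exact: cvgn_expR.
apply: (@squeeze_cvgr _ _ _ _ (fun n : nat => 1 - expR (- n%:R)) (fun=> 1)).
- near=> n; rewrite expR_le1 oppr_le0 expR_ge0 andbT.
  apply: le_trans (expR_ge1Dx _); rewrite lerD2l lerN2 ler_expR.
  have : 2 / t <= n%:R by near: n; exact: nbhs_infty_ger.
  rewrite ler_pdivrMr// => nt.
  rewrite expr2 -mulrA -{1}[n%:R]mulr1 -mulrBr -[X in _ <= X]mulrN1 ler_wpM2l//; lra.
- rewrite -[X in _ --> X]subr0; apply: cvgB; [exact: cvg_cst|exact: cvgn_expR].
- exact: cvg_cst.
Unshelve. all: by end_near. Qed.

Let arc0 (p q : R) : 0 <= p -> p < q -> q <= 2 * pi -> \int[mu]_(x in `]p, q[) h x = 0.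
Proof.
move=> p0 pq q2.
have sub : `]p, q[ `<=` I.
  move=> x /=; rewrite !in_itv/= => /andP[px xq].
  by rewrite (le_trans p0 (ltW px)) (lt_le_trans xq q2).
pose t (x : R) := sin ((x - p) / 2) * sin ((q - x) / 2).
(* By [sin_arc], [n - n^2 t] has the form [a + b cos (x - g)] of the moments. *)
pose A (n : nat) := n%:R + n%:R ^+ 2 * cos ((q - p) / 2) / 2 : R.
pose B (n : nat) := - (n%:R ^+ 2 / 2) : R.
have tE n x : n%:R - n%:R ^+ 2 * t x = A n + B n * cos (x - (p + q) / 2).
  by rewrite /t sin_arc /A /B; field.
have mE n : measurable_fun I (fun x => expR (- expR (n%:R - n%:R ^+ 2 * t x))).
  apply: measurableT_comp; first exact: measurable_expR.
  apply: measurableT_comp => //; apply: measurableT_comp; first exact: measurable_expR.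
  have := mP (A n) (B n) ((p + q) / 2).
  by apply: eq_measurable_fun => x _; rewrite tE.
have [||||_] := @Rint_dct _ _ _ mu I measurable_I
  (fun n x => h x * expR (- expR (n%:R - n%:R ^+ 2 * t x)))
  (fun x => h x * \1_`]p, q[ x) (fun x => `|h x|).
- by move=> n; apply: measurable_funM; [exact: (intb_meas hi)|exact: mE].
- exact: integrable_norm.
- move=> n x _; rewrite normrM; apply: ler_piMr => //.
  by rewrite (ger0_norm (expR_ge0 _)) expR_le1 oppr_le0 expR_ge0.
- move=> x Ix; apply: cvgM; first exact: cvg_cst.
  rewrite indicE; have [xpq|xpq] := pselect (`]p, q[%classic x).
    rewrite mem_set//; have := @cvg_expexp (t x).
    by rewrite sin_arc_gt0.
  rewrite memNset//; have := @cvg_expexp (t x).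
  by rewrite ltNge sin_arc_le0.
have -> : (fun n : nat => \int[mu]_(x in I) (h x * expR (- expR (n%:R - n%:R ^+ 2 * t x)))) = cst 0.
  by apply/funext => n; under eq_Rintegral do rewrite tE; exact: exp2.
move=> /cvg_lim; rewrite lim_cst// => /(_ (@Rhausdorff R)) E.
rewrite -(setIidr sub) Rintegral_mkcondr [RHS]E.
apply: eq_Rintegral => x _; rewrite /patch indicE.
by case: ifP; rewrite ?mulr1 ?mulr0.
Qed.

(** Orthogonality to cosines and sines passes to the powers of [a + b cos (x - g)],
then to their exponentials and double exponentials, whose limits include the
indicators of arcs.  The integrals of [h] over arcs therefore vanish, and
Lebesgue's differentiation theorem concludes. *)
Lemma trig_complete : {ae mu, forall x, I x -> h x = 0}.
Proof.
pose f := h \_ I.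
have fi : mu.-integrable setT (EFin \o f).
  have [K _] := @integrable_mkcond _ _ R mu I (EFin \o h) measurable_I.
  by have := K hi; rewrite restrict_EFin.
have F0 x : 0 < x -> x < 2 * pi -> \int[mu]_(t in `]-oo, x]) f t = 0.
  move=> x0 x2; rewrite /f -Rintegral_mkcondr.
  have -> : `]-oo, x] `&` I = `[0, x]%classic.
    apply/seteqP; split => y /=; rewrite !in_itv/=.
      by move=> [yx /andP[-> _]].
    by move=> /andP[y0 yx]; rewrite yx y0 (le_lt_trans yx x2).
  have i1 : mu.-integrable `[0, x[ (EFin \o h).
    apply: integrableS hi => //.
    by move=> y /=; rewrite !in_itv/= => /andP[-> /lt_trans]; apply.
  rewrite -Rintegral_itv_bndo_bndc// -Rintegral_itv_obnd_cbnd; last first.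
    apply: integrableS i1 => //.
    by move=> y /=; rewrite !in_itv/= => /andP[] /ltW -> ->.
  by apply: arc0 => //; exact: ltW.
have HF := @FTC1Ny R f.
have H1 : {ae mu, forall x : R, derivable (fun x : R => \int[mu]_(t in `]-oo, x]) f t) x 1 /\
    derive1 (fun x : R => \int[mu]_(t in `]-oo, x]) f t) x = f x}.
  apply: HF; first by move=> y; exact: integrableS fi.
  exact: integrable_locally.
have H2 : {ae mu, forall x : R, x != 0}.
  exists [set 0]; split => //; first exact: lebesgue_measure_set1.
  by move=> x /= /negP; rewrite negbK => /eqP.
apply: (aeS2 H1 H2) => x [_ dF] x0 Ix.
have : f x = h x by rewrite /f patchE mem_set.
move=> <-; rewrite -dF derive1E.
transitivity ('D_1 (cst 0 : R -> R) x); last exact: derive_cst.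
apply: near_eq_derive.
move: Ix; rewrite /= in_itv/= => /andP[x1 x2].
have {}x1 : 0 < x by rewrite lt_def x0.
near=> y; apply: F0; near: y.
- exact: lt_nbhsr.
- exact: lt_nbhsl.
Unshelve. all: by end_near. Qed.

End trig.

(** * Absolutely continuous functions on a period *)

Section tensor.
Context {R : realType}.
Notation mu := (@lebesgue_measure R).

Lemma integrable_tensor (D : set R) (f g : R -> R) :
  @measurable _ (measurableTypeR R) D ->
  mu.-integrable D (EFin \o f) -> mu.-integrable D (EFin \o g) ->
  leb2.-integrable (D `*` D) (EFin \o (fun p : pt R => f p.1 * g p.2)).
Proof.
move=> mD fi gi.
have mDD : measurable (D `*` D) by exact: measurableX.
have [K _] := @integrable_mkcond _ _ R mu D (EFin \o f) mD.
have [K' _] := @integrable_mkcond _ _ R mu D (EFin \o g) mD.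
have {K}fi := K fi; have {K'}gi := K' gi.
rewrite !restrict_EFin in fi gi.
have [_] := @integrable_mkcond _ _ R leb2 (D `*` D) (EFin \o (fun p : pt R => f p.1 * g p.2)) mDD.
apply; rewrite restrict_EFin.
have -> : (fun p : pt R => f p.1 * g p.2) \_ (D `*` D) =
   (fun p => (f \_ D) p.1 * (g \_ D) p.2).
  apply/funext => p; rewrite /patch.
  have [p1|p1] := boolP (p.1 \in D); have [p2|p2] := boolP (p.2 \in D);
    rewrite ?mulr0 ?mul0r.
  - by rewrite mem_set//; split; exact: set_mem.
  - by rewrite memNset// => -[_ /mem_set]; rewrite (negbTE p2).
  - by rewrite memNset// => -[/mem_set]; rewrite (negbTE p1).
  - by rewrite memNset// => -[/mem_set]; rewrite (negbTE p1).
move: (f \_ D) (g \_ D) fi gi => {}f {}g fi gi.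
have mf := intb_meas fi; have mg := intb_meas gi.
have mfg : measurable_fun [set: pt R] (fun p => f p.1 * g p.2).
  by apply: measurable_funM;
    [apply: (measurableT_comp mf); exact: measurable_fst
    |apply: (measurableT_comp mg); exact: measurable_snd].
have [_] := @integrable21ltyP _ _ _ _ R mu mu (EFin \o (fun p : pt R => f p.1 * g p.2))
  ((measurable_EFinP _ _).2 mfg).
apply.
have /integrableP[_ ifoo] := fi; have /integrableP[_ igoo] := gi.
have E y : (\int[mu]_x `|(EFin \o (fun p : pt R => (f p.1 * g p.2)%R)) (x, y)| =
    (\int[mu]_x `|(f x)%:E|) * `|(g y)%:E|)%E.
  rewrite -ge0_integralZr//.
  - by apply: eq_integral => x _; rewrite /= -EFinM normrM.
  - by apply: measurableT_comp => //; exact/measurable_EFinP.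
under eq_integral do rewrite E.
rewrite ge0_integralZl//.
- by apply: lte_mul_pinfty => //; [exact: integral_ge0|rewrite ge0_fin_numE//; exact: integral_ge0].
- by apply: measurableT_comp => //; exact/measurable_EFinP.
- exact: integral_ge0.
Qed.

End tensor.

Section abscont.
Context {R : realType}.
Notation mu := (@lebesgue_measure R).
Local Notation L := (2 * pi : R).
Local Notation I := (`[0, 2 * pi[%classic : set R).
Implicit Types f g : R -> R.

Definition prim g (s : R) : R := \int[mu]_(x in `[0, s[) g x.

(** Absolute continuity on a period, as the validity of the fundamental theorem of
calculus, the derivative [g] being carried along. *)
Definition abscont f g := mu.-integrable I (EFin \o g) /\
  forall s, 0 <= s <= L -> f s = f 0 + prim g s.

Lemma L_gt0 : 0 < L. Proof. by rewrite mulr_gt0// pi_gt0. Qed.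

Lemma prim0 g : prim g 0 = 0.
Proof. by rewrite /prim set_itv_ge ?bnd_simp// Rintegral_set0. Qed.

Lemma abscont_prim g : mu.-integrable I (EFin \o g) -> abscont (prim g) g.
Proof. by move=> gi; split => // s _; rewrite prim0 add0r. Qed.

Lemma intb_sub g (s : R) : s <= L -> mu.-integrable I (EFin \o g) ->
  mu.-integrable `[0, s[ (EFin \o g).
Proof.
move=> sL; apply: integrableS => // x /=; rewrite !in_itv/= => /andP[-> xs].
exact: lt_le_trans xs sL.
Qed.

Lemma prim_bound g s : 0 <= s <= L -> mu.-integrable I (EFin \o g) ->
  `|prim g s| <= \int[mu]_(x in I) `|g x|.
Proof.
move=> /andP[s0 sL] gi; rewrite /prim.
apply: le_trans (le_normr_Rintegral _ _) _ => //; first exact: intb_sub.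
rewrite /Rintegral fine_le//.
- by apply: integrable_fin_num => //; apply: integrable_norm; exact: intb_sub.
- by apply: integrable_fin_num => //; exact: integrable_norm.
- apply: ge0_subset_integral => //.
    by apply/measurable_EFinP; apply: measurableT_comp => //; exact: (intb_meas gi).
  move=> x /=; rewrite !in_itv/= => /andP[-> xs].
  exact: lt_le_trans xs sL.
Qed.

Lemma measurable_prim g : mu.-integrable I (EFin \o g) ->
  measurable_fun I (prim g).
Proof.
move=> gi.
have gi' : mu.-integrable `[0, L] (EFin \o g).
  have [_] := @integrable_mkcond _ _ R mu `[0, L] (EFin \o g) (measurable_itv _).
  apply.
  have [K _] := @integrable_mkcond _ _ R mu I (EFin \o g) (@measurable_I R).
  have := K gi; rewrite !restrict_EFin => H.
  apply: (@intb_ae _ _ _ mu setT measurableT (g \_ `[0, L]) (g \_ I)) => //.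
    have [_ KU] := @measurable_funU _ _ (measurableTypeR R) (measurableTypeR R) I [set L] g
      (@measurable_I R) (measurable_set1 L).
    have [KR _] := @measurable_restrictT _ _ (measurableTypeR R) (measurableTypeR R)
      `[0, L] g (measurable_itv _).
    apply: KR; rewrite -(@setUitv1 _ _ (BLeft 0) L true); last by rewrite bnd_simp ltW// L_gt0.
    by apply: KU; split; [exact: (intb_meas gi)|exact: measurable_fun_set1].
  exists [set L]; split => //; first exact: lebesgue_measure_set1.
  move=> x /= /not_implyP[_]; rewrite /patch => H'; apply: contrapT => xL; apply: H'.
  have -> // : (x \in `[0, L]%classic) = (x \in I).
  apply/idP/idP; rewrite !inE/= !in_itv/= => /andP[-> //].
    by rewrite lt_neqAle => ->; rewrite andbT; apply/eqP.
  by move=> /ltW.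
have c := @parameterized_integral_continuous R 0 L g (ltW L_gt0) gi'.
have mc := subspace_continuous_measurable_fun (measurable_itv _) c.
apply: (@eq_measurable_fun _ _ _ _ I (fun x => parameterized_integral mu 0 x g)).
  move=> s; rewrite inE/= in_itv/= => /andP[s0 sL].
  by rewrite /prim /parameterized_integral -Rintegral_itv_bndo_bndc//; apply: intb_sub => //; exact: ltW.
apply: (measurable_funS _ _ mc); first exact: measurable_itv.
by move=> x /=; rewrite !in_itv/= => /andP[-> /ltW].
Qed.

Lemma abscont_meas f g : abscont f g -> measurable_fun I f.
Proof.
move=> [gi fg]; apply: (@eq_measurable_fun _ _ _ _ I (fun s => f 0 + prim g s)).
  by move=> s; rewrite inE/= in_itv/= => /andP[s0 /ltW sL]; rewrite [f s]fg ?s0 ?sL//.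
by apply: measurable_funD => //; exact: measurable_prim.
Qed.

Lemma abscont_bound f g s : abscont f g -> 0 <= s <= L ->
  `|f s| <= `|f 0| + \int[mu]_(x in I) `|g x|.
Proof.
move=> [gi fg] s0; rewrite [f s]fg// (le_trans (ler_normD _ _))// lerD2l.
exact: prim_bound.
Qed.

Lemma I_itv (s : R) : I s -> 0 <= s <= L.
Proof. by rewrite /= in_itv/= => /andP[-> /ltW]. Qed.

(** The product rule in integrated form: Fubini's theorem on a square of side [s],
cut along its diagonal. *)
Lemma prim_mul f g (s : R) : 0 <= s <= L ->
  mu.-integrable I (EFin \o f) -> mu.-integrable I (EFin \o g) ->
  \int[mu]_(x in `[0, s[) (f x * prim g x) + \int[mu]_(x in `[0, s[) (prim f x * g x)
  = prim f s * prim g s.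
Proof.
move=> /andP[s0 sL] fi gi.
set J := `[0, s[%classic.
have mJ : @measurable _ (measurableTypeR R) J by exact: measurable_itv.
have mJJ : measurable (J `*` J) by exact: measurableX.
have fJ := intb_sub sL fi; have gJ := intb_sub sL gi.
pose F (p : pt R) := f p.1 * g p.2.
have Fi : leb2.-integrable (J `*` J) (EFin \o F) by exact: integrable_tensor.
(* Indicator of the half of the square below the diagonal. *)
pose c (p : pt R) : R := (p.2 < p.1)%R%:R.
have mc : measurable_fun [set: pt R] c.
  apply: (measurableT_comp (f := fun b : bool => b%:R : R)) => //.
  by apply: measurable_fun_ltr; [exact: measurable_snd|exact: measurable_fst].
have F1 : leb2.-integrable (J `*` J) (EFin \o (fun p => F p * c p)).
  apply: (@intbM_bd _ _ _ leb2 _ mJJ F c 1) => //.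
    exact: measurable_funTS.
  by move=> p _; rewrite /c; case: (p.2 < p.1); rewrite ?normr1 ?normr0.
have F2 : leb2.-integrable (J `*` J) (EFin \o (fun p => F p * (1 - c p))).
  apply: (@intbM_bd _ _ _ leb2 _ mJJ F (fun p => 1 - c p) 1) => //.
    by apply: measurable_funTS; apply: measurable_funB.
  by move=> p _; rewrite /c; case: (p.2 < p.1); rewrite ?subrr ?subr0 ?normr1 ?normr0.
have : \int[leb2]_(p in J `*` J) F p =
       \int[leb2]_(p in J `*` J) (F p * c p) + \int[leb2]_(p in J `*` J) (F p * (1 - c p)).
  rewrite -RintegralD//; apply: eq_Rintegral => p _; ring.
rewrite (@Rfubini_line R 0 J mJ F)// (@Rfubini_line R 1 J mJ _ F1) (@Rfubini_line R 0 J mJ _ F2).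
rewrite /line /= /F /=.
have -> : \int[mu]_(r in J) \int[mu]_(s in J) (f s * g r) = prim f s * prim g s.
  under eq_Rintegral do rewrite RintegralZr//.
  by rewrite RintegralZl.
move=> ->; congr (_ + _).
- apply: eq_Rintegral => x; rewrite inE /J /= in_itv/= => /andP[x0 xs].
  rewrite /c /=.
  transitivity (\int[mu]_(y in J) (f x * (g \_ `[0, x[) y)).
    rewrite RintegralZl//; last first.
      have [K _] := @integrable_restrict _ _ R mu `[0, x[ (measurable_itv _) J mJ (EFin \o g).
      rewrite -restrict_EFin; apply: K; apply: integrableS gJ => //.
      exact: measurableI.
    rewrite -Rintegral_mkcondr; congr (_ * _).
    have -> // : J `&` `[0, x[ = `[0, x[%classic.
    by rewrite setIidr// => y; rewrite /J /= !in_itv/= => /andP[-> /lt_trans]; apply.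
  apply: eq_Rintegral => y; rewrite inE /J /= in_itv/= => /andP[y0 ys].
  rewrite /patch mem_setE in_itv/= y0 /=.
  by case: (y < x); rewrite ?mulr1 ?mulr0.
- apply: eq_Rintegral => y; rewrite inE /J /= in_itv/= => /andP[y0 ys].
  rewrite /c /=.
  transitivity (\int[mu]_(x in J) ((f \_ `[0, y]) x * g y)).
    rewrite RintegralZr//; last first.
      have [K _] := @integrable_restrict _ _ R mu `[0, y] (measurable_itv _) J mJ (EFin \o f).
      rewrite -restrict_EFin; apply: K; apply: integrableS fJ => //.
      exact: measurableI.
    rewrite -Rintegral_mkcondr; congr (_ * _).
    have -> : J `&` `[0, y] = `[0, y]%classic.
      by rewrite setIidr// => x; rewrite /J /= !in_itv/= => /andP[-> /le_lt_trans]; apply.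
    rewrite -Rintegral_itv_bndo_bndc//.
    by apply: intb_sub => //; exact: le_trans (ltW ys) sL.
  apply: eq_Rintegral => x; rewrite inE /J /= in_itv/= => /andP[x0 xs].
  rewrite /patch mem_setE in_itv/= x0 /= [x <= y]leNgt.
  by case: (y < x); rewrite /= ?subrr ?subr0 ?mulr1 ?mulr0 ?mul0r.
Qed.

Lemma abscont_intM f g g' : mu.-integrable I (EFin \o f) -> abscont g g' ->
  mu.-integrable I (EFin \o (fun s => f s * g s)).
Proof.
move=> fi acg.
apply: (@intbM_bd _ _ _ mu I (@measurable_I R) f g (`|g 0| + \int[mu]_(x in I) `|g' x|)) => //.
  exact: (abscont_meas acg).
by move=> s /I_itv; exact: abscont_bound.
Qed.

Lemma abscont_mul f f' g g' : abscont f f' -> abscont g g' ->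
  abscont (fun s => f s * g s) (fun s => f' s * g s + f s * g' s).
Proof.
move=> acf acg; have [f'i fE] := acf; have [g'i gE] := acg.
have i1 := abscont_intM f'i acg.
have i2 : mu.-integrable I (EFin \o (fun s => f s * g' s)).
  by have := abscont_intM g'i acf; apply: eq_integrable => // s _ /=; rewrite mulrC.
split; first by apply: intbD => //; exact: measurable_I.
move=> s sL; have /andP[s0 sL'] := sL.
have sub t : `[0, s[%classic t -> 0 <= t <= L.
  rewrite /= in_itv/= => /andP[-> ts] /=; exact: le_trans (ltW ts) sL'.
have j1 := intb_sub sL' (abscont_intM f'i (abscont_prim g'i)).
have j2 : mu.-integrable `[0, s[ (EFin \o (fun t => prim f' t * g' t)).
  have := intb_sub sL' (abscont_intM g'i (abscont_prim f'i)).
  by apply: eq_integrable => // t _ /=; rewrite mulrC.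
have k1 := intb_sub sL' f'i; have k2 := intb_sub sL' g'i.
have mJ : @measurable _ (measurableTypeR R) `[0, s[ by exact: measurable_itv.
transitivity ((f 0 + prim f' s) * (g 0 + prim g' s)); first by rewrite fE// gE.
rewrite [prim (fun s => _ + _) s](_ : _ = \int[mu]_(t in `[0, s[)
   ((g 0 * f' t + f 0 * g' t) + (f' t * prim g' t + prim f' t * g' t))); last first.
  apply: eq_Rintegral => t /set_mem/sub tL; rewrite fE// gE//; ring.
rewrite RintegralD//; last 2 first.
- by apply: intbD => //; exact: intbZ.
- exact: intbD.
rewrite RintegralD//; [|exact: intbZ|exact: intbZ].
rewrite RintegralD// prim_mul// !RintegralZl// /prim; ring.
Qed.

Lemma abscont_int0 f g : abscont f g -> f 0 = f L -> \int[mu]_(x in I) g x = 0.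
Proof.
move=> [gi fE] f0; have := fE L; rewrite ltW ?L_gt0// lexx => /(_ isT).
by rewrite -f0 -{1}[f 0]addr0 => /addrI /esym.
Qed.

Lemma abscont_ae f g g' : abscont f g -> measurable_fun I g' ->
  {ae mu, forall x, I x -> g' x = g x} -> abscont f g'.
Proof.
move=> [gi fE] mg' gg'; split; first exact: intb_ae gi.
move=> s sL; rewrite fE//; congr (_ + _); have /andP[_ sL'] := sL.
have sub x : `[0, s[%classic x -> I x.
  by rewrite /= !in_itv/= => /andP[-> /lt_le_trans]; apply.
apply: Rint_ae => //.
- exact: (intb_meas (intb_sub sL' gi)).
- exact: measurable_funS mg'.
- by apply: (aeS gg') => x H /sub /H.
Qed.

Lemma abscont_smooth f : smooth1 f -> abscont f (derive1 f).
Proof.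
move=> sf.
have cf' := smooth1_continuous (smooth1_derive sf).
have fi : mu.-integrable `[0, L] (EFin \o derive1 f).
  apply: continuous_compact_integrable; first exact: segment_compact.
  exact: continuous_subspaceT.
split.
  apply: integrableS fi => // x /=; rewrite !in_itv/= => /andP[-> /ltW//].
move=> s /andP[]; rewrite le_eqVlt => /predU1P[<- _|s0 sL]; first by rewrite prim0 addr0.
rewrite /prim Rintegral_itv_bndo_bndc; last first.
  apply: integrableS fi => // x /=; rewrite !in_itv/= => /andP[-> xs].
  exact: ltW (lt_le_trans xs sL).
rewrite /Rintegral (continuous_FTC2 s0 _ _ (F := f)) /=.
- by rewrite [RHS]addrC subrK.
- exact: continuous_subspaceT.
- split.
  + by move=> x _; exact: smooth1_derivable.
  + by apply: cvg_at_right_filter; exact: smooth1_continuous.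
  + by apply: cvg_at_left_filter; exact: smooth1_continuous.
- by [].
Qed.

(** [f s] is compared with all the values of [f] and the comparison is integrated,
which bounds a supremum by integrals. *)
Lemma abscont_sum_bound f g s : abscont f g -> 0 <= s <= L ->
  L * `|f s| <= \int[mu]_(x in I) `|f x| + L * \int[mu]_(x in I) `|g x|.
Proof.
move=> acf sL; have [gi fE] := acf.
have fi : mu.-integrable I (EFin \o f).
  apply: (@intb_bd _ _ _ mu I (@measurable_I R) f (`|f 0| + \int[mu]_(x in I) `|g x|)).
  - exact: mu_I.
  - exact: (abscont_meas acf).
  - by move=> t /I_itv; exact: abscont_bound.
have mI := @measurable_I R.
have cI c : \int[mu]_(x in I) c = L * c.
  rewrite Rintegral_cst//.
  have muI : mu I = L%:E.
    by have := @lebesgue_measure_itv R `[0, L[; rewrite /= lte_fin L_gt0 oppr0 adde0.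
  by rewrite mulrC; congr (_ * _); rewrite -[RHS]/(fine L%:E) -muI.
rewrite -!cI -RintegralD//; last 2 first.
- exact: integrable_norm.
- by apply: intb_cst => //; exact: mu_I.
apply: le_Rintegral => //.
- by apply: intb_cst => //; exact: mu_I.
- apply: intbD => //; first exact: integrable_norm.
  by apply: intb_cst => //; exact: mu_I.
move=> t /I_itv tL.
have : `|f s - f t| <= \int[mu]_(x in I) `|g x|.
  wlog st : s t sL tL / t <= s.
    by move=> H; have [/H|/ltW/H] := leP t s; [exact|rewrite distrC; exact].
  rewrite fE// (fE t tL) opprD addrACA subrr add0r /prim.
  have /andP[t0 _] := tL; have /andP[_ sL'] := sL.
  have -> : \int[mu]_(x in `[0, s[) g x - \int[mu]_(x in `[0, t[) g x = \int[mu]_(x in `[t, s[) g x.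
    rewrite (@itv_bndbnd_setU _ _ (BLeft 0) (BLeft t) (BLeft s)) ?bnd_simp//.
    rewrite Rintegral_setU//=; first by rewrite addrC addKr.
      rewrite -itv_bndbnd_setU ?bnd_simp//; exact: intb_sub.
    apply/disj_setPS => y [/=]; rewrite 2!in_itv/= => /andP[_ yx] /andP[].
    by rewrite leNgt yx.
  have sub : `[t, s[ `<=` I.
    move=> x /=; rewrite !in_itv/= => /andP[tx xs].
    by rewrite (le_trans t0 tx) (lt_le_trans xs sL').
  have gts : mu.-integrable `[t, s[ (EFin \o g) by exact: integrableS gi.
  apply: le_trans (le_normr_Rintegral _ _) _ => //.
  rewrite /Rintegral fine_le//.
  - by apply: integrable_fin_num => //; apply: integrable_norm.
  - by apply: integrable_fin_num => //; exact: integrable_norm.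
  - apply: ge0_subset_integral => //.
    by apply/measurable_EFinP; apply: measurableT_comp => //; exact: (intb_meas gi).
have := ler_normD (f s - f t) (f t); rewrite subrK => H1 H2.
by rewrite (le_trans H1)// addrC lerD2l.
Qed.

End abscont.

(** * Weak derivatives on the circle *)

Section trigs.
Context {R : realType}.
Notation mu := (@lebesgue_measure R).
Local Notation L := (2 * pi : R).
Local Notation I := (`[0, 2 * pi[%classic : set R).

Definition per1 (f : R -> R) := forall (x : R) (z : int), f (x + z%:~R * L) = f x.

Definition trig (b : bool) (k : nat) (x : R) : R :=
  if b then cos (k%:R * x) else sin (k%:R * x).

Lemma cos_sin_int (x : R) (z : int) : cos (x + z%:~R * L) = cos x /\ sin (x + z%:~R * L) = sin x.
Proof.
have H (n : nat) y : cos (y + n%:R * L) = cos y /\ sin (y + n%:R * L) = sin y.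
  elim: n y => [|n IH] y; first by rewrite mul0r addr0.
  have -> : y + n.+1%:R * L = y + n%:R * L + pi *+ 2 by rewrite -natr1; ring.
  by rewrite cosD2pi sinD2pi.
case: z => n; first exact: H.
have := H n.+1 (x + (Negz n)%:~R * L).
by rewrite NegzE mulrNz mulNr subrK => -[-> ->].
Qed.

Lemma per1_trig b k : per1 (trig b k).
Proof.
move=> x z; rewrite /trig.
have -> : k%:R * (x + z%:~R * L) = k%:R * x + (k%:Z * z)%:~R * L by rewrite intrM; ring.
by have [-> ->] := cos_sin_int (k%:R * x) (k%:Z * z).
Qed.

Lemma smooth1_trig b k : smooth1 (trig b k).
Proof. by case: b; [exact: smooth1_cosM|exact: smooth1_sinM]. Qed.

Lemma derive1_trig b k : derive1 (trig b k) =
  (fun x => (-1) ^+ b * k%:R * trig (~~ b) k x).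
Proof.
have lin (x : R) : is_derive x 1 (fun x : R => k%:R * x) k%:R.
  have : is_derive (x : R) (1 : R) (k%:R \*: (@id R)) (k%:R *: (1 : R)).
    exact: is_deriveZ.
  by rewrite /GRing.scale/= mulr1.
apply: derive1_fun => x; case: b.
  have -> : trig true k = cos \o (fun x : R => k%:R * x) by [].
  apply: (is_derive_eq (is_derive1_comp (is_derive_cos (k%:R * x)) (lin x))).
  by rewrite /trig /=; ring.
have -> : trig false k = sin \o (fun x : R => k%:R * x) by [].
apply: (is_derive_eq (is_derive1_comp (is_derive_sin (k%:R * x)) (lin x))).
by rewrite /trig /=; ring.
Qed.

Lemma trig_le1 b k x : `|trig b k x| <= 1.
Proof. by case: b; [exact: cos_max|exact: sin_max]. Qed.

Lemma trig_complete_bool (h : R -> R) : mu.-integrable I (EFin \o h) ->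
  (forall b k, \int[mu]_(x in I) (h x * trig b k x) = 0) ->
  {ae mu, forall x, I x -> h x = 0}.
Proof.
by move=> hi H; apply: (trig_complete hi) => k; [exact: (H true k)|exact: (H false k)].
Qed.

Lemma trig_2pi b k : trig b k 0 = trig b k L.
Proof. by rewrite -(per1_trig b k 0 1) add0r mul1r. Qed.

(** The difference between [f] and a primitive of [g] is orthogonal to every
nonconstant trigonometric function, since each one is the derivative of another;
by completeness it is constant.  The test with the constant function makes the
primitive periodic. *)
Lemma wd1_abscont (f g : R -> R) : mu.-integrable I (EFin \o f) -> mu.-integrable I (EFin \o g) ->
  (forall b k, \int[mu]_(x in I) (f x * derive1 (trig b k) x) =
             - \int[mu]_(x in I) (g x * trig b k x)) ->
  exists phi, [/\ abscont phi g, phi 0 = phi L & {ae mu, forall x, I x -> phi x = f x}].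
Proof.
move=> fi gi H.
have mI := @measurable_I R.
have acg := abscont_prim gi.
have g0 : prim g L = 0.
  have := H true 0%N; rewrite derive1_trig /trig.
  under eq_Rintegral do rewrite mulr0 mul0r mulr0.
  under [in RHS]eq_Rintegral do rewrite mul0r cos0 mulr1.
  by rewrite Rintegral_cst// mul0r => /esym/eqP; rewrite oppr_eq0 => /eqP.
pose h x := f x - prim g x.
have pgi : mu.-integrable I (EFin \o prim g).
  apply: (@intb_bd _ _ _ mu I mI (prim g) (\int[mu]_(x in I) `|g x|)).
  - exact: mu_I.
  - exact: measurable_prim.
  - by move=> x /I_itv xL; exact: prim_bound.
have hi : mu.-integrable I (EFin \o h) by exact: intbB.
have mtrig b k : measurable_fun I (trig b k).
  exact: (abscont_meas (abscont_smooth (smooth1_trig b k))).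
have itrig b k (u : R -> R) : mu.-integrable I (EFin \o u) ->
    mu.-integrable I (EFin \o (fun x => u x * trig b k x)).
  move=> ui; apply: (@intbM_bd _ _ _ mu I mI u (trig b k) 1);
    [exact: ui|exact: mtrig|by move=> x _; exact: trig_le1].
have idtrig b k (u : R -> R) : mu.-integrable I (EFin \o u) ->
    mu.-integrable I (EFin \o (fun x => u x * derive1 (trig b k) x)).
  move=> ui; rewrite derive1_trig.
  have := intbZ mI ((-1) ^+ b * k%:R) (itrig (~~ b) k u ui).
  by apply: eq_integrable => // x _ /=; congr (_%:E); ring.
have hd b k : \int[mu]_(x in I) (h x * derive1 (trig b k) x) = 0.
  have acm := abscont_mul acg (abscont_smooth (smooth1_trig b k)).
  have := abscont_int0 acm.
  rewrite g0 prim0 !mul0r => /(_ erefl).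
  rewrite RintegralD//; last 2 first.
  - exact: itrig.
  - exact: idtrig.
  move=> E.
  transitivity (\int[mu]_(x in I) (f x * derive1 (trig b k) x - prim g x * derive1 (trig b k) x)).
    by apply: eq_Rintegral => x _; rewrite /h mulrBl.
  rewrite RintegralB//; [|exact: idtrig|exact: idtrig].
  by rewrite H -opprD E oppr0.
have h0 b k : (0 < k)%N -> \int[mu]_(x in I) (h x * trig b k x) = 0.
  move=> k0; have := hd (~~ b) k; rewrite derive1_trig negbK => H0.
  transitivity (((-1) ^+ (~~ b) * k%:R)^-1 * \int[mu]_(x in I) (h x * ((-1) ^+ (~~ b) * k%:R * trig b k x))); last first.
    by rewrite H0 mulr0.
  rewrite -RintegralZl//; last first.
    have := idtrig (~~ b) k h hi; rewrite derive1_trig negbK.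
    by [].
  apply: eq_Rintegral => x _.
  have n0 : (-1) ^+ (~~ b) * k%:R != 0 :> R.
    by rewrite mulf_neq0 ?signr_eq0// pnatr_eq0 -lt0n.
  by rewrite (mulrCA (h x)) mulKf.
pose c := L^-1 * \int[mu]_(x in I) h x.
have i1 : mu.-integrable I (EFin \o (fun=> c)) by apply: intb_cst => //; exact: mu_I.
have hc : {ae mu, forall x, I x -> h x - c = 0}.
  apply: trig_complete_bool; first exact: intbB.
  move=> b k.
  transitivity (\int[mu]_(x in I) (h x * trig b k x - c * trig b k x)).
    by apply: eq_Rintegral => x _; rewrite mulrBl.
  have i2 : mu.-integrable I (EFin \o trig b k).
    apply: (@intb_bd _ _ _ mu I mI (trig b k) 1);
      [exact: mu_I|exact: mtrig|by move=> x _; exact: trig_le1].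
  rewrite RintegralB//; [|exact: itrig|exact: intbZ].
  rewrite RintegralZl//.
  have [->|k0] := posnP k; last first.
    rewrite h0// sub0r.
    have := abscont_int0 (abscont_smooth (smooth1_trig (~~ b) k)) (trig_2pi _ _).
    rewrite derive1_trig negbK RintegralZl// => /eqP.
    rewrite mulf_eq0 mulf_eq0 signr_eq0 pnatr_eq0 -leqn0 leqNgt k0 /= => /eqP ->.
    by rewrite mulr0 oppr0.
  case: b {i2} => /=.
    rewrite /trig; under eq_Rintegral do rewrite mul0r cos0 mulr1.
    under [X in _ - _ * X]eq_Rintegral do rewrite mul0r cos0.
    rewrite Rintegral_cst// mul1r.
    have -> : fine (mu I) = L.
      have muI : mu I = L%:E.
        by have := @lebesgue_measure_itv R `[0, L[; rewrite /= lte_fin L_gt0 oppr0 adde0.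
      by rewrite -[RHS]/(fine L%:E) -muI.
    rewrite /c mulrAC mulVf ?mul1r ?subrr//.
    by rewrite gt_eqF// L_gt0.
  rewrite /trig; under eq_Rintegral do rewrite mul0r sin0 mulr0.
  under [X in _ - _ * X]eq_Rintegral do rewrite mul0r sin0.
  by rewrite Rintegral_cst// mul0r mulr0 subrr.
exists (fun x => c + prim g x); split.
- by split => // x xL; rewrite prim0 addr0.
- by rewrite prim0 g0.
- by apply: (aeS hc) => x /[apply]/subr0_eq <-; rewrite /h subrK.
Qed.

End trigs.

(** * Weak derivatives on the torus, line by line *)

Section planar.
Context {R : realType}.
Notation mu := (@lebesgue_measure R).
Local Notation L := (2 * pi : R).
Local Notation I := (`[0, 2 * pi[%classic : set R).
Local Notation C := (cell (@T2 R)).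
Implicit Types (f g : pt R -> R) (j : 'I_2).

Lemma ord2_neq0 j : j != 0 -> j = 1.
Proof. by case: j => -[|[|]] // h _; apply/val_inj. Qed.

Definition oth j : 'I_2 := if j == 0 then 1 else 0.

Lemma crd_line j s r : crd j (line j s r : pt R) = s.
Proof. by rewrite /crd /line; case: (j == 0). Qed.

Lemma crd_oth_line j s r : crd (oth j) (line j s r : pt R) = r.
Proof. by rewrite /crd /line /oth; case: (j == 0). Qed.

Lemma measurable_C : @measurable _ (measurableTypeR R * measurableTypeR R)%type C.
Proof. by apply: measurableX; exact: measurable_itv. Qed.

Lemma leb2_C : (leb2 C < +oo)%E.
Proof.
have -> : leb2 C = (mu I * mu I)%E.
  by rewrite /leb2 /cell product_measure1E//; exact: measurable_I.
by rewrite lte_mul_pinfty// ?mu_I// ge0_fin_numE ?mu_I.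
Qed.

Definition tline j (a b : R -> R) (p : pt R) : R := a (crd j p) * b (crd (oth j) p).

Lemma tlineE j a b : tline j a b = if j == 0 then tens a b else tens b a.
Proof.
apply/funext => p; rewrite /tline /tens /crd /oth.
by case: (j == 0) => //=; rewrite mulrC.
Qed.

Lemma tequiv_crd i (p q : pt R) : tequiv T2 p q -> exists z : int, crd i p = crd i q + z%:~R * L.
Proof. by move=> [k ->]; rewrite /crd; case: (i == 0); [exists k.1|exists k.2]. Qed.

Lemma test_tline j a b : smooth1 a -> smooth1 b -> per1 a -> per1 b ->
  test_fun T2 (tline j a b).
Proof.
move=> sa sb pa pb; split.
  by rewrite tlineE; case: (j == 0); exact: smooth2_tens.
move=> p q pq; rewrite /tline.
have [z ->] := tequiv_crd j pq; have [z' ->] := tequiv_crd (oth j) pq.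
by rewrite pa pb.
Qed.

Lemma D_tline j a b p : smooth1 a -> smooth1 b ->
  'D_(ebase j) (tline j a b) p = derive1 a (crd j p) * b (crd (oth j) p).
Proof.
move=> sa sb; rewrite tlineE /crd /oth /ebase /mkpt.
have [->|j0] := eqVneq j 0.
  by have H := @is_derive_tens R a b p (1, 0) sa sb; rewrite derive_val /=; ring.
rewrite (ord2_neq0 j0).
by have H := @is_derive_tens R b a p (0, 1) sb sa; rewrite derive_val /=; ring.
Qed.

Lemma measurable_crd i : measurable_fun setT (crd i : pt R -> R).
Proof. by rewrite /crd; case: (i == 0); [exact: measurable_fst|exact: measurable_snd]. Qed.

Lemma measurable_smooth1 (a : R -> R) : smooth1 a -> measurable_fun setT a.
Proof. by move=> sa; apply: continuous_measurable_fun; exact: smooth1_continuous. Qed.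

(** How an identity on the torus is localized on almost every line: the integrals
along lines are orthogonal to a complete system in the transverse variable. *)
Lemma slice_int0 j (F : pt R -> R) : leb2.-integrable C (EFin \o F) ->
  (forall b k, \int[leb2]_(p in C) (F p * trig b k (crd (oth j) p)) = 0) ->
  {ae mu, forall r, I r -> \int[mu]_(s in I) F (line j s r) = 0}.
Proof.
move=> Fi H.
have mI := @measurable_I R.
have Hi := @integrable_Rint_line R j I mI F Fi.
apply: (trig_complete_bool Hi) => b k; rewrite -[RHS](H b k).
have mt : measurable_fun setT (fun p : pt R => trig b k (crd (oth j) p)).
  by apply: measurableT_comp; [apply: measurable_smooth1; exact: smooth1_trig|exact: measurable_crd].
have Fti : leb2.-integrable C (EFin \o (fun p => F p * trig b k (crd (oth j) p))).
  apply: (@intbM_bd _ _ _ leb2 C measurable_C F (fun p => trig b k (crd (oth j) p)) 1).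
  - exact: Fi.
  - exact: measurable_funTS.
  - by move=> p _; exact: trig_le1.
rewrite (@Rfubini_line R j I mI _ Fti).
have ae0 := @ae_integrable_line R j I mI F Fi.
apply: Rint_ae => //.
- apply: measurable_funM; first exact: (intb_meas Hi).
  exact: (abscont_meas (abscont_smooth (smooth1_trig b k))).
- exact: (intb_meas (@integrable_Rint_line R j I mI _ Fti)).
apply: (aeS ae0) => r + Ir => /(_ Ir) Fri.
rewrite -RintegralZr//; apply: eq_Rintegral => s _.
by rewrite crd_oth_line.
Qed.

Lemma ae_forall_trig (P : bool -> nat -> R -> Prop) :
  (forall b k, {ae mu, forall r, P b k r}) -> {ae mu, forall r, forall b k, P b k r}.
Proof.
move=> H.
have H' k : {ae mu, forall r, forall b, P b k r}.
  by apply: (aeS2 (H true k) (H false k)) => r Ht Hf [].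
by apply: (aeS (ae_forall_nat H')) => r Hr b k.
Qed.

Lemma L1_int f : L1 T2 f -> leb2.-integrable C (EFin \o f).
Proof. by case. Qed.

(** The trigonometric system is countable, whence a single exceptional set for all
tests. *)
Lemma wd_line j f g : is_wd T2 j f g -> {ae mu, forall r, I r -> forall b k,
  \int[mu]_(s in I) (f (line j s r) * derive1 (trig b k) s) =
  - \int[mu]_(s in I) (g (line j s r) * trig b k s)}.
Proof.
move=> [Lf Lg H].
have mI := @measurable_I R; have mC := measurable_C.
have fi := L1_int Lf; have gi := L1_int Lg.
have i1 b k : leb2.-integrable C (EFin \o (fun p => f p * derive1 (trig b k) (crd j p))).
  apply: (@intbM_bd _ _ _ leb2 C mC f (fun p => derive1 (trig b k) (crd j p)) k%:R) => //.
    apply: measurable_funTS; apply: measurableT_comp; last exact: measurable_crd.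
    by apply: measurable_smooth1; apply: smooth1_derive; exact: smooth1_trig.
  move=> p _; rewrite derive1_trig !normrM normr_nat normrX normrN1 expr1n mul1r.
  by rewrite ler_piMr// trig_le1.
have i2 b k : leb2.-integrable C (EFin \o (fun p => g p * trig b k (crd j p))).
  apply: (@intbM_bd _ _ _ leb2 C mC g (fun p => trig b k (crd j p)) 1) => //.
    apply: measurable_funTS; apply: measurableT_comp; last exact: measurable_crd.
    by apply: measurable_smooth1; exact: smooth1_trig.
  by move=> p _; exact: trig_le1.
have mt b k : measurable_fun C (fun p => trig b k (crd (oth j) p)).
  apply: measurable_funTS; apply: measurableT_comp; last exact: measurable_crd.
  by apply: measurable_smooth1; exact: smooth1_trig.
have it b k (F : pt R -> R) : leb2.-integrable C (EFin \o F) ->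
    leb2.-integrable C (EFin \o (fun p => F p * trig b k (crd (oth j) p))).
  move=> Fi; apply: (@intbM_bd _ _ _ leb2 C mC F (fun p => trig b k (crd (oth j) p)) 1);
    [exact: Fi|exact: mt|by move=> p _; exact: trig_le1].
suff : {ae mu, forall r, forall b k, I r ->
   \int[mu]_(s in I) (f (line j s r) * derive1 (trig b k) s) =
  - \int[mu]_(s in I) (g (line j s r) * trig b k s)}.
  by move=> K; apply: (aeS K) => r Hr Ir b k; exact: Hr.
apply: ae_forall_trig => b k.
have /slice_int0 S : leb2.-integrable C (EFin \o (fun p => f p * derive1 (trig b k) (crd j p) +
    g p * trig b k (crd j p))) by exact: intbD.
have {}S := S j.
have {S} S : {ae mu, forall r, I r ->
   \int[mu]_(s in I) (f (line j s r) * derive1 (trig b k) (crd j (line j s r)) +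
     g (line j s r) * trig b k (crd j (line j s r))) = 0}.
  apply: S => b' k'.
  have := H _ (test_tline j (@smooth1_trig R b k) (@smooth1_trig R b' k') (@per1_trig R b k) (@per1_trig R b' k')).
  move=> E0.
  have E : \int[leb2]_(p in C) (f p * derive1 (trig b k) (crd j p) * trig b' k' (crd (oth j) p)) =
     - \int[leb2]_(p in C) (g p * trig b k (crd j p) * trig b' k' (crd (oth j) p)).
    transitivity (\int[leb2]_(p in C) (f p * 'D_(ebase j) (tline j (trig b k) (trig b' k')) p)).
      by apply: eq_Rintegral => p _; rewrite D_tline ?mulrA//; exact: smooth1_trig.
    by rewrite E0; congr (- _); apply: eq_Rintegral => p _; rewrite /tline mulrA.
  transitivity (\int[leb2]_(p in C) (f p * derive1 (trig b k) (crd j p) * trig b' k' (crd (oth j) p) +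
     g p * trig b k (crd j p) * trig b' k' (crd (oth j) p))).
    by apply: eq_Rintegral => p _; rewrite mulrDl.
  rewrite RintegralD//; [|exact: it|exact: it].
  by rewrite E addNr.
have h1 := @ae_integrable_line R j I mI _ (i1 b k).
have h2 := @ae_integrable_line R j I mI _ (i2 b k).
apply: (aeS2 S (aeS2 h1 h2 (fun r => @conj _ _))) => r Hr [{}h1 {}h2] Ir.
have {h1}h1 := h1 Ir; have {h2}h2 := h2 Ir; have := Hr Ir.
rewrite RintegralD//.
have -> : \int[mu]_(s in I) (f (line j s r) * derive1 (trig b k) (crd j (line j s r))) =
  \int[mu]_(s in I) (f (line j s r) * derive1 (trig b k) s).
  by apply: eq_Rintegral => s _; rewrite crd_line.
have -> : \int[mu]_(s in I) (g (line j s r) * trig b k (crd j (line j s r))) =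
  \int[mu]_(s in I) (g (line j s r) * trig b k s).
  by apply: eq_Rintegral => s _; rewrite crd_line.
by move=> /eqP; rewrite addr_eq0 => /eqP.
Qed.

(** The characterization of weak derivatives by absolute continuity on lines.  The
representative [phi] depends on the line, as [f] matters up to null sets only. *)
Definition abscont_lines j f g := {ae mu, forall r, I r ->
  exists phi : R -> R, [/\ abscont phi (fun s => g (line j s r)), phi 0 = phi L &
    {ae mu, forall s, I s -> phi s = f (line j s r)}]}.

Lemma wd_abscont j f g : is_wd T2 j f g -> abscont_lines j f g.
Proof.
move=> W; have [Lf Lg _] := W.
have mI := @measurable_I R.
have hf := @ae_integrable_line R j I mI _ (L1_int Lf).
have hg := @ae_integrable_line R j I mI _ (L1_int Lg).
apply: (aeS2 (wd_line W) (aeS2 hf hg (fun r => @conj _ _))) => r Hr [{}hf {}hg] Ir.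
exact: wd1_abscont (hf Ir) (hg Ir) (Hr Ir).
Qed.

Lemma abscont_lines_mul j f f' g g' : abscont_lines j f f' -> abscont_lines j g g' ->
  measurable_fun setT f -> measurable_fun setT g ->
  measurable_fun setT f' -> measurable_fun setT g' ->
  abscont_lines j (fun p => f p * g p) (fun p => f' p * g p + f p * g' p).
Proof.
move=> Hf Hg mf mg mf' mg'; apply: (aeS2 Hf Hg) => r {}Hf {}Hg Ir.
have [phi [aphi phi0 phif]] := Hf Ir; have [psi [apsi psi0 psig]] := Hg Ir.
exists (fun s => phi s * psi s); split; last 2 first.
- by rewrite phi0 psi0.
- by apply: (aeS2 phif psig) => s Hs Hs' Is; rewrite Hs// Hs'.
apply: (abscont_ae (abscont_mul aphi apsi)).
  have ml (F : pt R -> R) : measurable_fun setT F -> measurable_fun I (fun s => F (line j s r)).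
    by move=> mF; apply: measurable_funTS; exact: measurable_line_comp.
  refine (ml (fun p => f' p * g p + f p * g' p) _).
  by apply: measurable_funD; apply: measurable_funM.
by apply: (aeS2 phif psig) => s Hs Hs' Is; rewrite Hs// Hs'.
Qed.

Lemma abscont_lines_int0 j f g : abscont_lines j f g -> leb2.-integrable C (EFin \o g) ->
  \int[leb2]_(p in C) g p = 0.
Proof.
move=> H gi; have mI := @measurable_I R.
rewrite (@Rfubini_line R j I mI _ gi).
transitivity (\int[mu]_(r in I) (cst 0 : R -> R) r); last first.
  by rewrite Rintegral_cst// mul0r.
apply: Rint_ae => //; first exact: (intb_meas (@integrable_Rint_line R j I mI _ gi)).
apply: (aeS H) => r + Ir => /(_ Ir)[phi [aphi phi0 _]].
exact: abscont_int0 aphi phi0.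
Qed.

End planar.

(** * Continuous functions on the plane *)

Section plane_continuous.
Context {R : realType}.
Implicit Types phi : pt R -> R.

Definition stair (n : nat) (x : R) : R := (Num.floor (n.+1%:R * x))%:~R / n.+1%:R.

Lemma cvg_stair x : stair n x @[n --> \oo] --> x.
Proof.
apply: (@squeeze_cvgr _ _ _ _ (fun n : nat => x - harmonic n) (fun=> x)).
- apply: nearW => n; rewrite /stair /harmonic /=.
  have n0 : 0 < n.+1%:R :> R by rewrite ltr0n.
  rewrite ler_pdivrMr// [x * _]mulrC floor_le_tmp andbT.
  rewrite ler_pdivlMr// mulrBl mulVf ?gt_eqF// lerBlDr [x * _]mulrC.
  by rewrite -[1]/(1%:~R) -intrD ltW// floorD1_gt.
- rewrite -[X in _ --> X]subr0; apply: cvgB; [exact: cvg_cst|exact: cvg_harmonic].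
- exact: cvg_cst.
Qed.

(** Measurability in the plane refers to the product sigma-algebra; a continuous
function is a limit of functions constant on the squares of a grid. *)
Lemma measurable_continuous2 phi : continuous phi -> measurable_fun setT phi.
Proof.
move=> cphi.
apply: (@measurable_fun_cvg _ _ _ _ (fun n p => phi (stair n p.1, stair n p.2))); last first.
  move=> p _.
  apply: (@cvg_comp _ _ _ (fun n => (stair n p.1, stair n p.2)) phi _ (nbhs p)); last exact: cphi.
  by apply: (@cvg_pair _ _ _ \oo (nbhs p.1) (nbhs p.2)); exact: cvg_stair.
move=> n _ Y mY; rewrite setTI.
pose B (z : int) : set R := [set x | Num.floor (n.+1%:R * x) = z].
have mB z : measurable (B z).
  have -> : B z = `[z%:~R / n.+1%:R, (z + 1)%:~R / n.+1%:R[%classic.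
    have n0 : 0 < n.+1%:R :> R by rewrite ltr0n.
    apply/seteqP; split => x; rewrite /B /= in_itv/=.
      move=> <-; rewrite ler_pdivrMr// ltr_pdivlMr// ![x * _]mulrC.
      by rewrite floor_le_tmp floorD1_gt.
    rewrite ler_pdivrMr// ltr_pdivlMr// ![x * _]mulrC => h.
    exact/floor_def.
  exact: measurable_itv.
pose S (k : nat) : set (pt R) := if unpickle k is Some (z, w) then
   if `[< Y (phi ((z : int)%:~R / n.+1%:R, (w : int)%:~R / n.+1%:R)) >] then B z `*` B w else set0 else set0.
have -> : (fun p : pt R => phi (stair n p.1, stair n p.2)) @^-1` Y = \bigcup_k S k.
  apply/seteqP; split => p /=.
    move=> Yp; exists (pickle (Num.floor (n.+1%:R * p.1), Num.floor (n.+1%:R * p.2))); first exact: Logic.I.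
    by rewrite /S pickleK; case: asboolP.
  move=> [k _]; rewrite /S; case: (unpickle k) => [[z w]|//].
  by case: asboolP => // YP []; rewrite /B /= => zE wE; rewrite /stair zE wE.
apply: bigcup_measurable => k _; rewrite /S; case: (unpickle k) => [[z w]|//].
by case: asboolP => // _; apply: measurableX.
Qed.

Lemma continuous_cell_bounded (L : pt R) phi : continuous phi -> exists M, forall p, cell L p -> `|phi p| <= M.
Proof.
move=> cphi.
have K : compact (`[0, L.1]%classic `*` `[0, L.2]%classic : set (pt R)).
  by apply: compact_setX; exact: segment_compact.
have : compact (phi @` (`[0, L.1] `*` `[0, L.2])).
  by apply: continuous_compact => //; exact: continuous_subspaceT.
move=> /compact_bounded [M [_ HM]].
exists (M + 1) => p [/= p1 p2]; apply: HM; first by rewrite ltrDl.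
exists p => //; split => /=.
  by move: p1; rewrite !in_itv/= => /andP[-> /ltW].
by move: p2; rewrite !in_itv/= => /andP[-> /ltW].
Qed.

End plane_continuous.

(** * Uniqueness and linearity of weak derivatives *)

Section wdalg.
Context {R : realType}.
Notation mu := (@lebesgue_measure R).
Local Notation L := (2 * pi : R).
Local Notation I := (`[0, 2 * pi[%classic : set R).
Local Notation C := (cell (@T2 R)).
Implicit Types (f g : pt R -> R) (j : 'I_2).

Lemma test_continuous phi : test_fun (@T2 R) phi -> continuous phi.
Proof. by move=> [/(_ [::])[]]. Qed.

Lemma test_D_continuous j phi : test_fun (@T2 R) phi -> continuous ('D_(ebase j) phi).
Proof. by move=> [/(_ [:: j])[]]. Qed.

Lemma intM_cont f phi : leb2.-integrable C (EFin \o f) -> continuous phi ->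
  leb2.-integrable C (EFin \o (fun p => f p * phi p)).
Proof.
move=> fi cphi; have [M HM] := @continuous_cell_bounded R (@T2 R) phi cphi.
apply: (@intbM_bd _ _ _ leb2 C (@measurable_C R) f phi M); [exact: fi| |exact: HM].
by apply: measurable_funTS; exact: measurable_continuous2.
Qed.

Lemma L1B f g : L1 T2 f -> L1 T2 g -> L1 T2 (fun p => f p - g p).
Proof.
move=> [pf mf fi] [pg mg gi]; split.
- by move=> p q pq; rewrite (pf p q pq) (pg p q pq).
- exact: measurable_funB.
- by apply: intbB => //; exact: measurable_C.
Qed.

Lemma is_wdB j f f' g g' : is_wd T2 j f f' -> is_wd T2 j g g' ->
  is_wd T2 j (fun p => f p - g p) (fun p => f' p - g' p).
Proof.
move=> [Lf Lf' Hf] [Lg Lg' Hg]; split; [exact: L1B|exact: L1B|] => phi tphi.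
have mC := @measurable_C R.
have cphi := test_continuous tphi; have cD := @test_D_continuous j _ tphi.
have i1 := intM_cont (L1_int Lf) cD; have i2 := intM_cont (L1_int Lg) cD.
have i3 := intM_cont (L1_int Lf') cphi; have i4 := intM_cont (L1_int Lg') cphi.
under eq_Rintegral do rewrite mulrBl.
under [in RHS]eq_Rintegral do rewrite mulrBl.
by rewrite !RintegralB// Hf// Hg//; ring.
Qed.

Lemma L1_ae f g : L1 T2 f -> L1 T2 g -> {ae leb2, forall p, C p -> f p = g p} ->
  forall phi, continuous phi -> \int[leb2]_(p in C) (f p * phi p) = \int[leb2]_(p in C) (g p * phi p).
Proof.
move=> Lf Lg fg phi cphi.
apply: Rint_ae.
- exact: measurable_C.
- exact: (intb_meas (intM_cont (L1_int Lf) cphi)).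
- exact: (intb_meas (intM_cont (L1_int Lg) cphi)).
- by apply: (aeS fg) => p /[apply] ->.
Qed.

(** Test functions separate integrable periodic functions because products of
trigonometric functions do: completeness is applied in each variable in turn. *)
Lemma wd_ae0 g : L1 T2 g -> (forall phi, test_fun T2 phi -> \int[leb2]_(p in C) (g p * phi p) = 0) ->
  {ae leb2, forall p, C p -> g p = 0}.
Proof.
move=> Lg H; have [_ mg gi] := Lg.
have mI := @measurable_I R; have mC := @measurable_C R.
have mt b k : measurable_fun setT (trig b k : R -> R).
  by apply: measurable_smooth1; exact: smooth1_trig.
have cline b k : leb2.-integrable C (EFin \o (fun p => g p * trig b k (crd 0 p))).
  apply: intM_cont => // p; apply: continuous_comp; first exact: continuous_crd.
  exact/smooth1_continuous/smooth1_trig.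
have S : {ae mu, forall r, forall b k, I r -> \int[mu]_(s in I) (g (line 0 s r) * trig b k s) = 0}.
  apply: ae_forall_trig => b k.
  have := @slice_int0 R 0 _ (cline b k); move=> K.
  have {}K : {ae mu, forall r, I r -> \int[mu]_(s in I) (g (line 0 s r) * trig b k (crd 0 (line 0 s r))) = 0}.
    apply: K => b' k'.
    rewrite -[RHS](H _ (test_tline 0 (@smooth1_trig R b k) (@smooth1_trig R b' k') (@per1_trig R b k) (@per1_trig R b' k'))).
    by apply: eq_Rintegral => p _; rewrite /tline mulrA.
  apply: (aeS K) => r + Ir => /(_ Ir) E; rewrite -[RHS]E.
  by apply: eq_Rintegral => s _; rewrite crd_line.
have Z : {ae mu, forall r, I r -> {ae mu, forall s, I s -> ~ [set p | g p != 0] (line 0 s r)}}.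
  apply: (aeS2 S (@ae_integrable_line R 0 I mI _ gi)) => r H1 H2 Ir.
  have := trig_complete_bool (H2 Ir) (fun b k => H1 b k Ir) => K.
  by apply: (aeS K) => s Hs /Hs /= ->; rewrite eqxx.
have mA : measurable [set p | g p != 0].
  have -> : [set p | g p != 0] = ~` (g @^-1` [set 0]).
    by apply/seteqP; split => p /=; [move=> /eqP|move=> /eqP].
  by apply: measurableC; rewrite -[X in measurable X]setTI; exact: mg.
by apply: (aeS (@line_ae R 0 I _ mI mA Z)) => p Hp /Hp /negP; rewrite negbK => /eqP.
Qed.

Lemma is_wd_unique j f g g' : is_wd T2 j f g -> is_wd T2 j f g' ->
  {ae leb2, forall p, C p -> g p = g' p}.
Proof.
move=> W W'; have [_ Lg H] := W; have [_ Lg' H'] := W'.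
have : {ae leb2, forall p, C p -> g p - g' p = 0}.
  apply: wd_ae0; first exact: L1B.
  move=> phi tphi; have cphi := test_continuous tphi.
  have i1 := intM_cont (L1_int Lg) cphi; have i2 := intM_cont (L1_int Lg') cphi.
  transitivity (\int[leb2]_(p in C) (g p * phi p - g' p * phi p)).
    by apply: eq_Rintegral => p _; rewrite mulrBl.
  rewrite RintegralB//; last exact: measurable_C.
  by rewrite -[X in X - _]opprK -H// -[X in _ - X]opprK -H'// subrr.
by move=> K; apply: (aeS K) => p /[apply] /subr0_eq.
Qed.

Lemma is_wd_has j f g : is_wd T2 j f g -> has_wd T2 j f.
Proof. by move=> W; rewrite /has_wd /wd; case: xgetP => [h -> //|/(_ g)]. Qed.

Lemma wd_eq j f g : is_wd T2 j f g -> {ae leb2, forall p, C p -> wd T2 j f p = g p}.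
Proof. by move=> W; exact: is_wd_unique (is_wd_has W) W. Qed.

(** Along a line in direction [j], the derivative of a periodic function has
integral zero over a period. *)
Lemma is_wd_cst j c : is_wd T2 j (fun=> c) (fun=> 0 : R).
Proof.
have mC := @measurable_C R.
have L1c (c' : R) : L1 T2 (fun=> c').
  by split=> //; apply: intb_cst => //; exact: leb2_C.
split => // phi tphi.
under [in RHS]eq_Rintegral do rewrite mul0r.
rewrite Rintegral_cst// mul0r oppr0.
have cD := @test_D_continuous j _ tphi.
have i1 := intM_cont (L1_int (L1c c)) cD.
rewrite (@Rfubini_line R j I (@measurable_I R) _ i1).
rewrite (@eq_Rintegral _ _ R mu I (cst 0)); first by rewrite Rintegral_cst ?mul0r//; exact: measurable_I.
move=> r _ /=.
have dl (s : R) : is_derive s 1 (fun s => phi (line j s r)) ('D_(ebase j) phi (line j s r)).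
  have [/(_ [::])[_ /(_ j (line j s r)) dphi] _] := tphi.
  have [dphi1 dphi2] := derivableP dphi.
  have E h : h *: (1 : R) + s = h + s by rewrite /GRing.scale/= mulr1.
  have lineE h : line j (h + s) r = h *: ebase j + line j s r.
    rewrite /line /ebase /mkpt; have [->|j0] := eqVneq j 0.
      by apply: injective_projections; rewrite /= /GRing.scale/= ?mulr1 ?mulr0 ?add0r.
    rewrite (ord2_neq0 j0).
    by apply: injective_projections; rewrite /= /GRing.scale/= ?mulr1 ?mulr0 ?add0r.
  have FE : (fun h : R => h^-1 *: (((fun s => phi (line j s r)) \o shift s) (h *: 1) - phi (line j s r))) =
    (fun h => h^-1 *: ((phi \o shift (line j s r)) (h *: ebase j) - phi (line j s r))).
    by apply/funext => h; rewrite /= E lineE.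
  by split; rewrite /derivable /derive FE.
have cl : continuous (fun s => 'D_(ebase j) phi (line j s r)).
  move=> s; apply: (@continuous_comp _ _ _ (fun s => line j s r) ('D_(ebase j) phi)); last exact: cD.
  rewrite /line; case: (j == 0).
    by apply: (@cvg_pair _ _ _ (nbhs s) (nbhs s) (nbhs r)); [exact: cvg_id|exact: cvg_cst].
  by apply: (@cvg_pair _ _ _ (nbhs s) (nbhs r) (nbhs s)); [exact: cvg_cst|exact: cvg_id].
have il : mu.-integrable `[0, L] (EFin \o (fun s => 'D_(ebase j) phi (line j s r))).
  apply: continuous_compact_integrable; first exact: segment_compact.
  exact: continuous_subspaceT.
have il' : mu.-integrable `[0, L[ (EFin \o (fun s => 'D_(ebase j) phi (line j s r))).
  by apply: integrableS il => // s /=; rewrite !in_itv/= => /andP[-> /ltW].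
rewrite RintegralZl//.
have -> : \int[mu]_(s in I) 'D_(ebase j) phi (line j s r) = 0; last by rewrite mulr0.
rewrite Rintegral_itv_bndo_bndc// /Rintegral.
have cphil : continuous (fun s => phi (line j s r)).
  by move=> s; apply/differentiable_continuous/derivable1_diffP; exact: ex_derive.
rewrite (@continuous_FTC2 R _ (fun s => phi (line j s r)) 0 L (@L_gt0 R)) /=.
- have [_ /(_ (line j L r) (line j 0 r)) ->] := tphi; first by rewrite subrr.
  rewrite /tequiv /line; case: (j == 0).
    by exists (1, 0); congr pair; rewrite /= ?mul1r ?mul0r ?add0r ?addr0.
  by exists (0, 1); congr pair; rewrite /= ?mul1r ?mul0r ?add0r ?addr0.
- exact: continuous_subspaceT.
- split.
  + by move=> x _; exact: ex_derive.
  + by apply: cvg_at_right_filter; exact: cphil.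
  + by apply: cvg_at_left_filter; exact: cphil.
- by move=> x _; rewrite derive1E derive_val.
Qed.

Lemma is_wd_ae j f f' g : is_wd T2 j f g -> L1 T2 f' -> {ae leb2, forall p, C p -> f' p = f p} ->
  is_wd T2 j f' g.
Proof.
move=> [Lf Lg H] Lf' E; split => // phi tphi.
by rewrite (L1_ae Lf' Lf E (@test_D_continuous j _ tphi)) H.
Qed.

End wdalg.

(** * Sobolev functions on the torus *)

Section sobolev.
Context {R : realType}.
Notation mu := (@lebesgue_measure R).
Local Notation L := (2 * pi : R).
Local Notation I := (`[0, 2 * pi[%classic : set R).
Local Notation C := (cell (@T2 R)).
Local Notation int f := (leb2.-integrable C (EFin \o f)).
Implicit Types (f g h : pt R -> R) (j : 'I_2).

Lemma intM_sq f g : measurable_fun setT f -> measurable_fun setT g ->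
  int (fun p => f p ^+ 2) -> int (fun p => g p ^+ 2) -> int (fun p => f p * g p).
Proof.
move=> mf mg fi gi; have mC := @measurable_C R.
apply: (@intb_le _ _ _ leb2 C mC _ (fun p => f p ^+ 2 + g p ^+ 2)).
- by apply: measurable_funTS; exact: measurable_funM.
- move=> p _; rewrite ler_norml; apply/andP; split.
    have := sqr_ge0 (f p + g p); nra.
  have := sqr_ge0 (f p - g p); nra.
- exact: intbD.
Qed.

Lemma L2_meas f : L2 T2 f -> measurable_fun setT f.
Proof. by case=> -[]. Qed.

Lemma L2_sq f : L2 T2 f -> int (fun p => f p ^+ 2).
Proof. by case. Qed.

Lemma L2_L1 f : L2 T2 f -> L1 T2 f.
Proof. by case. Qed.

Lemma L2_intM f g : L2 T2 f -> L2 T2 g -> int (fun p => f p * g p).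
Proof. by move=> Lf Lg; apply: intM_sq; [exact: L2_meas|exact: L2_meas|exact: L2_sq|exact: L2_sq]. Qed.

Lemma L2B f g : L2 T2 f -> L2 T2 g -> L2 T2 (fun p => f p - g p).
Proof.
move=> Lf Lg; split; first by apply: L1B; exact: L2_L1.
have mC := @measurable_C R.
have := intbB mC (intbD mC (L2_sq Lf) (L2_sq Lg)) (intbZ mC 2 (L2_intM Lf Lg)).
by apply: eq_integrable => // p _ /=; congr (_%:E); ring.
Qed.

Lemma L2_ae f g : L1 T2 f -> L2 T2 g -> {ae leb2, forall p, C p -> f p = g p} -> L2 T2 f.
Proof.
move=> Lf Lg fg; split=> //.
apply: (@intb_ae _ _ _ leb2 C (@measurable_C R) _ (fun p => g p ^+ 2)).
- by apply: measurable_funTS; apply: measurable_funX; case: Lf.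
- by apply: (aeS fg) => p /[apply] ->.
- exact: L2_sq.
Qed.

Lemma H1_L2 f : H1 T2 f -> L2 T2 f. Proof. by case. Qed.
Lemma H1_wd j f : H1 T2 f -> is_wd T2 j f (wd T2 j f).
Proof. by case=> _ /(_ j)[]. Qed.
Lemma H1_wd_L2 j f : H1 T2 f -> L2 T2 (wd T2 j f).
Proof. by case=> _ /(_ j)[]. Qed.

Lemma wdB j f g : H1 T2 f -> H1 T2 g ->
  {ae leb2, forall p, C p -> wd T2 j (fun p => f p - g p) p = wd T2 j f p - wd T2 j g p}.
Proof. by move=> Hf Hg; apply: wd_eq; apply: is_wdB; exact: H1_wd. Qed.

Lemma H1B f g : H1 T2 f -> H1 T2 g -> H1 T2 (fun p => f p - g p).
Proof.
move=> Hf Hg; split; first by apply: L2B; exact: H1_L2.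
move=> j.
have W := is_wdB (H1_wd j Hf) (H1_wd j Hg).
have Hw := is_wd_has W; split=> //.
apply: (@L2_ae _ (fun p => wd T2 j f p - wd T2 j g p)).
- by have [] := Hw.
- by apply: L2B; exact: H1_wd_L2.
- exact: wdB.
Qed.

Lemma H1_lines j f : H1 T2 f -> abscont_lines j f (wd T2 j f).
Proof. by move=> Hf; apply: wd_abscont; exact: H1_wd. Qed.

Lemma H1_ibp j f g : H1 T2 f -> H1 T2 g ->
  \int[leb2]_(p in C) (wd T2 j f p * g p) = - \int[leb2]_(p in C) (f p * wd T2 j g p).
Proof.
move=> Hf Hg; have mC := @measurable_C R.
have i1 := L2_intM (H1_wd_L2 j Hf) (H1_L2 Hg).
have i2 := L2_intM (H1_L2 Hf) (H1_wd_L2 j Hg).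
have := abscont_lines_int0 (abscont_lines_mul (H1_lines j Hf) (H1_lines j Hg)
  (L2_meas (H1_L2 Hf)) (L2_meas (H1_L2 Hg)) (L2_meas (H1_wd_L2 j Hf)) (L2_meas (H1_wd_L2 j Hg)))
  (intbD mC i1 i2).
by rewrite RintegralD// => /eqP; rewrite addr_eq0 => /eqP.
Qed.

(** The bound depends on the transverse coordinate only: multiplying those obtained
in the two directions gives an integrable function on the torus. *)
Lemma line_sup j f g : abscont_lines j f g -> measurable_fun setT f ->
  int f -> int g ->
  exists A : R -> R, [/\ measurable_fun setT A, mu.-integrable I (EFin \o A) &
    {ae leb2, forall p, C p -> L * `|f p| <= A (crd (oth j) p)}].
Proof.
move=> H mf fi gi; have mI := @measurable_I R.
have mC := @measurable_C R.
have afi : int (fun p => `|f p|) by exact: integrable_norm.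
have agi : int (fun p => `|g p|) by exact: integrable_norm.
pose A0 r := \int[mu]_(s in I) `|f (line j s r)| + L * \int[mu]_(s in I) `|g (line j s r)|.
have A0i : mu.-integrable I (EFin \o A0).
  apply: intbD => //; first exact: (@integrable_Rint_line R j I mI _ afi).
  by apply: intbZ => //; exact: (@integrable_Rint_line R j I mI _ agi).
pose A := A0 \_ I.
have mA : measurable_fun setT A.
  have [K _] := @integrable_mkcond _ _ R mu I (EFin \o A0) mI.
  have := K A0i; rewrite restrict_EFin => KA.
  exact: (intb_meas KA).
have AE r : I r -> A r = A0 r by move=> Ir; rewrite /A patchE mem_set.
exists A; split.
- exact: mA.
- by apply: eq_integrable A0i => // r /set_mem Ir /=; rewrite AE.
pose S := [set p : pt R | A (crd (oth j) p) < L * `|f p|].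
have mS : measurable S.
  have mb : measurable_fun setT (fun p : pt R => L * `|f p| - A (crd (oth j) p)).
    apply: measurable_funB.
      by apply: measurable_funM => //; exact: measurableT_comp.
    by apply: (measurableT_comp mA); exact: measurable_crd.
  have -> : S = (fun p : pt R => L * `|f p| - A (crd (oth j) p)) @^-1` `]0, +oo[.
    by apply/seteqP; split => p; rewrite /S /= in_itv/= andbT subr_gt0.
  by rewrite -[X in measurable X]setTI; apply: mb => //; exact: measurable_itv.
suff Z : {ae mu, forall r, I r -> {ae mu, forall s, I s -> ~ S (line j s r)}}.
  apply: (aeS (@line_ae R j I S mI mS Z)) => p Hp /Hp.
  by rewrite /S /= => /negP; rewrite -leNgt.
apply: (aeS H) => r + Ir => /(_ Ir)[phi [aphi _ phif]].
have phiE : \int[mu]_(s in I) `|phi s| = \int[mu]_(s in I) `|f (line j s r)|.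
  apply: Rint_ae => //.
  - by apply: measurableT_comp => //; exact: (abscont_meas aphi).
  - apply: measurableT_comp => //.
    refine (measurable_funTS (@measurable_line_comp R j f r mf)).
  - by apply: (aeS phif) => s /[apply] ->.
apply: (aeS phif) => s Hs Is; rewrite /S /=; apply/negP; rewrite -leNgt.
rewrite crd_oth_line AE// /A0 -phiE -Hs//.
by apply: abscont_sum_bound => //; exact: I_itv.
Qed.

(** Ladyzhenskaya's argument: [f^2] has the integrable derivatives [2 f f'], so by
[line_sup] it is bounded by an integrable function of either coordinate, and
[f^4] by their product. *)
Lemma H1_L4 f : H1 T2 f -> int (fun p => (f p ^+ 2) ^+ 2).
Proof.
move=> Hf; have mC := @measurable_C R; have mI := @measurable_I R.
have mf := L2_meas (H1_L2 Hf).
have sup j := @line_sup j (fun p => f p * f p) (fun p => wd T2 j f p * f p + f p * wd T2 j f p)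
  (abscont_lines_mul (H1_lines j Hf) (H1_lines j Hf) mf mf (L2_meas (H1_wd_L2 j Hf)) (L2_meas (H1_wd_L2 j Hf)))
  (measurable_funM mf mf) (L2_intM (H1_L2 Hf) (H1_L2 Hf))
  (intbD mC (L2_intM (H1_wd_L2 j Hf) (H1_L2 Hf)) (L2_intM (H1_L2 Hf) (H1_wd_L2 j Hf))).
have [A [mA iA HA]] := sup 0; have [B [mB iB HB]] := sup 1.
have T := intbZ mC (L^-1 ^+ 2) (integrable_tensor mI iB iA).
apply: (intb_le_ae mC _ _ T).
  by apply: measurable_funTS; do 2 apply: measurable_funX.
apply: (aeS2 HA HB) => p {}HA {}HB Cp; have {}HA := HA Cp; have {}HB := HB Cp.
have L0 : 0 < L^-1 by rewrite invr_gt0 L_gt0.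
rewrite /crd /oth /= in HA HB.
rewrite -expr2 ger0_norm ?sqr_ge0// in HA.
rewrite -expr2 ger0_norm ?sqr_ge0// in HB.
rewrite ger0_norm ?sqr_ge0//.
have sq_scale (l x : R) : l != 0 -> x ^+ 2 = l^-1 ^+ 2 * ((l * x) * (l * x)).
  by move=> l0; field.
rewrite (sq_scale L) ?gt_eqF ?L_gt0//.
rewrite ler_pM2l ?exprn_gt0//; apply: ler_pM => //;
  by rewrite mulr_ge0 ?sqr_ge0// ltW// L_gt0.
Qed.

(** The integrability behind the trilinear form: [f g] is square-integrable by the
L^4 embedding. *)
Lemma H1_intM3 f g h : H1 T2 f -> H1 T2 g -> L2 T2 h -> int (fun p => f p * g p * h p).
Proof.
move=> Hf Hg Hh.
have mf := L2_meas (H1_L2 Hf); have mg := L2_meas (H1_L2 Hg).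
apply: (@intM_sq (fun p => f p * g p) h).
- exact: measurable_funM.
- exact: L2_meas.
- have := @intM_sq (fun p => f p ^+ 2) (fun p => g p ^+ 2) (measurable_funX _ mf) (measurable_funX _ mg)
    (H1_L4 Hf) (H1_L4 Hg).
  by apply: eq_integrable => //; [exact: measurable_C|move=> p _ /=; rewrite exprMn].
- exact: L2_sq.
Qed.

(** Up to the factor 1/2 the integrand is the divergence of [f^2 v], which has zero
integral over the torus. *)
Lemma transport_int0 (v : field R) f : space_V v -> H1 T2 f ->
  \int[leb2]_(p in C) (\sum_(j < 2) crd j (v p) * wd T2 j f p * f p) = 0.
Proof.
move=> [[_ _ Hdiv] Hv] Hf; have mC := @measurable_C R.
have mf := L2_meas (H1_L2 Hf).
have mv j := L2_meas (H1_L2 (Hv j)).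
have div0 : {ae leb2, forall p, C p -> \sum_(j < 2) wd T2 j (crd j \o v) p = 0}.
  apply: wd_ae0.
    rewrite (_ : (fun p => _) = (fun p => wd T2 0 (crd 0 \o v) p - (0 - wd T2 1 (crd 1 \o v) p))); last first.
      by apply/funext => p; rewrite !big_ord_recl big_ord0 /=; congr (_ + _); rewrite opprB subr0 addr0.
    apply: L1B; first exact: L2_L1 (H1_wd_L2 0 (Hv 0)).
    apply: L1B; last exact: L2_L1 (H1_wd_L2 1 (Hv 1)).
    by have [_ L10 _] := @is_wd_cst R 0 0.
  move=> phi tphi; have cphi := test_continuous tphi.
  have i1 j := intM_cont (L1_int (L2_L1 (H1_wd_L2 j (Hv j)))) cphi.
  have i2 j := intM_cont (L1_int (L2_L1 (H1_L2 (Hv j)))) (@test_D_continuous R j _ tphi).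
  have := Hdiv _ tphi; rewrite Rint_sum// => E.
  under eq_Rintegral do rewrite mulr_suml.
  rewrite Rint_sum// -[RHS]oppr0 -[in RHS]E -sumrN; apply: eq_bigr => j _.
  by have [_ _ ->//] := H1_wd j (Hv j); rewrite opprK.
have ff j := abscont_lines_mul (H1_lines j Hf) (H1_lines j Hf) mf mf (L2_meas (H1_wd_L2 j Hf)) (L2_meas (H1_wd_L2 j Hf)).
have i1 j : int (fun p => wd T2 j (crd j \o v) p * (f p * f p)).
  have := H1_intM3 Hf Hf (H1_wd_L2 j (Hv j)).
  by apply: eq_integrable => // p _ /=; congr (_%:E); ring.
have i2 j : int (fun p => crd j (v p) * wd T2 j f p * f p).
  have := H1_intM3 (Hv j) Hf (H1_wd_L2 j Hf).
  by apply: eq_integrable => // p _ /=; congr (_%:E); ring.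
have E j : \int[leb2]_(p in C) (wd T2 j (crd j \o v) p * (f p * f p) + 2 * (crd j (v p) * wd T2 j f p * f p)) = 0.
  have mff : measurable_fun setT (fun p => f p * f p) by exact: measurable_funM.
  have mwff : measurable_fun setT (fun p => wd T2 j f p * f p + f p * wd T2 j f p).
    have mw := L2_meas (H1_wd_L2 j Hf).
    by apply: measurable_funD; exact: measurable_funM.
  have H := abscont_lines_int0 (abscont_lines_mul (H1_lines j (Hv j)) (ff j) (mv j) mff (L2_meas (H1_wd_L2 j (Hv j))) mwff).
  rewrite -[RHS]H.
    by apply: eq_Rintegral => p _ /=; ring.
  have := intbD mC (i1 j) (intbZ mC 2 (i2 j)).
  by apply: eq_integrable => // p _ /=; congr (_%:E); ring.
have : \sum_(j < 2) \int[leb2]_(p in C) (wd T2 j (crd j \o v) p * (f p * f p) + 2 * (crd j (v p) * wd T2 j f p * f p)) = 0.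
  by rewrite big1.
have i3 j : int (fun p => 2 * (crd j (v p) * wd T2 j f p * f p)) by exact: intbZ.
under eq_bigr => j _ do rewrite RintegralD//.
rewrite big_split /= -!Rint_sum//.
have -> : \int[leb2]_(p in C) (\sum_(j < 2) wd T2 j (crd j \o v) p * (f p * f p)) = 0.
  rewrite (@Rint_ae _ _ _ leb2 C mC _ (cst 0)); first by rewrite Rintegral_cst// mul0r.
  - exact: (intb_meas (intb_sum mC i1)).
  - exact: measurable_cst.
  - by apply: (aeS div0) => p /[apply] H; rewrite -mulr_suml H mul0r.
rewrite add0r; under eq_Rintegral do rewrite -mulr_sumr.
rewrite RintegralZl//; last exact: intb_sum.
by move=> /eqP; rewrite mulf_eq0 pnatr_eq0 /= => /eqP.
Qed.

End sobolev.

(** * The energy identity *)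

Section fields.
Context {R : realType}.
Notation mu := (@lebesgue_measure R).
Local Notation C := (cell (@T2 R)).
Local Notation int f := (leb2.-integrable C (EFin \o f)).
Implicit Types (u v w e : field R) (j i : 'I_2).

Lemma crdB i (p q : pt R) : crd i (p - q) = crd i p - crd i q.
Proof. by rewrite /crd; case: (i == 0). Qed.
Lemma crdD i (p q : pt R) : crd i (p + q) = crd i p + crd i q.
Proof. by rewrite /crd; case: (i == 0). Qed.
Lemma crdN i (p : pt R) : crd i (- p) = - crd i p.
Proof. by rewrite /crd; case: (i == 0). Qed.
Lemma crdZ i (c : R) (p : pt R) : crd i (c *: (p : R * R)) = c * crd i p.
Proof. by rewrite /crd; case: (i == 0). Qed.
Lemma crd_mkpt i (c : 'I_2 -> R) : crd i (mkpt c) = c i.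
Proof. by rewrite /crd /mkpt; have [->|/ord2_neq0 ->] := eqVneq i 0. Qed.

Lemma dotpBl (p q r : pt R) : dotp (p - q) r = dotp p r - dotp q r.
Proof. by rewrite /dotp -sumrB; apply: eq_bigr => i _; rewrite crdB mulrBl. Qed.
Lemma dotpDl (p q r : pt R) : dotp (p + q) r = dotp p r + dotp q r.
Proof. by rewrite /dotp -big_split; apply: eq_bigr => i _; rewrite crdD mulrDl. Qed.
Lemma dotpZl (c : R) (p r : pt R) : dotp (c *: (p : R * R)) r = c * dotp p r.
Proof. by rewrite /dotp mulr_sumr; apply: eq_bigr => i _; rewrite crdZ mulrA. Qed.
Lemma dotpC (p q : pt R) : dotp p q = dotp q p.
Proof. by rewrite /dotp; apply: eq_bigr => i _; rewrite mulrC. Qed.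
Lemma dotp_ge0 (p : pt R) : 0 <= dotp p p.
Proof. by apply: sumr_ge0 => i _; rewrite -expr2 sqr_ge0. Qed.

Lemma dotp_int u w : L2v u -> L2v w -> int (fun x => dotp (u x) (w x)).
Proof.
move=> Lu Lw; apply: intb_sum; first exact: measurable_C.
by move=> i; exact: L2_intM (Lu i) (Lw i).
Qed.

Lemma L2vB u w : L2v u -> L2v w -> L2v (u \- w).
Proof.
move=> Lu Lw i; have := L2B (Lu i) (Lw i).
by congr (L2 _ _); apply/funext => p; rewrite /= crdB.
Qed.

Lemma ipC u w : ip u w = ip w u.
Proof. by apply: eq_Rintegral => x _; rewrite dotpC. Qed.

Lemma ipBl u v w : L2v u -> L2v v -> L2v w -> ip (u \- v) w = ip u w - ip v w.
Proof.
move=> Lu Lv Lw; rewrite /ip; under eq_Rintegral do rewrite dotpBl.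
by rewrite RintegralB//; [exact: measurable_C|exact: dotp_int|exact: dotp_int].
Qed.

Lemma ipBr u v w : L2v u -> L2v v -> L2v w -> ip w (u \- v) = ip w u - ip w v.
Proof. by move=> Lu Lv Lw; rewrite ipC ipBl// ![ip _ w]ipC. Qed.

Lemma ip_ge0 u : 0 <= ip u u.
Proof. by apply: Rintegral_ge0 => x _; exact: dotp_ge0. Qed.

Lemma norm_HE u : norm_H u ^+ 2 = ip u u.
Proof. by rewrite /norm_H sqr_sqrtr// ip_ge0. Qed.

Lemma norm_H_ge0 u : 0 <= norm_H u. Proof. exact: sqrtr_ge0. Qed.

Lemma ip_quad u w (s : R) : L2v u -> L2v w ->
  0 <= ip u u + 2 * s * ip u w + s ^+ 2 * ip w w.
Proof.
move=> Lu Lw; have mC := @measurable_C R.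
have i1 := dotp_int Lu Lu; have i2 := dotp_int Lu Lw; have i3 := dotp_int Lw Lw.
have -> : ip u u + 2 * s * ip u w + s ^+ 2 * ip w w =
  \int[leb2]_(x in C) dotp (u x + s *: (w x : R * R)) (u x + s *: (w x : R * R)).
  have k2 := intbZ mC (2 * s) i2; have k3 := intbZ mC (s ^+ 2) i3.
  have k12 := intbD mC i1 k2.
  rewrite /ip -!RintegralZl// -RintegralD// -RintegralD//.
  apply: eq_Rintegral => x _.
  rewrite dotpDl dotpZl [dotp (u x) (_ + _)]dotpC [dotp (w x) (_ + _)]dotpC !dotpDl !dotpZl.
  by rewrite [dotp (w x) (u x)]dotpC; ring.
by apply: Rintegral_ge0 => x _; exact: dotp_ge0.
Qed.

Lemma ip_CS u w : L2v u -> L2v w -> `|ip u w| <= norm_H u * norm_H w.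
Proof.
move=> Lu Lw.
rewrite -ler_sqr ?nnegrE ?mulr_ge0 ?norm_H_ge0// exprMn !norm_HE real_normK ?num_real//.
have a0 := ip_ge0 u; have c0 := ip_ge0 w.
have [c00|c00] := eqVneq (ip w w) 0.
  rewrite c00 mulr0.
  suff -> : ip u w = 0 by rewrite expr2 mul0r.
  apply/eqP; apply/negPn/negP => b0.
  have := ip_quad (- (ip u u + 1) / ip u w) Lu Lw.
  rewrite c00 mulr0 addr0.
  have -> : 2 * (- (ip u u + 1) / ip u w) * ip u w = - 2 * (ip u u + 1) by field.
  lra.
(* The minimum of the quadratic polynomial of [ip_quad]. *)
have := ip_quad (- ip u w / ip w w) Lu Lw.
have -> : ip u u + 2 * (- ip u w / ip w w) * ip u w + (- ip u w / ip w w) ^+ 2 * ip w w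
  = (ip u u * ip w w - ip u w ^+ 2) / ip w w by field.
rewrite pmulr_lge0 ?subr_ge0// invr_gt0 lt_def c00.
exact: c0.
Qed.

Lemma space_H_L2v u : space_H u -> L2v u. Proof. by case. Qed.

Lemma space_HB u w : space_H u -> space_H w -> space_H (u \- w).
Proof.
move=> [Lu zu du] [Lw zw dw]; have mC := @measurable_C R; split.
- exact: L2vB.
- move=> i; under eq_Rintegral do rewrite crdB.
  rewrite RintegralB ?zu ?zw ?subrr//; first by have [[]] := Lu i.
  by have [[]] := Lw i.
- move=> phi tphi.
  have i1 z j : L2v z -> int (fun x => crd j (z x) * 'D_(ebase j) phi x).
    by move=> Lz; exact: intM_cont (L1_int (L2_L1 (Lz j))) (@test_D_continuous R j _ tphi).
  transitivity (\int[leb2]_(x in C) (\sum_(i < 2) crd i (u x) * 'D_(ebase i) phi x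
      - \sum_(i < 2) crd i (w x) * 'D_(ebase i) phi x)).
    by apply: eq_Rintegral => x _; rewrite -sumrB; apply: eq_bigr => i _; rewrite crdB mulrBl.
  rewrite RintegralB//; [|by apply: intb_sum => // j; exact: i1..].
  by rewrite du// dw// subrr.
Qed.

Lemma crdB_comp i u w : crd i \o (u \- w) = (fun p => crd i (u p) - crd i (w p)).
Proof. by apply/funext => p; rewrite /= crdB. Qed.

Lemma space_VB u w : space_V u -> space_V w -> space_V (u \- w).
Proof.
move=> [Hu Wu] [Hw Ww]; split; first exact: space_HB.
by move=> i; rewrite crdB_comp; exact: H1B (Wu i) (Ww i).
Qed.

Lemma space_V_H u : space_V u -> space_H u. Proof. by case. Qed.
Lemma dom_A_V u : dom_A u -> space_V u.
Proof. by case=> Hu Wu; split => // i; case: (Wu i). Qed.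

Lemma l2normE (f : pt R -> R) : l2norm T2 f ^+ 2 = \int[leb2]_(x in C) (f x ^+ 2).
Proof. by rewrite /l2norm sqr_sqrtr// Rintegral_ge0// => x _; exact: sqr_ge0. Qed.

Lemma norm_VE u : norm_V u ^+ 2 = \sum_(i < 2) \sum_(j < 2) \int[leb2]_(x in C) (wd T2 j (crd i \o u) x ^+ 2).
Proof.
rewrite /norm_V sqr_sqrtr; last by do 2 apply: sumr_ge0 => ? _; exact: sqr_ge0.
by do 2 apply: eq_bigr => ? _; rewrite l2normE.
Qed.

Lemma norm_V_ge0 u : 0 <= norm_V u. Proof. exact: sqrtr_ge0. Qed.

(** The projection disappears against a field of H. *)
Lemma leray_ip g h w : is_leray g h -> space_H w -> ip h w = ip g w.
Proof.
move=> [Lg Hh H] Hw; have := H w Hw.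
rewrite ipBl//; try exact: space_H_L2v.
by move=> /eqP; rewrite subr_eq0 => /eqP.
Qed.

Lemma laplacian_ip u w : dom_A u -> space_V w ->
  ip (fun x => - laplacian u x) w =
  \sum_(i < 2) \sum_(j < 2) \int[leb2]_(x in C) (wd T2 j (crd i \o u) x * wd T2 j (crd i \o w) x).
Proof.
move=> [_ Hu] [_ Hw]; have mC := @measurable_C R.
have i1 i j : int (fun x => - (wd T2 j (wd T2 j (crd i \o u)) x * crd i (w x))).
  by apply: intbN; exact: L2_intM (H1_wd_L2 j ((Hu i).2 j)) (H1_L2 (Hw i)).
transitivity (\int[leb2]_(x in C) (\sum_(i < 2) \sum_(j < 2) - (wd T2 j (wd T2 j (crd i \o u)) x * crd i (w x)))).
  apply: eq_Rintegral => x _; rewrite /dotp; apply: eq_bigr => i _.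
  by rewrite crdN crd_mkpt sumrN mulNr mulr_suml.
rewrite Rint_sum//; last by move=> i; exact: intb_sum.
apply: eq_bigr => i _; rewrite Rint_sum//; apply: eq_bigr => j _.
rewrite RintN//; last exact: L2_intM (H1_wd_L2 j ((Hu i).2 j)) (H1_L2 (Hw i)).
by have := H1_ibp j ((Hu i).2 j) (Hw i) => /= ->; rewrite opprK.
Qed.

Lemma wdB_field i j u w : space_V u -> space_V w ->
  {ae leb2, forall x, C x -> wd T2 j (crd i \o (u \- w)) x = wd T2 j (crd i \o u) x - wd T2 j (crd i \o w) x}.
Proof. by move=> [_ Hu] [_ Hw]; rewrite crdB_comp; exact: wdB (Hu i) (Hw i). Qed.

(** With [e = v - u], [B(v,v) - B(u,u) = B(v,e) + B(e,u)], and the first term is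
orthogonal to [e] by [transport_int0]. *)
Lemma advection_ip u v : space_V u -> space_V v -> L2v (advection u u) -> L2v (advection v v) ->
  ip (advection v v) (v \- u) - ip (advection u u) (v \- u) = trilinear (v \- u) u (v \- u).
Proof.
move=> Vu Vv Lau Lav; have mC := @measurable_C R.
set e := v \- u; have Ve : space_V e by exact: space_VB.
have [He We] := Ve; have [Hv Wv] := Vv; have [Hu Wu] := Vu.
have i1 i j : int (fun x => crd j (v x) * wd T2 j (crd i \o e) x * crd i (e x)).
  have := H1_intM3 (Wv j) (We i) (H1_wd_L2 j (We i)).
  by apply: eq_integrable => // x _ /=; congr (_%:E); ring.
have i2 i j : int (fun x => crd j (e x) * wd T2 j (crd i \o u) x * crd i (e x)).
  have := H1_intM3 (We j) (We i) (H1_wd_L2 j (Wu i)).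
  by apply: eq_integrable => // x _ /=; congr (_%:E); ring.
have j1 := intb_sum mC (fun i => intb_sum mC (i1 i)).
have j2 := intb_sum mC (fun i => intb_sum mC (i2 i)).
have -> : trilinear e u e = \int[leb2]_(x in C) (\sum_(i < 2) \sum_(j < 2) crd j (e x) * wd T2 j (crd i \o u) x * crd i (e x)).
  apply: eq_Rintegral => x _; apply: eq_bigr => i _.
  by rewrite crd_mkpt mulr_suml.
have Le := space_H_L2v He.
rewrite /ip -RintegralB//; [|exact: dotp_int|exact: dotp_int].
transitivity (\int[leb2]_(x in C)
    (\sum_(i < 2) \sum_(j < 2) crd j (v x) * wd T2 j (crd i \o e) x * crd i (e x) +
     \sum_(i < 2) \sum_(j < 2) crd j (e x) * wd T2 j (crd i \o u) x * crd i (e x))).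
  apply: Rint_ae => //.
  - exact: (intb_meas (intbB mC (dotp_int Lav Le) (dotp_int Lau Le))).
  - exact: (intb_meas (intbD mC j1 j2)).
  - have W : {ae leb2, forall x, forall i j, C x -> wd T2 j (crd i \o e) x = wd T2 j (crd i \o v) x - wd T2 j (crd i \o u) x}.
      by do 2 apply: ae_forall_ord => ?; exact: wdB_field.
    apply: (aeS W) => x H Cx.
    rewrite -sumrB -big_split; apply: eq_bigr => i _ /=.
    rewrite /advection !crd_mkpt !mulr_suml -sumrB -big_split; apply: eq_bigr => j _ /=.
    by rewrite H// /e /= !crdB; ring.
rewrite RintegralD// -[RHS]add0r; congr (_ + _).
rewrite Rint_sum//; last by move=> i; exact: intb_sum.
by rewrite big1// => i _; exact: (transport_int0 Vv (We i)).
Qed.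

Lemma laplacian_diff u v : dom_A u -> dom_A v ->
  ip (fun x => - laplacian v x) (v \- u) - ip (fun x => - laplacian u x) (v \- u) = norm_V (v \- u) ^+ 2.
Proof.
move=> Du Dv; have Vu := dom_A_V Du; have Vv := dom_A_V Dv.
have Ve := space_VB Vv Vu; have [_ We] := Ve; have [_ Wv] := Vv; have [_ Wu] := Vu.
have mC := @measurable_C R.
rewrite [X in X - _ = _](laplacian_ip Dv Ve) [X in _ - X = _](laplacian_ip Du Ve).
rewrite norm_VE -sumrB; apply: eq_bigr => i _.
rewrite -sumrB; apply: eq_bigr => j _.
have i1 := L2_intM (H1_wd_L2 j (Wv i)) (H1_wd_L2 j (We i)).
have i2 := L2_intM (H1_wd_L2 j (Wu i)) (H1_wd_L2 j (We i)).
rewrite -RintegralB//; apply: Rint_ae => //.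
- exact: (intb_meas (intbB mC i1 i2)).
- exact: (intb_meas (L2_sq (H1_wd_L2 j (We i)))).
- by apply: (aeS (wdB_field i j Vv Vu)) => x /[apply] E; rewrite -mulrBl -E expr2.
Qed.

(** Pairing with [v - u] removes the forcing and, through [leray_ip], all the
projections. *)
Lemma energy_identity (nu mu0 : R) (a : pt R) (f u v ut vt au bu av bv p : field R) :
  space_H ut -> space_H vt ->
  is_A u au -> is_B u u bu -> is_A v av -> is_B v v bv ->
  is_leray (fun x => dotp (v x - u x) a *: (a : R * R)) p ->
  aeq (fun x => ut x + nu *: (au x : R * R) + bu x) f ->
  aeq (fun x => vt x + nu *: (av x : R * R) + bv x) (fun x => f x - mu0 *: (p x : R * R)) ->
  ip (vt \- ut) (v \- u) = - nu * norm_V (v \- u) ^+ 2 - trilinear (v \- u) u (v \- u)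
    - mu0 * l2norm T2 (proj_on (fun=> a) (v \- u)) ^+ 2.
Proof.
move=> Hut Hvt [Du Pu] Bu [Dv Pv] Bv Pp Eu Ev.
have Vu := dom_A_V Du; have Vv := dom_A_V Dv.
set e := v \- u; have Ve : space_V e := space_VB Vv Vu; have He := space_V_H Ve.
have Le := space_H_L2v He.
have mC := @measurable_C R.
have [_ Hau _] := Pu; have [_ Hav _] := Pv; have [Lau Hbu _] := Bu; have [Lav Hbv _] := Bv.
have [_ Hp _] := Pp.
have I z : space_H z -> int (fun x => dotp (z x) (e x)) by move=> /space_H_L2v Lz; exact: dotp_int.
have -> : ip (vt \- ut) e = - nu * (ip av e - ip au e) - (ip bv e - ip bu e) - mu0 * ip p e.
  transitivity (\int[leb2]_(x in C) (- nu * (dotp (av x) (e x) - dotp (au x) (e x))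
      - (dotp (bv x) (e x) - dotp (bu x) (e x)) - mu0 * dotp (p x) (e x))).
    apply: Rint_ae => //.
    - exact: (intb_meas (dotp_int (L2vB (space_H_L2v Hvt) (space_H_L2v Hut)) Le)).
    - apply: (@intb_meas _ _ _ leb2 C); apply: intbB => //; last by apply: intbZ => //; exact: I.
      apply: intbB => //; first apply: intbZ => //; by apply: intbB => //; exact: I.
    - apply: (aeS2 Eu Ev) => x Eux Evx _ /=.
      have -> : vt x - ut x = - nu *: ((av x : R * R) - au x) - (bv x - bu x) - mu0 *: (p x : R * R).
        have -> : vt x = f x - mu0 *: (p x : R * R) - bv x - nu *: (av x : R * R).
          by rewrite -Evx !addrK.
        have -> : ut x = f x - bu x - nu *: (au x : R * R) by rewrite -Eux !addrK.
        rewrite scalerBr scaleNr scaleNr.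
        by apply: injective_projections => /=; ring.
      by rewrite !(dotpBl, dotpZl).
  have B1 : int (fun x => dotp (av x) (e x) - dotp (au x) (e x)) by apply: intbB => //; exact: I.
  have B2 : int (fun x => dotp (bv x) (e x) - dotp (bu x) (e x)) by apply: intbB => //; exact: I.
  have B3 : int (fun x => - nu * (dotp (av x) (e x) - dotp (au x) (e x))) by exact: intbZ.
  rewrite RintegralB//; last 2 first.
  - exact: intbB.
  - by apply: intbZ => //; exact: I.
  rewrite RintegralB// !RintegralZl//; last exact: I.
  by rewrite !RintegralB//; exact: I.
rewrite (leray_ip Pv He) (leray_ip Pu He) (leray_ip Bv He) (leray_ip Bu He) (leray_ip Pp He).
rewrite laplacian_diff// advection_ip//.
congr (_ - _ * _); rewrite l2normE; apply: eq_Rintegral => x _.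
by rewrite dotpZl expr2 /proj_on /= [dotp a _]dotpC.
Qed.

End fields.

(** * A smooth step *)

Section step.
Context {R : realType}.

(** [x^-k exp (- 1/x)], extended by 0.  The derivative of a member is a combination
of two others, so that all of them are smooth at once. *)
Definition flat (k : nat) (x : R) : R := if 0 < x then (x^-1) ^+ k * expR (- x^-1) else 0.

Lemma flat_le0 k x : x <= 0 -> flat k x = 0.
Proof. by rewrite /flat ltNge => ->. Qed.

Lemma flat_ge0 k x : 0 <= flat k x.
Proof.
rewrite /flat; case: ifP => // x0.
by rewrite mulr_ge0 ?expR_ge0// exprn_ge0// invr_ge0 ltW.
Qed.

(** The exponential beats any power; a linear bound is what the difference quotient
at 0 asks for. *)
Lemma flat_bound k x : 0 < x -> flat k x <= k.+1`!%:R * x.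
Proof.
move=> x0; rewrite /flat x0; set y := x^-1; have y0 : 0 < y by rewrite invr_gt0.
have := expR_ge1Dxn k (ltW y0); set F := k.+1`!%:R => H.
have F0 : 0 < F by rewrite ltr0n fact_gt0.
have {}H : y ^+ k.+1 / F <= expR y by rewrite (le_trans _ H)// lerDr.
have -> : x = y^-1 by rewrite /y invrK.
rewrite expRN ler_pdivrMr ?expR_gt0//.
rewrite ler_pdivrMr// in H.
have -> : F * y^-1 * expR y = y^-1 * (expR y * F) by ring.
by rewrite ler_pdivlMl// -exprS.
Qed.

Lemma is_derive_flat k (x : R) :
  is_derive x 1 (flat k) (- k%:R * flat k.+1 x + flat k.+2 x).
Proof.
have [x0|x0|->] := ltgtP x 0.
- rewrite !flat_le0 ?ltW// mulr0 addr0.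
  have H0 : is_derive (x : R) (1 : R) (fun=> 0 : R) 0 by exact: is_derive_cst.
  apply: (near_eq_is_derive _ H0).
  by near=> y; rewrite flat_le0// ltW//; near: y; exact: lt_nbhsl.
- have dinv : is_derive (x : R) 1 (fun y : R => y^-1) (- x ^- 2).
    have df : differentiable (GRing.inv : R -> R) x by apply: differentiable_Rinv; rewrite gt_eqF.
    apply: DeriveDef; first exact/derivable1_diffP.
    by rewrite deriveE// diff_Rinv ?gt_eqF// /GRing.scale/= mulr1.
  have dN : is_derive (x : R) 1 (fun y : R => - y^-1) (- - x ^- 2) by exact: is_deriveN.
  have dE := @is_derive1_comp R expR (fun y : R => - y^-1) x _ _ (is_derive_expR (- x^-1)) dN.
  have dP n : is_derive (x : R) 1 (fun y : R => (y^-1) ^+ n) (- n%:R * (x^-1) ^+ n.+1).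
    elim: n => [|n IH].
      have -> : (fun y : R => y^-1 ^+ 0) = cst 1 by apply/funext => y; rewrite expr0.
      rewrite oppr0 mul0r; exact: is_derive_cst.
    have H := is_deriveM dinv IH.
    have -> : (fun y : R => y^-1 ^+ n.+1) = (fun y : R => y^-1) * (fun y => y^-1 ^+ n).
      by apply/funext => y; rewrite exprS.
    apply: (is_derive_eq H); rewrite /GRing.scale/= -exprVn !exprS -natr1; ring.
  have dM := is_deriveM (dP k) dE.
  apply: (@near_eq_is_derive _ _ _ _ _ _ _ _ _ (is_derive_eq dM _)).
    by near=> y; rewrite /flat ifT//; near: y; exact: lt_nbhsr.
  by rewrite /flat x0 /= /GRing.scale/= opprK -exprVn !exprS; ring.
rewrite !flat_le0// mulr0 addr0.
have lim0 : (h^-1 *: ((flat k \o shift 0) (h *: 1) - flat k 0)) @[h --> 0^'] --> (0 : R).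
  have B h : `|h^-1 *: ((flat k \o shift 0) (h *: 1) - flat k 0)| <= k.+2`!%:R * `|h|.
    rewrite /= addr0 {2}/flat ltxx subr0 /GRing.scale/= mulr1.
    have [h0|h0] := ltP 0 h; last by rewrite flat_le0// mulr0 normr0 mulr_ge0.
    rewrite (_ : h^-1 * flat k h = flat k.+1 h); last by rewrite /flat h0 exprS mulrA.
    by rewrite ger0_norm ?flat_ge0// (gtr0_norm h0) flat_bound.
  apply/cvgrPdist_le => /= eps eps0; near=> h.
  rewrite sub0r normrN (le_trans (B h))// mulrC -ler_pdivlMr ?ltr0n ?fact_gt0//.
  near: h; apply: dnbhs0_le; by rewrite divr_gt0// ltr0n fact_gt0.
by apply: DeriveDef; [apply/cvg_ex; exists 0|apply/cvg_lim].
Unshelve. all: by end_near. Qed.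

Lemma smooth1_flat k : smooth1 (flat k).
Proof.
move=> n; elim: n k => [//|n IH] k.
apply: (Cn_intro (@is_derive_flat k)).
by apply: Cn_add => //; apply: Cn_mul => //; exact: Cn_cst.
Qed.

Lemma flat_gt0 k x : 0 < x -> 0 < flat k x.
Proof. by move=> x0; rewrite /flat x0 mulr_gt0 ?expR_gt0// exprn_gt0// invr_gt0. Qed.

Lemma flat0_le x y : x <= y -> flat 0 x <= flat 0 y.
Proof.
have [x0 _|x0 xy] := leP x 0; first by rewrite flat_le0// flat_ge0.
have y0 := lt_le_trans x0 xy.
by rewrite /flat x0 y0 !expr0 !mul1r ler_expR lerN2 lef_pV2.
Qed.

(** Built by composition alone: the inner function [flat 0 1 - flat 0 x] is constant
before 0 and nonpositive after 1, where the outer [flat 0] vanishes. *)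
Definition step (x : R) : R := 1 - flat 0 (flat 0 1 - flat 0 x) / flat 0 (flat 0 1).

Lemma smooth1_step : smooth1 step.
Proof.
have f1 : smooth1 (fun x : R => flat 0 1 - flat 0 x).
  rewrite (_ : (fun x => _) = (fun x => flat 0 1 + (-1) * flat 0 x)); last first.
    by apply/funext => x; rewrite mulN1r.
  apply: smooth1_add; first exact: smooth1_cst.
  by apply: smooth1_mul; [exact: smooth1_cst|exact: smooth1_flat].
have f2 := smooth1_comp (@smooth1_flat 0) f1.
rewrite (_ : step = (fun x => 1 + (- (flat 0 (flat 0 1))^-1) * flat 0 (flat 0 1 - flat 0 x))); last first.
  by apply/funext => x; rewrite /step mulNr mulrC.
by apply: smooth1_add; [exact: smooth1_cst|apply: smooth1_mul => //; exact: smooth1_cst].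
Qed.

Let c0 : 0 < flat 0 (flat 0 1).
Proof. by apply: flat_gt0; exact: flat_gt0. Qed.

Lemma step_le0 x : x <= 0 -> step x = 0.
Proof. by move=> x0; rewrite /step (flat_le0 _ x0) subr0 divff ?subrr// gt_eqF// c0. Qed.

Lemma step_ge1 x : 1 <= x -> step x = 1.
Proof.
move=> x1; rewrite /step [flat 0 (_ - _)]flat_le0 ?mul0r ?subr0//.
by rewrite subr_le0 flat0_le.
Qed.

Lemma step_01 x : 0 <= step x <= 1.
Proof.
rewrite /step subr_ge0 ler_pdivrMr ?c0// mul1r flat0_le; last by rewrite gerBl flat_ge0.
by rewrite /= gerBl divr_ge0 ?flat_ge0.
Qed.

Lemma derive_step_out x : x < 0 \/ 1 < x -> derive1 step x = 0.
Proof.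
move=> H; rewrite derive1E.
have [c E] : exists c, \near x, step x = (cst c : R -> R) x.
  case: H => H; [exists 0|exists 1]; near=> y.
    by rewrite step_le0// ltW//; near: y; exact: lt_nbhsl.
  by rewrite step_ge1// ltW//; near: y; exact: lt_nbhsr.
by rewrite (near_eq_derive _ E) derive_cst.
Unshelve. all: by end_near. Qed.

Lemma derive_step_bound : exists M, forall x, `|derive1 step x| <= M.
Proof.
have cont : continuous (derive1 step).
  by apply: smooth1_continuous; apply: smooth1_derive; exact: smooth1_step.
have : compact (derive1 step @` `[0, 1]).
  apply: continuous_compact; last exact: segment_compact.
  exact: continuous_subspaceT.
move=> /compact_bounded [M [_ HM]].
exists (Num.max 0 (M + 1)) => x; rewrite le_max.
have [x0|x0] := ltP x 0; first by rewrite derive_step_out ?normr0 ?lexx//; left.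
have [x1|x1] := ltP 1 x; first by rewrite derive_step_out ?normr0 ?lexx//; right.
apply/orP; right; apply: HM; first by rewrite ltrDl.
by exists x => //=; rewrite in_itv/= x0.
Qed.

End step.

(** * Distributional derivatives in time *)

Section time.
Context {R : realType}.
Notation mu := (@lebesgue_measure R).
Implicit Types g G : R -> R.

Lemma Rint_support (A B : set R) g : B `<=` A -> (forall x, A x -> ~ B x -> g x = 0) ->
  \int[mu]_(x in A) g x = \int[mu]_(x in B) g x.
Proof.
move=> BA g0; rewrite -[in RHS](setIidr BA) Rintegral_mkcondr.
apply: eq_Rintegral => x /set_mem Ax; rewrite /patch; case: ifPn => // /negP nB.
by apply: g0 => // Bx; apply: nB; exact: mem_set.
Qed.

Lemma norm_sub01 (y z : R) : 0 <= y <= 1 -> 0 <= z <= 1 -> `|y - z| <= 1.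
Proof. by move=> /andP[? ?] /andP[? ?]; rewrite ler_norml; apply/andP; split; lra. Qed.

(** The derivative of a step that rises between [s] and [s + 1 / (n + 1)]. *)
Definition bump (s : R) (n : nat) (x : R) : R := n.+1%:R * derive1 step (n.+1%:R * (x - s)).

Lemma smooth1_stepn s n : smooth1 (fun x : R => step (n.+1%:R * (x - s))).
Proof.
apply: smooth1_comp; first exact: smooth1_step.
apply: smooth1_mul; first exact: smooth1_cst.
exact: smooth1_add (@smooth1_id _) (smooth1_cst _).
Qed.

Lemma derive_stepn s n : derive1 (fun x : R => step (n.+1%:R * (x - s))) = bump s n.
Proof.
apply: derive1_fun => x.
have d1 : is_derive (x : R) 1 (fun x : R => n.+1%:R * (x - s)) n.+1%:R.
  have -> : (fun x : R => n.+1%:R * (x - s)) = (n.+1%:R \*: (@id R)) + cst (- (n.+1%:R * s)).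
    by apply/funext => y; rewrite mulrBr.
  have : is_derive (x : R) (1 : R) ((n.+1%:R \*: (@id R)) + cst (- (n.+1%:R * s))) (n.+1%:R *: (1 : R) + 0).
    exact: is_deriveD.
  by rewrite addr0 /GRing.scale/= mulr1.
have d2 : is_derive (n.+1%:R * (x - s)) 1 (@step R) (derive1 step (n.+1%:R * (x - s))).
  by rewrite derive1E; apply: derivableP; apply: smooth1_derivable; exact: smooth1_step.
have := @is_derive1_comp R (@step R) (fun x => n.+1%:R * (x - s)) x _ _ d2 d1.
by rewrite /bump mulrC.
Qed.

Lemma bump_continuous s n : continuous (bump s n).
Proof. by rewrite -derive_stepn; apply: smooth1_continuous; apply: smooth1_derive; exact: smooth1_stepn. Qed.

Lemma bump_out s n x : x < s \/ s + n.+1%:R^-1 < x -> bump s n x = 0.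
Proof.
move=> H; rewrite /bump derive_step_out ?mulr0//.
have n0 : 0 < n.+1%:R :> R by rewrite ltr0n.
case: H => H; [left|right].
  by rewrite pmulr_rlt0// subr_lt0.
by rewrite -ltr_pdivrMl// mulr1 ltrBrDl.
Qed.

Lemma cont_int (a b : R) g : (forall x, a <= x <= b -> {for x, continuous g}) ->
  mu.-integrable `[a, b] (EFin \o g).
Proof.
move=> cg; apply: continuous_compact_integrable; first exact: segment_compact.
apply: continuous_in_subspaceT => x; rewrite inE/= in_itv/=; exact: cg.
Qed.

(** The bumps have integral one, height of order [n] and support of length
[1 / (n + 1)]. *)
Lemma bump_cvg s b g : s < b -> (forall x, s <= x <= b -> {for x, continuous g}) ->
  \int[mu]_(x in `[s, b]) (bump s n x * g x) @[n --> \oo] --> g s.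
Proof.
move=> sb cg.
have [M HM] := @derive_step_bound R.
have M0 : 0 <= M by exact: le_trans (normr_ge0 _) (HM 0).
apply/cvgrPdist_le => /= eps eps0.
have e0 : 0 < eps / (M + 1) by rewrite divr_gt0// ltr_wpDl.
have cgs : {for s, continuous g} by apply: cg; rewrite lexx ltW.
move: cgs => /cvgrPdist_le/(_ _ e0).
rewrite near_nbhs => /nbhs_ballP[d /= d0 Hd].
have bs : 0 < b - s by rewrite subr_gt0.
near=> n.
have n0 : 0 < n.+1%:R :> R by rewrite ltr0n.
have nd : n.+1%:R^-1 < d.
  near: n; exact: (near_infty_natSinv_lt (PosNum d0)).
have nb : n.+1%:R^-1 < b - s.
  near: n; exact: (near_infty_natSinv_lt (PosNum bs)).
set J := `[s, b]%classic; have mJ : @measurable _ (measurableTypeR R) J by exact: measurable_itv.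
have ib : mu.-integrable J (EFin \o bump s n).
  by apply: cont_int => x _; exact: bump_continuous.
have ibg : mu.-integrable J (EFin \o (fun x => bump s n x * g x)).
  by apply: cont_int => x xJ; apply: cvgM; [exact: bump_continuous|exact: cg].
have one : \int[mu]_(x in J) bump s n x = 1.
  rewrite -derive_stepn /Rintegral (@continuous_FTC2 R _ (fun x => step (n.+1%:R * (x - s))) s b sb) /=.
  - rewrite subrr mulr0 (step_le0 (lexx 0)) subr0; apply: step_ge1.
    by rewrite -ler_pdivrMl// mulr1 ltW.
  - by rewrite derive_stepn; apply: continuous_subspaceT; exact: bump_continuous.
  - have cs := smooth1_continuous (@smooth1_stepn s n); split.
    + by move=> x _; apply: smooth1_derivable; exact: smooth1_stepn.
    + by apply: cvg_at_right_filter; exact: cs.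
    + by apply: cvg_at_left_filter; exact: cs.
  - by [].
have -> : g s - \int[mu]_(x in J) (bump s n x * g x) = \int[mu]_(x in J) (g s * bump s n x - bump s n x * g x).
  by rewrite RintegralB//; [rewrite RintegralZl// one mulr1|exact: intbZ].
set K := `[s, s + n.+1%:R^-1]%classic.
have KJ : K `<=` J.
  move=> x; rewrite /K /J /= !in_itv/= => /andP[-> xs] /=.
  by rewrite (le_trans xs)// -lerBrDl ltW.
rewrite (@Rint_support J K)//; last first.
  move=> x; rewrite /K /J /= !in_itv/= => /andP[sx xb] /negP.
  rewrite sx /= -ltNge => h; rewrite bump_out ?mulr0 ?mul0r ?subrr//; by right.
have mK : @measurable _ (measurableTypeR R) K by exact: measurable_itv.
have iF : mu.-integrable K (EFin \o (fun x => g s * bump s n x - bump s n x * g x)).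
  apply: (@integrableS _ _ _ mu J) => //; apply: intbB => //; exact: intbZ.
have muK : mu K = (n.+1%:R^-1)%:E.
  have := @lebesgue_measure_itv R `[s, s + n.+1%:R^-1].
  by rewrite /= lte_fin ltrDl invr_gt0 n0 => ->; congr (_%:E); rewrite addrAC subrr add0r.
apply: le_trans (le_normr_Rintegral mK iF) _.
apply: (@le_trans _ _ (\int[mu]_(x in K) (n.+1%:R * M * (eps / (M + 1))))).
  apply: le_Rintegral => //.
  - exact: integrable_norm.
  - by apply: (@intb_cst _ _ _ mu K mK); rewrite -[X in (X < _)%E]/(mu K) muK ltry.
  - move=> x; rewrite /K /= in_itv/= => /andP[sx xs].
    have -> : g s * bump s n x - bump s n x * g x = bump s n x * (g s - g x) by ring.
    rewrite normrM ler_pM//.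
      by rewrite /bump normrM gtr0_norm// ler_pM2l.
    apply: Hd; rewrite /ball /= ler0_norm ?subr_le0// opprB ltrBlDl.
    by rewrite (le_lt_trans xs)// ltrD2l.
rewrite Rintegral_cst//.
have -> : n.+1%:R * M * (eps / (M + 1)) * fine (mu K) = eps * (M / (M + 1)).
  rewrite muK /=.
  by field; rewrite ?gt_eqF// ltr_wpDl.
by rewrite ler_piMr ?(ltW eps0)// ler_pdivrMr ?ltr_wpDl// mul1r lerDl.
Unshelve. all: by end_near. Qed.

(** Differences of rescaled steps are test functions that approach the indicator of
the interval from [s] to [t]; their derivatives concentrate at [s] and [t], where
[g] is continuous. *)
Lemma weak_time_ftc T g G : mu.-integrable `]0, T[ (EFin \o G) ->
  (forall x, 0 < x < T -> {for x, continuous g}) ->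
  (forall phi, test_time T phi ->
    \int[mu]_(x in `]0, T[) (derive1 phi x * g x) = - \int[mu]_(x in `]0, T[) (phi x * G x)) ->
  forall s t, 0 < s -> s < t -> t < T -> g t - g s = \int[mu]_(x in `]s, t]) G x.
Proof.
move=> Gi cg H s t s0 st tT.
pose b := (t + T) / 2; have tb : t < b by rewrite /b; lra.
have bT : b < T by rewrite /b; lra.
(* The support of [phi n] ends at [t + 1 / (n + 1)], below [b] for large [n]. *)
pose phi n (x : R) := step (n.+1%:R * (x - s)) - step (n.+1%:R * (x - t)).
have sphi n : smooth1 (phi n).
  rewrite (_ : phi n = (fun x => step (n.+1%:R * (x - s)) + (-1) * step (n.+1%:R * (x - t)))); last first.
    by apply/funext => x; rewrite mulN1r.
  apply: smooth1_add; first exact: smooth1_stepn.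
  by apply: smooth1_mul; [exact: smooth1_cst|exact: smooth1_stepn].
have dphi n : derive1 (phi n) = (fun x => bump s n x - bump t n x).
  apply: derive1_fun => x.
  have d z : is_derive (x : R) 1 (fun x : R => step (n.+1%:R * (x - z))) (bump z n x).
    by rewrite -derive_stepn derive1E; apply: derivableP; apply: smooth1_derivable; exact: smooth1_stepn.
  have := is_deriveB (d s) (d t); by apply.
have cgs x : s <= x <= b -> {for x, continuous g}.
  by move=> /andP[sx xb]; apply: cg; lra.
have cgt x : t <= x <= b -> {for x, continuous g}.
  by move=> /andP[sx xb]; apply: cg; lra.
have Ls := bump_cvg (lt_trans st tb) cgs; have Lt := bump_cvg tb cgt.
have LHS : \int[mu]_(x in `]0, T[) (derive1 (phi n) x * g x) @[n --> \oo] --> g s - g t.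
  have bt : 0 < b - t by rewrite subr_gt0.
  apply: cvg_trans (cvgB Ls Lt); apply: near_eq_cvg; near=> n.
  have nb : n.+1%:R^-1 < b - t.
    near: n; exact: (near_infty_natSinv_lt (PosNum bt)).
  set J := `[s, b]%classic; have mJ : @measurable _ (measurableTypeR R) J by exact: measurable_itv.
  have JT : J `<=` `]0, T[ by move=> x; rewrite /J /= !in_itv/= => /andP[sx xb]; lra.
  rewrite (@Rint_support `]0, T[ J)//; last first.
    move=> x; rewrite /J /= !in_itv/= => _ /negP; rewrite negb_and -!ltNge dphi => /orP[xs|bx].
      by rewrite !bump_out ?subr0 ?mul0r//; left => //; exact: lt_trans st.
    have tx : t + n.+1%:R^-1 < x by rewrite -ltrBrDl (lt_trans nb)// ltrD2r.
    by rewrite !bump_out ?subr0 ?mul0r//; right => //; rewrite (lt_trans _ tx)// ltrD2r.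
  rewrite dphi.
  have i z : mu.-integrable J (EFin \o (fun x => bump z n x * g x)).
    by apply: cont_int => x xJ; apply: cvgM; [exact: bump_continuous|exact: cgs].
  under [RHS]eq_Rintegral do rewrite mulrBl.
  rewrite RintegralB//; congr (_ - _); symmetry; apply: Rint_support.
    by move=> x; rewrite /J /= !in_itv/= => /andP[tx ->]; rewrite (le_trans (ltW st) tx).
  move=> x; rewrite /J /= !in_itv/= => /andP[sx ->] /negP; rewrite andbT -ltNge => xt.
  by rewrite bump_out ?mul0r//; left.
(* On the other side dominated convergence applies, as steps lie between 0 and 1. *)
have [||||_ RHS] := @Rint_dct _ _ R mu `]0, T[ (measurable_itv _) (fun n x => phi n x * G x)
  (fun x => \1_`]s, t] x * G x) (fun x => `|G x|).
- move=> n; apply: measurable_funM; last exact: (intb_meas Gi).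
  apply: measurable_funTS; apply: continuous_measurable_fun.
  exact: smooth1_continuous (sphi n).
- exact: integrable_norm.
- move=> n x _; rewrite normrM ler_piMl// /phi.
  exact: norm_sub01 (step_01 _) (step_01 _).
- move=> x _; apply: cvgM; last exact: cvg_cst.
  have S z : step (n.+1%:R * (x - z)) @[n --> \oo] --> ((z < x)%R%:R : R).
    have [zx|xz] := ltP z x; last first.
      apply: cvg_near_cst; apply: nearW => n.
      by rewrite step_le0// mulr_ge0_le0// subr_le0.
    have zx0 : 0 < x - z by rewrite subr_gt0.
    apply: cvg_near_cst; near=> n.
    rewrite step_ge1// -ler_pdivrMl ?ltr0n// mulr1 ltW//.
    near: n; exact: (near_infty_natSinv_lt (PosNum zx0)).
  rewrite (_ : \1_`]s, t] x = (s < x)%R%:R - (t < x)%R%:R); first exact: cvgB (S s) (S t).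
  rewrite indicE mem_setE in_itv/=; case: (ltP s x) => sx; case: (leP x t) => xt; rewrite ?subrr ?subr0//.
  by have := lt_le_trans (lt_trans st xt) sx; rewrite ltxx.
have E : g s - g t = - \int[mu]_(x in `]0, T[) (\1_`]s, t] x * G x).
  apply: (@cvg_unique _ (@Rhausdorff R) _ _ _ _ LHS).
  have Tt : 0 < T - t by rewrite subr_gt0.
  apply: cvg_trans (cvgN RHS); apply: near_eq_cvg; near=> n.
  have nT : n.+1%:R^-1 < T - t.
    near: n; exact: (near_infty_natSinv_lt (PosNum Tt)).
  rewrite H//; split; first by have /smooth1P := sphi n.
  exists s, (t + n.+1%:R^-1); split => //; first by rewrite -ltrBrDl.
  have n0 : 0 < n.+1%:R :> R by rewrite ltr0n.
  move=> x; rewrite in_itv/= negb_and -!ltNge => /orP[xs|tx]; rewrite /phi.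
    by rewrite !step_le0 ?subrr// mulr_ge0_le0// ?subr_le0 ?ltW//; exact: lt_trans st.
  by rewrite !step_ge1 ?subrr// -ler_pdivrMl// mulr1 ltW// ltrBrDl// (lt_trans _ tx)// ltrD2r.
rewrite -opprB E opprK.
rewrite (@Rint_support `]0, T[ `]s, t]).
- by apply: eq_Rintegral => x; rewrite inE => xs; rewrite indicE mem_set// mul1r.
- by move=> x /=; rewrite !in_itv/= => /andP[sx xt]; lra.
- by move=> x _ nx; rewrite indicE memNset// mul0r.
Unshelve. all: by end_near. Qed.

End time.

(** * A Gronwall inequality with small local errors *)

Section gronwall.
Context {R : realType}.
Notation mu := (@lebesgue_measure R).

(** Real induction: the supremum of the points where [W x <= W a] is reached and
cannot be smaller than [b]. *)
Lemma locally_decr (W : R -> R) (a b : R) : a <= b ->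
  (forall c, a <= c <= b -> exists2 d, 0 < d & forall s s', a <= s -> s < s' -> s' <= b ->
     `|s - c| < d -> `|s' - c| < d -> W s' <= W s) -> W b <= W a.
Proof.
move=> ab H.
pose S := [set x | a <= x <= b /\ W x <= W a].
have Sa : S a by rewrite /S /= lexx ab.
have hS : has_sup S.
  by split; [exists a|exists b => x [/andP[]]].
pose c := sup S.
have ac : a <= c by apply: ub_le_sup => //; case: hS.
have cb : c <= b by apply: ge_sup; [exists a|move=> x [/andP[]]].
have [d d0 Hd] : exists2 d, 0 < d & forall s s', a <= s -> s < s' -> s' <= b ->
     `|s - c| < d -> `|s' - c| < d -> W s' <= W s by apply: H; rewrite ac cb.
have [x Sx cx] := sup_adherent d0 hS; rewrite -/c in cx.
have [/andP[ax xb] Wx] := Sx.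
have xc : x <= c by apply: ub_le_sup => //; case: hS.
have Wc : W c <= W a.
  have [->//|xc'] := eqVneq c x; apply: le_trans Wx; apply: Hd => //.
  - by rewrite lt_neqAle eq_sym xc'.
  - by rewrite ler0_norm ?subr_le0// opprB ltrBlDl -ltrBlDr.
  - by rewrite subrr normr0.
have [->//|cb'] := eqVneq b c.
have cltb : c < b by rewrite lt_neqAle eq_sym cb' cb.
pose y := Num.min b (c + d / 2).
have cy : c < y by rewrite /y lt_min cltb ltrDl divr_gt0.
have yb : y <= b by rewrite /y ge_min lexx.
have Sy : S y.
  split; first by rewrite yb (le_trans ac (ltW cy)).
  apply: le_trans Wc; apply: Hd => //; first by rewrite subrr normr0.
  rewrite gtr0_norm ?subr_gt0// ltrBlDl /y gt_min ltrD2l; apply/orP; right.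
  by rewrite gtr_pMr// invf_lt1// ltr1n.
have : y <= c by apply: ub_le_sup => //; case: hS.
by rewrite leNgt cy.
Qed.

(** Near each instant the differential inequality holds up to an arbitrarily small
fraction of the integral of [M].  Over the whole interval these errors add up to
the same fraction of a finite integral.  This form suits an energy known only
through its increments. *)
Lemma gronwall_local (Y M : R -> R) (k a b : R) : 0 <= k -> a < b ->
  (forall t, 0 <= Y t) -> (forall t, 0 <= M t) -> mu.-integrable `]a, b] (EFin \o M) ->
  (forall c eps, a <= c <= b -> 0 < eps ->
     exists2 d, 0 < d & forall s s', a <= s -> s < s' -> s' <= b ->
     `|s - c| < d -> `|s' - c| < d ->
     Y s' - Y s <= - k * (s' - s) * Y s + eps * \int[mu]_(x in `]s, s']) M x) ->
  expR (k * b) * Y b <= expR (k * a) * Y a.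
Proof.
move=> k0 ab Y0 M0 iM H.
set B := \int[mu]_(x in `]a, b]) M x.
have B0 : 0 <= B by exact: Rintegral_ge0.
have sub s : s <= b -> mu.-integrable `]a, s] (EFin \o M).
  move=> sb; apply: integrableS iM => //.
  by move=> x /=; rewrite !in_itv/= => /andP[-> /le_trans]; apply.
have key eps : 0 < eps -> expR (k * b) * Y b <= expR (k * a) * Y a + eps * expR (k * b) * B.
  move=> eps0.
  (* The weighted energy minus the accumulated errors decreases. *)
  pose W t := expR (k * t) * Y t - eps * expR (k * b) * \int[mu]_(x in `]a, t]) M x.
  suff : W b <= W a.
    have Ia : \int[mu]_(x in `]a, a]) M x = 0 by rewrite set_itv_ge ?bnd_simp ?ltxx// Rintegral_set0.
    by rewrite /W Ia mulr0 subr0 lerBlDr.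
  apply: locally_decr; first exact: ltW.
  move=> c cab; have [d d0 Hd] := H c eps cab eps0; exists d => // s s' as_ ss' s'b sc s'c.
  have := Hd s s' as_ ss' s'b sc s'c.
  set Q := \int[mu]_(x in `]s, s']) M x => HY.
  have Q0 : 0 <= Q by exact: Rintegral_ge0.
  have E : \int[mu]_(x in `]a, s']) M x = \int[mu]_(x in `]a, s]) M x + Q.
    have b1 : (BRight a <= BRight s)%O by rewrite bnd_simp.
    have b2 : (BRight s <= BRight s')%O by rewrite bnd_simp ltW.
    by rewrite /Q -(@Rintegral_itvB R M (BRight a) (BRight s') s (sub s' s'b) b1 b2) addrC subrK.
  have E1 : expR (k * s') * (1 - k * (s' - s)) <= expR (k * s).
    have -> : k * s = k * s' + - (k * (s' - s)) by ring.
    rewrite expRD ler_pM2l ?expR_gt0//; exact: expR_ge1Dx.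
  have E2 : expR (k * s') <= expR (k * b) by rewrite ler_expR ler_wpM2l.
  have h1 := expR_gt0 (k * s').
  have h2 : expR (k * s') * Y s' <= expR (k * s') * ((1 - k * (s' - s)) * Y s + eps * Q).
    by rewrite ler_pM2l//; lra.
  have h3 : expR (k * s') * (1 - k * (s' - s)) * Y s <= expR (k * s) * Y s by rewrite ler_wpM2r.
  have h4 : expR (k * s') * (eps * Q) <= expR (k * b) * (eps * Q).
    by rewrite ler_wpM2r// mulr_ge0// ltW.
  rewrite /W E.
  lra.
apply/ler_addgt0Pr => z z0.
have P0 : 0 <= expR (k * b) * B by rewrite mulr_ge0 ?expR_ge0.
have P1 : 0 < expR (k * b) * B + 1 by rewrite ltr_wpDl.
apply: le_trans (key (z / (expR (k * b) * B + 1)) _) _; first exact: divr_gt0.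
rewrite lerD2l -mulrA mulrAC ler_pdivrMr// ler_pM2l// lerDl//.
Qed.

End gronwall.

(** * Continuity and increments of the velocity in H *)

Section evolution.
Context {R : realType}.
Notation mu := (@lebesgue_measure R).
Local Notation C := (cell (@T2 R)).
Implicit Types (u v ut vt : R -> field R) (w : field R).

Lemma L2Z (c : R) (f : pt R -> R) : L2 T2 f -> L2 T2 (fun p => c * f p).
Proof.
move=> [[pf mf fi] f2]; have mC := @measurable_C R; split.
  split; [by move=> p q pq; rewrite (pf p q pq)|exact: measurable_funM|exact: intbZ].
have := intbZ mC (c ^+ 2) f2.
by apply: eq_integrable => // p _ /=; rewrite exprMn.
Qed.

Lemma L2_0 : L2 T2 (fun _ : pt R => 0 : R).
Proof.
have [_ L1c _] := @is_wd_cst R 0 0; split => //.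
have [_ _] := L1c.
by apply: eq_integrable => //; [exact: measurable_C|move=> x _ /=; rewrite expr0n].
Qed.

Lemma L2D (f g : pt R -> R) : L2 T2 f -> L2 T2 g -> L2 T2 (fun p => f p + g p).
Proof.
move=> Lf Lg; have := L2B Lf (L2Z (-1) Lg).
by congr (L2 _ _); apply/funext => p; rewrite mulN1r opprK.
Qed.

Lemma L2v_sum k (c : 'I_k -> R) (w : 'I_k -> field R) : (forall i, L2v (w i)) ->
  L2v (fun x => \sum_(i < k) c i *: (w i x : R * R)).
Proof.
move=> Lw j.
have -> : crd j \o (fun x => \sum_(i < k) c i *: (w i x : R * R)) = fun x => \sum_(i < k) c i * crd j (w i x).
  apply/funext => x /=; elim: k c w {Lw} => [|k IH] c w.
    by rewrite !big_ord0 /crd; case: (j == 0).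
  by rewrite !big_ord_recr /= crdD crdZ; congr (_ + _);
    exact: (IH (fun i => c (widen_ord (leqnSn k) i)) (fun i => w (widen_ord (leqnSn k) i))).
elim: k c w Lw => [|k IH] c w Lw.
  by under eq_fun do rewrite big_ord0; exact: L2_0.
under eq_fun do rewrite big_ord_recr /=.
by apply: L2D; [exact: IH|exact: L2Z (Lw _ j)].
Qed.

Lemma ip_sum k (c : 'I_k -> R) (w : 'I_k -> field R) z : (forall i, L2v (w i)) -> L2v z ->
  ip (fun x => \sum_(i < k) c i *: (w i x : R * R)) z = \sum_(i < k) c i * ip (w i) z.
Proof.
move=> Lw Lz; have mC := @measurable_C R.
transitivity (\int[leb2]_(x in C) (\sum_(i < k) c i * dotp (w i x) (z x))).
  apply: eq_Rintegral => x _; elim: k c w {Lw} => [|k IH] c w.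
    by rewrite !big_ord0 /dotp big1// => i _; rewrite /crd; case: (i == 0); rewrite mul0r.
  by rewrite !big_ord_recr /= dotpDl dotpZl; congr (_ + _);
    exact: (IH (fun i => c (widen_ord (leqnSn k) i)) (fun i => w (widen_ord (leqnSn k) i))).
rewrite Rint_sum//; last by move=> i; apply: intbZ => //; exact: dotp_int.
by apply: eq_bigr => i _; rewrite RintegralZl//; exact: dotp_int.
Qed.

Lemma norm_HB_le (u w : field R) : L2v u -> L2v w -> norm_H (u \- w) <= norm_H u + norm_H w.
Proof.
move=> Lu Lw; have Luw := L2vB Lu Lw.
rewrite -ler_sqr ?nnegrE ?addr_ge0 ?norm_H_ge0// sqrrD !norm_HE.
have -> : ip (u \- w) (u \- w) = ip u u - 2 * ip u w + ip w w.
  by rewrite ipBl// !ipBr// (ipC w u); ring.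
have /ler_normlP[h _] := ip_CS Lu Lw.
rewrite lerD2r lerD2l -mulr_natl; lra.
Qed.

Lemma dist_H_le (u v w : field R) : L2v u -> L2v v -> L2v w ->
  norm_H (u \- v) <= norm_H (u \- w) + norm_H (v \- w).
Proof.
move=> Lu Lv Lw.
have -> : u \- v = (u \- w) \- (v \- w).
  by apply/funext => x /=; rewrite opprB addrA subrK.
by apply: norm_HB_le; exact: L2vB.
Qed.

Section one.
Variables (T : R) (u ut : R -> field R) (lam : R).
Hypothesis T0 : 0 < T.
Hypothesis Plam : poincare_const lam.
Hypothesis cont : cont_V T u.
Hypothesis boch : bochner_L2 space_H norm_H T ut.
Hypothesis deriv : is_time_deriv T u ut.

(** Through the Poincare inequality. *)
Lemma cont_V_H (c : R) (eps : R) : 0 <= c <= T -> 0 < eps -> exists2 d, 0 < d &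
  forall t, 0 <= t <= T -> `|t - c| < d -> norm_H (u t \- u c) <= eps.
Proof.
move=> cT eps0; have [lam0 HP] := Plam.
have mem t : 0 <= t <= T -> t \in `[0, T] by rewrite in_itv.
have [Vc cc] := cont (mem _ cT).
have e0 : 0 < Num.sqrt lam * eps by rewrite mulr_gt0// sqrtr_gt0.
move/cvgrPdist_le : cc => /(_ _ e0).
rewrite near_withinE near_nbhs => /nbhs_ballP[d /= d0 Hd].
exists d => // t tT tc.
have [Vt _] := cont (mem _ tT).
have := Hd t; rewrite /ball /= distrC tc => /(_ isT).
move=> /(_ (mem _ tT)); rewrite sub0r normrN ger0_norm ?norm_V_ge0// => H.
have := HP _ (space_VB Vt Vc) => H'.
have : norm_V (u t \- u c) ^+ 2 <= lam * eps ^+ 2.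
  rewrite -[lam in leRHS](sqr_sqrtr (ltW lam0)) -exprMn.
  by rewrite ler_sqr// nnegrE ?norm_V_ge0// ltW.
move=> /(le_trans H'); rewrite ler_pM2l// ler_sqr// nnegrE ?norm_H_ge0//.
exact: ltW.
Qed.

(** Measurability comes from the approximating simple functions, the bound from the
Cauchy-Schwarz inequality. *)
Lemma boch_ip_int w : space_H w -> mu.-integrable `]0, T[ (EFin \o (fun t => ip (ut t) w)).
Proof.
move=> Hw; have Lw := space_H_L2v Hw.
have [HX [s [simp cvs]] iN] := boch.
have mD : @measurable _ (measurableTypeR R) `]0, T[ by exact: measurable_itv.
apply: (@intb_le _ _ _ mu `]0, T[ mD _ (fun t => norm_H w * (1 + norm_H (ut t) ^+ 2))).
- apply: (@measurable_fun_cvg _ _ _ `]0, T[ (fun n t => ip (s n t) w)).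
    move=> n; have [k [E [z [mE Hz sE]]]] := simp n.
    have -> : (fun t => ip (s n t) w) = fun t => \sum_(i < k) \1_(E i) t * ip (z i) w.
      apply/funext => t.
      rewrite -ip_sum//; last by move=> i; exact/space_H_L2v.
      by congr ip; apply/funext => x; rewrite sE.
    apply: measurable_sum => i; apply: measurable_funM => //.
  move=> t tT.
  have Lut : L2v (ut t) by exact/space_H_L2v/HX.
  have Lst n : L2v (s n t).
    have [k [E [z [mE Hz sE]]]] := simp n.
    have -> : s n t = fun x => \sum_(i < k) (\1_(E i) t : R) *: (z i x : R * R) by apply/funext => x; rewrite sE.
    by apply: L2v_sum => i; exact/space_H_L2v.
  have B n : `|ip (s n t) w - ip (ut t) w| <= norm_H (s n t \- ut t) * norm_H w.
    by rewrite -ipBl//; apply: ip_CS => //; exact: L2vB.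
  have cz : norm_H (s n t \- ut t) * norm_H w @[n --> \oo] --> 0.
    rewrite -[X in _ --> X](mul0r (norm_H w)); apply: cvgM; last exact: cvg_cst.
    by apply: cvs.
  apply/cvgrPdist_le => eps eps0; move/cvgrPdist_le : cz => /(_ _ eps0).
  apply: filterS => n; rewrite sub0r normrN ger0_norm ?mulr_ge0 ?norm_H_ge0// => h.
  by rewrite distrC (le_trans (B n)).
- move=> t tT; have Lut : L2v (ut t) by exact/space_H_L2v/HX.
  rewrite (le_trans (ip_CS Lut Lw))// mulrC ler_wpM2l ?norm_H_ge0//.
  have := sqr_ge0 (norm_H (ut t) - 1); have := norm_H_ge0 (ut t); nra.
- apply: intbZ => //; apply: intbD => //.
  apply: (@intb_cst _ _ _ mu `]0, T[ mD).
  by have := @lebesgue_measure_itv R `]0, T[; rewrite /= lte_fin T0 oppr0 adde0 => ->; rewrite ltry.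
Qed.

Lemma boch_int : mu.-integrable `]0, T[ (EFin \o (fun t => norm_H (ut t) ^+ 2)).
Proof. by have [] := boch. Qed.

(** The scalar functions [ip (u t) w] are continuous, with the integrable
distributional derivative [ip (ut t) w]. *)
Lemma increment w s t : space_H w -> 0 < s -> s < t -> t < T ->
  ip (u t) w - ip (u s) w = \int[mu]_(x in `]s, t]) ip (ut x) w.
Proof.
move=> Hw s0 st tT.
apply: (@weak_time_ftc R T (fun t => ip (u t) w) (fun t => ip (ut t) w) (boch_ip_int Hw)) => //;
  last by move=> phi tphi; exact: deriv.
move=> c cT; have cT' : 0 <= c <= T by move: cT => /andP[/ltW -> /ltW ->].
have mem x : 0 <= x <= T -> x \in `[0, T] by rewrite in_itv.
have LV x : 0 <= x <= T -> L2v (u x).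
  by move=> /mem xT; have [/space_V_H/space_H_L2v] := cont xT.
apply/cvgrPdist_le => eps eps0.
have e0 : 0 < eps / (norm_H w + 1) by rewrite divr_gt0// ltr_wpDl// norm_H_ge0.
have [d d0 Hd] := cont_V_H cT' e0.
move: cT => /andP[c0 cT].
near=> x.
have xT : 0 <= x <= T.
  by apply/andP; split; apply: ltW; near: x; [exact: lt_nbhsr|exact: lt_nbhsl].
have xc : `|x - c| < d.
  rewrite distrC; near: x; apply/nbhs_ballP; exists d => //.
have Lw := space_H_L2v Hw.
rewrite distrC -(ipBl (LV _ xT) (LV _ cT') Lw).
apply: le_trans (ip_CS (L2vB (LV _ xT) (LV _ cT')) Lw) _.
have := Hd x xT xc; have w0 := norm_H_ge0 w => h.
apply: le_trans (ler_wpM2r w0 h) _.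
have w1 : 0 < norm_H w + 1 by rewrite ltr_wpDl.
by rewrite mulrAC ler_pdivrMr// ler_pM2l// lerDl.
Unshelve. all: by end_near. Qed.

End one.
End evolution.

(** * Exponential decay of the energy *)

Section sq_diff.
Context {R : realType}.
Implicit Types A B : field R.

(** Increments in time are only known against fixed fields: here [A] and [B]
themselves play that role. *)
Lemma norm_H_diff A B : L2v A -> L2v B ->
  norm_H A ^+ 2 - norm_H B ^+ 2 = ip (A \- B) A + ip (A \- B) B.
Proof. by move=> LA LB; rewrite !norm_HE !ipBl// (ipC B A); ring. Qed.

Lemma norm_H_diff2 A B : L2v A -> L2v B ->
  norm_H A ^+ 2 - norm_H B ^+ 2 = norm_H (A \- B) ^+ 2 + 2 * ip (A \- B) B.
Proof.
move=> LA LB; have LAB := L2vB LA LB.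
by rewrite !norm_HE !ipBl// !ipBr// (ipC B A); ring.
Qed.

End sq_diff.

Lemma Rint_le_ae d (T : measurableType d) (R : realType) (m : {measure set T -> \bar R})
    (D : set T) (mD : measurable D) (f g : T -> R) :
  m.-integrable D (EFin \o f) -> m.-integrable D (EFin \o g) ->
  {ae m, forall x, D x -> f x <= g x} ->
  \int[m]_(x in D) f x <= \int[m]_(x in D) g x.
Proof.
move=> fi gi fg.
have mf := intb_meas fi; have mg := intb_meas gi.
have mn : measurable_fun D (fun x => Num.min (f x) (g x)) by exact: measurable_minr.
have fn : {ae m, forall x, D x -> f x = Num.min (f x) (g x)}.
  by apply: filterS fg => x /[apply] /min_idPl ->.
rewrite (Rint_ae mD mf mn fn); apply: le_Rintegral => //.
- apply: (@intb_ae _ _ _ m D mD _ f) => //.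
  by apply: filterS fn => x /[apply].
- by move=> x _; rewrite ge_min lexx orbT.
Qed.

Section arithmetic.
Context {R : realType}.
Implicit Types a b k x y z N eps : R.

Lemma ler_scale_close k y z eps : 0 <= k -> `|y - z| <= eps -> - k * z <= - k * y + k * eps.
Proof. by move=> k0 yz; have := ler_norm (y - z); nra. Qed.

Lemma ler_sum_squares N a b : N <= a + b -> N * 2 <= 4 + 2 * (a ^+ 2 + b ^+ 2).
Proof.
move=> h; have := sqr_ge0 (a - 1); have := sqr_ge0 (b - 1).
have := sqr_ge0 a; have := sqr_ge0 b; nra.
Qed.

Lemma ler_error k x y z b N S a eps : x <= - (k / 2) * y -> a <= N * eps -> b <= N * eps ->
  - k * y <= - k * z + k * eps -> N * 2 * eps <= S * eps ->
  2 * x + a + b <= - k * z + eps * (k + S).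
Proof. by move=> *; lra. Qed.

End arithmetic.

Section energy_decay.
Context {R : realType}.
Notation mu := (@lebesgue_measure R).
Variables (u v ut vt : R -> field R) (lam k t0 : R).
Hypothesis Plam : poincare_const lam.
Hypothesis Su : strong_class u ut.
Hypothesis Sv : strong_class v vt.
Hypothesis k0 : 0 <= k.
Hypothesis t00 : 0 <= t0.
Hypothesis H : {ae mu, forall t, t0 < t ->
  ip (vt t \- ut t) (v t \- u t) <= - (k / 2) * norm_H (v t \- u t) ^+ 2}.

Local Notation e t := (v t \- u t).
Local Notation Y t := (norm_H (v t \- u t) ^+ 2).

Let VL (w : R -> field R) (wt : R -> field R) (t : R) : strong_class w wt -> 0 <= t -> L2v (w t) /\ space_H (w t).
Proof.
move=> S ht.
have T0 : 0 < t + 1 by lra.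
have [cont _ _ _] := S _ T0.
have tT : t \in `[0, t + 1] by rewrite in_itv/= ht lerDl ler01.
have [/space_V_H HV _] := cont _ tT.
by split => //; exact: space_H_L2v.
Qed.

Let He (t : R) : 0 <= t -> space_H (e t).
Proof. by move=> ht; apply: space_HB; [exact: (VL Sv ht).2|exact: (VL Su ht).2]. Qed.

Let Le (t : R) : 0 <= t -> L2v (e t).
Proof. by move=> ht; apply: space_H_L2v; exact: He. Qed.

Let cont_e (T c eps : R) : 0 <= c <= T -> 0 < T -> 0 < eps -> exists2 d, 0 < d &
  forall t, 0 <= t <= T -> `|t - c| < d -> norm_H (e t \- e c) <= eps.
Proof.
move=> cT T0 eps0; have e2 : 0 < eps / 2 by rewrite divr_gt0.
have [cu _ _ _] := Su T0; have [cv _ _ _] := Sv T0.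
have [du du0 Hu] := cont_V_H Plam cu cT e2.
have [dv dv0 Hv] := cont_V_H Plam cv cT e2.
exists (Num.min du dv); first by rewrite lt_min du0.
move=> t tT; rewrite lt_min => /andP[tu tv].
have t0' : 0 <= t by case/andP: tT.
have c0' : 0 <= c by case/andP: cT.
have -> : e t \- e c = (v t \- v c) \- (u t \- u c).
  by apply/funext => x; apply: injective_projections => /=; ring.
have Lv := L2vB (VL Sv t0').1 (VL Sv c0').1.
have Lu := L2vB (VL Su t0').1 (VL Su c0').1.
apply: le_trans (norm_HB_le Lv Lu) _.
have := Hu t tT tu; have := Hv t tT tv; lra.
Qed.

Let Ydiff (s t : R) : 0 <= s -> 0 <= t -> Y t - Y s = ip (e t \- e s) (e t) + ip (e t \- e s) (e s).
Proof.
move=> hs ht; have Ls := Le hs; have Lt := Le ht.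
exact: norm_H_diff.
Qed.

Let Yclose (s c d : R) : 0 <= s -> 0 <= c -> 0 <= d -> norm_H (e s \- e c) <= d ->
  `|Y s - Y c| <= d * (2 * norm_H (e c) + d).
Proof.
move=> hs hc hd sc; have Ls := Le hs; have Lc := Le hc.
have Lsc := L2vB Ls Lc.
rewrite (norm_H_diff2 Ls Lc).
apply: le_trans (ler_normD _ _) _.
have n0 := norm_H_ge0 (e s \- e c); have c0 := norm_H_ge0 (e c).
have h := ip_CS Lsc Lc; rewrite [`|2 * _|]normrM normr_nat (ger0_norm (sqr_ge0 (norm_H _))).
have h2 : norm_H (e s \- e c) * norm_H (e c) <= d * norm_H (e c) by rewrite ler_wpM2r.
have h3 : norm_H (e s \- e c) ^+ 2 <= d ^+ 2 by rewrite lerXn2r ?nnegrE.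
nra.
Qed.

(** Integrable in time, and large enough for [eps * M r] to dominate all the errors
made in [step_ineq]. *)
Let M (t : R) : R := k + 4 + 2 * (norm_H (vt t) ^+ 2 + norm_H (ut t) ^+ 2).

Let M0 (t : R) : 0 <= M t.
Proof.
rewrite /M; have := sqr_ge0 (norm_H (vt t)); have := sqr_ge0 (norm_H (ut t)).
move: (_ ^+ 2) (_ ^+ 2) k0 => x y hk hx hy; lra.
Qed.

Let Mi (T a b : R) : 0 < T -> 0 <= a -> b < T -> mu.-integrable `]a, b] (EFin \o M).
Proof.
move=> T0 a0 bT.
have sub : `]a, b] `<=` `]0, T[.
  by move=> x /=; rewrite !in_itv/= => /andP[ax xb]; apply/andP; split; lra.
have [_ _ Bu _] := Su T0; have [_ _ Bv _] := Sv T0.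
have iu := boch_int Bu; have iv := boch_int Bv.
have mT : @measurable _ (measurableTypeR R) `]0, T[ by exact: measurable_itv.
have muT : (mu (`]0%R, T[%classic : set R) < +oo)%E.
  by have := @lebesgue_measure_itv R `]0, T[; rewrite /= lte_fin T0 oppr0 adde0 => ->; rewrite ltry.
apply: (@integrableS _ _ _ mu `]0, T[) => //.
apply: intbD => //; first exact: (@intb_cst _ _ _ mu _ mT).
by apply: intbZ => //; apply: intbD.
Qed.

(** The increment of the energy is the integral of [(e_t(r), e(s) + e(t))], and
[e(s) + e(t)] differs from [2 e(r)] by at most [2 d] in H. *)
Let step_ineq (T s t d eps : R) : 0 < T -> t0 < s -> s < t -> t < T -> 0 <= eps ->
  (forall r, s <= r <= t -> norm_H (e s \- e r) <= d /\ norm_H (e t \- e r) <= d /\ `|Y s - Y r| <= eps) ->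
  d <= eps ->
  Y t - Y s <= - k * (t - s) * Y s + eps * \int[mu]_(r in `]s, t]) M r.
Proof.
move=> T0 ts st tT eps0 close deps; have hk := k0; have ht0 := t00.
have s0 : 0 < s by lra.
have ht : 0 <= t by lra. have hs : 0 <= s by lra.
have [_ _ Bu Du] := Su T0; have [_ _ Bv Dv] := Sv T0.
have [cu _ _ _] := Su T0; have [cv _ _ _] := Sv T0.
have HeS := He hs; have HeT := He ht; have LeS := Le hs; have LeT := Le ht.
set J := `]s, t]%classic; have mJ : @measurable _ (measurableTypeR R) J by exact: measurable_itv.
have JT : J `<=` `]0, T[.
  by move=> x; rewrite /J /= !in_itv/= => /andP[ax xb]; apply/andP; split; lra.
have iu w : space_H w -> mu.-integrable J (EFin \o (fun r => ip (ut r) w)).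
  by move=> Hw; apply: (@integrableS _ _ _ mu `]0, T[) => //; exact: boch_ip_int.
have iv w : space_H w -> mu.-integrable J (EFin \o (fun r => ip (vt r) w)).
  by move=> Hw; apply: (@integrableS _ _ _ mu `]0, T[) => //; exact: boch_ip_int.
have inc w : space_H w -> ip (e t \- e s) w = \int[mu]_(r in J) (ip (vt r) w - ip (ut r) w).
  move=> Hw; have Lw := space_H_L2v Hw.
  rewrite RintegralB//; [|exact: iv|exact: iu].
  rewrite -(increment T0 Plam cu Bu Du Hw s0 st tT) -(increment T0 Plam cv Bv Dv Hw s0 st tT).
  have Lvt := (VL Sv ht).1; have Lvs := (VL Sv hs).1; have Lut := (VL Su ht).1; have Lus := (VL Su hs).1.
  by rewrite !ipBl//; ring.
have iw w : space_H w -> mu.-integrable J (EFin \o (fun r => ip (vt r) w - ip (ut r) w)).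
  by move=> Hw; apply: intbB => //; [exact: iv|exact: iu].
rewrite Ydiff// !inc// -RintegralD//; [|exact: iw|exact: iw].
have iM : mu.-integrable J (EFin \o M) by exact: Mi T0 hs tT.
have muJ : mu J = (t - s)%:E.
  by have := @lebesgue_measure_itv R `]s, t]; rewrite /= lte_fin st.
have ic c : mu.-integrable J (EFin \o (fun=> c : R)).
  by apply: (@intb_cst _ _ _ mu J mJ); rewrite -[X in (X < _)%E]/(mu J) muJ ltry.
have -> : - k * (t - s) * Y s + eps * \int[mu]_(r in J) M r = \int[mu]_(r in J) (- k * Y s + eps * M r).
  have ick := ic (- k * Y s); have iMe := intbZ mJ eps iM.
  rewrite (RintegralD mJ ick iMe).
  rewrite RintegralZl//; congr (_ + _).
  have -> : \int[mu]_(r in J) (- k * Y s) = (- k * Y s) * (t - s).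
    by rewrite Rintegral_cst//; congr (_ * _); rewrite -[LHS]/(fine (mu J)) muJ.
  by ring.
have HJ : {ae mu, forall r, J r ->
   (ip (vt r) (e t) - ip (ut r) (e t)) + (ip (vt r) (e s) - ip (ut r) (e s)) <= - k * Y s + eps * M r}.
  apply: (aeS H) => r Hr Jr.
  have rT : r \in `]0, T[ by exact: JT.
  have r0 : 0 <= r by move: Jr; rewrite /J /= in_itv/= => /andP[? _]; lra.
  have t0r : t0 < r by move: Jr; rewrite /J /= in_itv/= => /andP[? _]; lra.
  have {}Hr := Hr t0r.
  have str : s <= r <= t by move: Jr; rewrite /J /= in_itv/= => /andP[/ltW -> ->].
  have [c1 [c2 c3]] := close r str.
  have Ler := Le r0.
  have [/(_ r rT) /space_H_L2v Lur _ _] := Bu; have [/(_ r rT) /space_H_L2v Lvr _ _] := Bv.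
  have Ld := L2vB Lvr Lur.
  have n1 := norm_HB_le Lvr Lur.
  have b1 := ip_CS Ld (L2vB LeT Ler); have b2 := ip_CS Ld (L2vB LeS Ler).
  have -> : ip (vt r) (e t) - ip (ut r) (e t) + (ip (vt r) (e s) - ip (ut r) (e s)) =
     2 * ip (vt r \- ut r) (e r) + ip (vt r \- ut r) (e t \- e r) + ip (vt r \- ut r) (e s \- e r).
    by rewrite !(ipBr LeT Ler Ld) !(ipBr LeS Ler Ld) !(ipBl Lvr Lur)//; ring.
  have {}b1 := le_trans (ler_norm _) b1; have {}b2 := le_trans (ler_norm _) b2.
  set N := norm_H (vt r \- ut r) in b1 b2 n1.
  have N0 : 0 <= N := norm_H_ge0 _.
  have b1' : N * norm_H (e t \- e r) <= N * eps by rewrite ler_wpM2l// (le_trans c2).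
  have b2' : N * norm_H (e s \- e r) <= N * eps by rewrite ler_wpM2l// (le_trans c1).
  have c3' := ler_scale_close hk c3.
  have NM' : N * 2 * eps <= (4 + 2 * (norm_H (vt r) ^+ 2 + norm_H (ut r) ^+ 2)) * eps.
    by rewrite ler_wpM2r// ler_sum_squares.
  have A1 := le_trans b1 b1'.
  have A2 := le_trans b2 b2'.
  have K := ler_error Hr A1 A2 c3' NM'.
  rewrite /M -(addrA k).
  exact: K.
apply: (@Rint_le_ae _ _ _ mu J mJ) => //.
  by apply: intbD => //; exact: iw.
by apply: intbD => //; exact: intbZ.
Qed.

Let decay_from (s t : R) : t0 < s -> s <= t -> Y t <= expR (- k * (t - s)) * Y s.
Proof.
move=> ts st; have hk := k0; have ht0 := t00.
move: st; rewrite le_eqVlt => /orP[/eqP <-|st].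
  by rewrite subrr mulr0 expR0 mul1r.
have T0 : 0 < t + 1 by lra.
have tT : t < t + 1 by lra.
have s0 : 0 <= s by lra.
have G : expR (k * t) * Y t <= expR (k * s) * Y s.
  apply: (@gronwall_local R (fun r : R => norm_H (v r \- u r) ^+ 2) M k s t) => //.
  - by move=> r; exact: sqr_ge0.
  - exact: (Mi T0 s0 tT).
  move=> c eps /andP[sc ct] eps0.
  have c0 : 0 <= c by lra.
  have cT : 0 <= c <= t + 1 by apply/andP; split; lra.
  (* Keeps both the fields in H and, by [Yclose], their energies within [eps / 4]. *)
  pose d1 := Num.min (eps / 4) (Num.min 1 (eps / (4 * (2 * norm_H (e c) + 1)))).
  have nc := norm_H_ge0 (e c).
  have d10 : 0 < d1.
    rewrite !lt_min ltr01 !divr_gt0//; lra.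
  have d1e : d1 <= eps / 4 by rewrite /d1 ge_min lexx.
  have e42 : eps / 4 + eps / 4 <= eps / 2 by lra.
  have e44 : eps / 4 + eps / 4 <= eps by lra.
  have d12 := le_trans (lerD d1e d1e) e42.
  have d11 : d1 <= 1 by rewrite /d1 !ge_min lexx orbT.
  have d1n : d1 * (2 * norm_H (e c) + 1) <= eps / 4.
    have h : 0 < 2 * norm_H (e c) + 1 by lra.
    rewrite -ler_pdivlMr// -mulrA -invfM.
    by rewrite /d1 !ge_min lexx !orbT.
  have [d d0 Hd] := cont_e cT T0 d10.
  exists d => // r r' sr rr' r't rc r'c.
  have inc x : r <= x <= r' -> `|x - c| < d.
    move=> /andP[rx xr']; move: rc r'c; rewrite !ltr_norml => /andP[? ?] /andP[? ?].
    by apply/andP; split; lra.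
  have near x : r <= x <= r' -> [/\ 0 <= x, norm_H (e x \- e c) <= d1 & `|Y x - Y c| <= eps / 4].
    move=> /andP[rx xr']; have x0 : 0 <= x by lra.
    have hx : norm_H (e x \- e c) <= d1.
      by apply: Hd; [apply/andP; split; lra|apply: inc; rewrite rx].
    split => //; apply: le_trans (Yclose x0 c0 (ltW d10) hx) _.
    apply: le_trans d1n; rewrite ler_wpM2l ?(ltW d10)//; lra.
  have r_in : r <= r <= r' by rewrite lexx ltW.
  have r'_in : r <= r' <= r' by rewrite lexx ltW.
  apply: (@step_ineq (t + 1) r r' (eps / 2) eps) => //; [lra|lra|exact: ltW| |lra].
  move=> x xin; have [r0 r1 r2] := near _ r_in; have [r'0 r'1 r'2] := near _ r'_in.
  have [x0 x1 x2] := near _ xin.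
  have Lr := Le r0; have Lr' := Le r'0; have Lx := Le x0; have Lc := Le c0.
  have h1 := dist_H_le Lr Lx Lc; have h2 := dist_H_le Lr' Lx Lc.
  split; first exact: le_trans h1 (le_trans (lerD r1 x1) d12).
  split; first exact: le_trans h2 (le_trans (lerD r'1 x1) d12).
  have -> : Y r - Y x = (Y r - Y c) - (Y x - Y c) by rewrite opprB addrA subrK.
  exact: le_trans (ler_normB _ _) (le_trans (lerD r2 x2) e44).
rewrite -(ler_pM2l (expR_gt0 (k * t))) (mulrA _ (expR (- k * _))) -(expRD (k * t)).
by have -> : k * t + - k * (t - s) = k * s by ring.
Qed.

(** [decay_from] starts at positive times, at which increments are known; continuity
in H then reaches [t0], which may be 0. *)
Lemma energy_decay (t : R) : t0 <= t -> Y t <= expR (- k * (t - t0)) * Y t0.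
Proof.
have hk := k0; have ht0 := t00.
rewrite le_eqVlt => /orP[/eqP <-|tt].
  by rewrite subrr mulr0 expR0 mul1r.
have T0 : 0 < t by lra.
have tT : 0 <= t0 <= t by rewrite ht0 ltW.
have cY : Y s @[s --> t0^'+] --> Y t0.
  apply/cvgrPdist_le => eps eps0.
  have nc := norm_H_ge0 (e t0).
  pose d1 := Num.min 1 (eps / (2 * norm_H (e t0) + 1)).
  have h : 0 < 2 * norm_H (e t0) + 1 by lra.
  have d10 : 0 < d1 by rewrite lt_min ltr01 divr_gt0.
  have d11 : d1 <= 1 by rewrite ge_min lexx.
  have d1n : d1 * (2 * norm_H (e t0) + 1) <= eps.
    by rewrite -ler_pdivlMr// ge_min lexx orbT.
  have [d d0 Hd] := cont_e tT T0 d10.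
  near=> s.
  have s1 : t0 < s by near: s; exact: nbhs_right_gt.
  have s2 : s < t by near: s; exact: nbhs_right_lt.
  have s3 : s < t0 + d by near: s; apply: nbhs_right_lt; lra.
  have s0 : 0 <= s by lra.
  rewrite distrC.
  have hs : norm_H (e s \- e t0) <= d1.
    apply: Hd; first by rewrite s0 ltW.
    by rewrite ltr_norml; apply/andP; split; lra.
  apply: le_trans (Yclose s0 ht0 (ltW d10) hs) _.
  apply: (le_trans _ d1n); rewrite ler_wpM2l ?(ltW d10)//; lra.
have cE : expR (- k * (t - s)) @[s --> t0^'+] --> expR (- k * (t - t0)).
  apply: cvg_at_right_filter; apply: continuous_cvg; first exact: continuous_expR.
  by apply: cvgM; [exact: cvg_cst|apply: cvgB; [exact: cvg_cst|exact: cvg_id]].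
have cM : expR (- k * (t - s)) * Y s @[s --> t0^'+] --> expR (- k * (t - t0)) * Y t0.
  exact: cvgM cE cY.
apply: (cvgr_to_ge cM).
near=> s; apply: decay_from.
  by near: s; exact: nbhs_right_gt.
by near: s; exact: nbhs_right_le.
Unshelve. all: end_near.
Qed.

End energy_decay.

(** * The covering attached to a rational direction *)

Section periodic_ae.
Context {R : realType}.
Notation mu := (@lebesgue_measure R).
Local Notation L := (2 * pi : R).
Local Notation I := (`[0, 2 * pi[%classic : set R).
Local Notation C := (cell (@T2 R)).

Lemma measurable_translation (c : R) : measurable_fun setT (fun x : measurableTypeR R => x + c : measurableTypeR R).
Proof. exact: (@measurable_funD _ _ _ setT (fun x : measurableTypeR R => x) (fun=> c)). Qed.

Lemma lebesgue_translation (c : R) (A : set R) : @measurable _ (measurableTypeR R) A ->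
  mu ((fun x => x + c) @^-1` A) = mu A.
Proof.
move=> mA; symmetry.
pose tr : {mfun measurableTypeR R >-> measurableTypeR R} := mfun_Sub (mem_set (measurable_translation c)).
apply: (@lebesgue_measure_unique R (pushforward mu tr)) => // _ [[a b]] _ <-.
transitivity (mu (`]a - c, b - c]%classic : set R)); last first.
  rewrite /pushforward; congr (mu _).
  by apply/seteqP; split => x /=; rewrite !in_itv/= => /andP[? ?]; apply/andP; split; lra.
rewrite !lebesgue_measure_itv/= !lte_fin ltrD2r; case: ifP => // _.
by congr (_%:E); ring.
Qed.

(** Countably many translates of a period cover the line. *)
Lemma ae_periodic (Q : R -> Prop) : (forall x (k : int), Q (x + k%:~R * L) -> Q x) ->
  {ae mu, forall x, I x -> Q x} -> {ae mu, forall x, Q x}.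
Proof.
move=> pQ [N [mN N0 QN]].
have H (k : int) : mu.-negligible ((fun x => x + - (k%:~R * L)) @^-1` N).
  exists ((fun x => x + - (k%:~R * L)) @^-1` N); split => //.
    by rewrite -[X in measurable X]setTI; apply: measurable_translation.
  by rewrite lebesgue_translation.
have := negligible_bigcup (fun n => H (odflt 0 (unpickle n))).
apply: negligibleS => x /= nQ.
pose k := Num.floor (x / L).
exists (pickle k) => //=; rewrite pickleK/=; apply: QN => /=.
have L0 := @L_gt0 R.
move=> h; apply: nQ; apply: (pQ _ (- k)); rewrite rmorphN/= mulNr; apply: h.
have := ge_floor (x / L); have := lt_succ_floor (x / L); rewrite -/k intrD.
rewrite ler_pdivlMr// ltr_pdivrMr// mulrDl mul1r in_itv/= => h1 h2.
by apply/andP; split; lra.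
Qed.

(** Weak derivatives are determined on a cell, whereas L^oo norms are taken over the
plane; [ae_periodic] is applied in each variable. *)
Lemma ae_cell_plane (g : pt R -> R) : Defs.periodic T2 g -> measurable_fun setT g ->
  {ae leb2, forall p, C p -> g p = 0} -> {ae leb2, forall p, g p = 0}.
Proof.
move=> pg mg H.
pose A := [set p | g p <> 0].
have mA : measurable A.
  have -> : A = ~` (g @^-1` [set 0]) by [].
  apply: measurableC; rewrite -[X in measurable X]setTI; apply: mg => //.
have per (s r : R) (k l : int) : g (line 0 (s + k%:~R * L) (r + l%:~R * L)) = g (line 0 s r).
  by apply: pg; exists (k, l).
have per1 (s r : R) (k : int) : g (line 0 (s + k%:~R * L) r) = g (line 0 s r).
  by have := per s r k 0; rewrite mul0r addr0.
have per2 (s r : R) (k : int) : g (line 0 s (r + k%:~R * L)) = g (line 0 s r).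
  by have := per s r 0 k; rewrite mul0r addr0.
have K : {ae leb2, forall p, (setT `*` setT) p -> ~ A p}.
  apply: (line_ae (j := 0)) => //.
  have K : {ae mu, forall r, {ae mu, forall s, g (line 0 s r) = 0}}.
    apply: (@ae_periodic (fun r => {ae mu, forall s, g (line 0 s r) = 0})).
      by move=> r k Hr; apply: (aeS Hr) => s; rewrite per2.
    apply: (aeS (ae_line 0 H)) => r Hr Ir.
    apply: (@ae_periodic (fun s => g (line 0 s r) = 0)); first by move=> s k; rewrite per1.
    by apply: (aeS Hr) => s + Is; apply; split.
  by apply: (aeS K) => r Hr _; apply: (aeS Hr) => s + _; rewrite /A /= => ->.
by apply: (aeS K) => p /(_ (conj Logic.I Logic.I)) /contrapT.
Qed.

Lemma linfnorm_cst_ae (g : pt R -> R) (c : R) : {ae leb2, forall p, g p = c} ->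
  (linfnorm g < +oo)%E.
Proof.
move=> H; rewrite /linfnorm unlock; case: ifP => // _.
apply: (@le_lt_trans _ _ (`|c|%:E)); last by rewrite ltry.
by apply/ess_supP; apply: (aeS H) => p /= ->.
Qed.

(** The chosen weak derivatives of a constant vanish almost everywhere only, so that
their own weak derivatives are obtained through [is_wd_ae]. *)
Lemma w2infnorm_cst (c : R) : (w2infnorm T2 (fun=> c) < +oo)%E.
Proof.
have Wc j : is_wd T2 j (fun _ : pt R => c) (fun=> 0) := @is_wd_cst R j c.
have L1w j : L1 T2 (wd T2 j (fun _ : pt R => c)) by have [] := is_wd_has (Wc j).
have ae1 j := wd_eq (Wc j).
have Ww j k : is_wd T2 k (wd T2 j (fun _ : pt R => c)) (fun=> 0).
  exact: (is_wd_ae (@is_wd_cst R k 0) (L1w j) (ae1 j)).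
have L1ww j k : L1 T2 (wd T2 k (wd T2 j (fun _ : pt R => c))) by have [] := is_wd_has (Ww j k).
have plane (g : pt R -> R) : L1 T2 g -> {ae leb2, forall p, C p -> g p = 0} -> (linfnorm g < +oo)%E.
  by move=> [pg mg _] H; apply: (@linfnorm_cst_ae g 0); exact: ae_cell_plane.
rewrite /w2infnorm asboolT; last first.
  split; first by have [] := Wc 0.
  by move=> j; split; [exact: is_wd_has (Wc j)|move=> k; exact: is_wd_has (Ww j k)].
rewrite !lte_add_pinfty//.
- by apply: (@linfnorm_cst_ae _ c); exact: aeW.
- by apply: lte_sum_pinfty => j _; apply: plane (ae1 j).
- apply: lte_sum_pinfty => j _; apply: lte_sum_pinfty => k _.
  exact: plane (wd_eq (Ww j k)).
Qed.

End periodic_ae.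

Section linear_covering.
Context {R : realType}.

Definition affine (a b c : R) (p : pt R) : R := a * crd 0 p + b * crd 1 p + c.

Lemma is_derive_affine a b c (p v : pt R) :
  is_derive p v (affine a b c) (a * crd 0 v + b * crd 1 v).
Proof.
have H i : is_derive p v (fun q => id (crd i q)) (crd i v * derive1 id (crd i p)).
  by apply: is_derive_crd; exact: derivable_id.
have H0 := H 0; have H1 := H 1.
have := @is_deriveD _ _ _ _ _ _ _ _ _ (is_deriveD (is_deriveZ a H0) (is_deriveZ b H1)) (is_derive_cst c p v).
have -> : (a *: (fun q => id (crd 0 q)) + b *: (fun q => id (crd 1 q)) + cst c) = affine a b c.
  by [].
move=> K; apply: (is_derive_eq K).
by rewrite !derive1E !derive_id addr0 /GRing.scale/= !mulr1.
Qed.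

Lemma derive_affine a b c (v p : pt R) : 'D_v (affine a b c) p = a * crd 0 v + b * crd 1 v.
Proof. exact: (@derive_val _ _ _ _ _ _ _ (is_derive_affine a b c p v)). Qed.

Lemma continuous_affine a b c : continuous (affine a b c).
Proof.
move=> p; apply: cvgD; last exact: cvg_cst.
by apply: cvgD; apply: cvgM; [exact: cvg_cst|exact: continuous_crd|exact: cvg_cst|exact: continuous_crd].
Qed.

Lemma pder_affine a b c s : exists a' b' c', pder s (affine a b c) = affine a' b' c'.
Proof.
elim: s => [|j s [a' [b' [c' E]]]]; first by exists a, b, c.
exists 0, 0, (a' * crd 0 (ebase j) + b' * crd 1 (ebase j)).
rewrite /= E; apply/funext => p; rewrite derive_affine /affine; ring.
Qed.

Lemma smooth2_affine a b c : smooth2 (affine a b c).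
Proof.
move=> s; have [a' [b' [c' ->]]] := pder_affine a b c s.
split; first exact: continuous_affine.
by move=> j x; exact: (@ex_derive _ _ _ _ _ _ _ (is_derive_affine a' b' c' x (ebase j))).
Qed.

(** The entries of the matrix are listed row by row. *)
Definition linmap (k1 l1 k2 l2 : int) : field R := fun Y =>
  (k1%:~R * Y.1 + l1%:~R * Y.2, k2%:~R * Y.1 + l2%:~R * Y.2).

Lemma crd_linmap k1 l1 k2 l2 i : crd i \o linmap k1 l1 k2 l2 =
  affine (if i == 0 then k1%:~R else k2%:~R) (if i == 0 then l1%:~R else l2%:~R) 0.
Proof.
by apply/funext => Y; rewrite /affine /linmap /crd /=; case: (i == 0); rewrite /= addr0.
Qed.

Lemma continuous_linmap k1 l1 k2 l2 : continuous (linmap k1 l1 k2 l2).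
Proof.
move=> Y.
have c a b : (fun p : pt R => a * p.1 + b * p.2) p @[p --> Y] --> a * Y.1 + b * Y.2.
  have := @continuous_affine a b 0 Y; rewrite /continuous_at /affine addr0.
  by under eq_fun do rewrite addr0.
exact: cvg_pair (c _ _) (c _ _).
Qed.

Lemma tequiv_linmap k1 l1 k2 l2 p q : tequiv T2 p q ->
  tequiv T2 (linmap k1 l1 k2 l2 p) (linmap k1 l1 k2 l2 q).
Proof.
move=> [[z w] ->]; exists (k1 * z + l1 * w, k2 * z + l2 * w).
rewrite /linmap /= !rmorphD !rmorphM /=.
by apply: injective_projections => /=; ring.
Qed.

Lemma jac_linmap k1 l1 k2 l2 Y : jac (linmap k1 l1 k2 l2) Y = \matrix_(i, j)
  (if j == 0 then if i == 0 then k1%:~R else k2%:~R else if i == 0 then l1%:~R else l2%:~R).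
Proof.
apply/matrixP => i j; rewrite !mxE crd_linmap derive_affine !crd_ebase.
by case: j => [[|[|]]] //= ?; rewrite ?mulr1 ?mulr0 ?addr0 ?add0r.
Qed.

Variables (k1 k2 l1 l2 : int).
Hypothesis det1 : k1 * l2 - l1 * k2 = 1.
Local Notation Phi := (linmap k1 l1 k2 l2).
Local Notation Psi := (linmap l2 (- l1) (- k2) k1).

Let det1R : k1%:~R * l2%:~R - l1%:~R * k2%:~R = 1 :> R.
Proof. by rewrite -!rmorphM -rmorphB det1. Qed.

Let PsiK : cancel Phi Psi.
Proof.
move=> Y; apply: injective_projections; rewrite /linmap /= !rmorphN/=.
  by transitivity ((k1%:~R * l2%:~R - l1%:~R * k2%:~R) * Y.1); [ring|rewrite det1R mul1r].
by transitivity ((k1%:~R * l2%:~R - l1%:~R * k2%:~R) * Y.2); [ring|rewrite det1R mul1r].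
Qed.

Let PhiK : cancel Psi Phi.
Proof.
move=> Y; apply: injective_projections; rewrite /linmap /= !rmorphN/=.
  by transitivity ((k1%:~R * l2%:~R - l1%:~R * k2%:~R) * Y.1); [ring|rewrite det1R mul1r].
by transitivity ((k1%:~R * l2%:~R - l1%:~R * k2%:~R) * Y.2); [ring|rewrite det1R mul1r].
Qed.

Lemma linmap_jac_unit Y : jac Phi Y \in unitmx.
Proof.
have [] // := @mulmx1_unit _ _ (jac Phi Y) (jac Psi Y).
rewrite !jac_linmap; apply/matrixP => i j; rewrite !mxE big_ord_recl big_ord1 !mxE /=.
case: i => [[|[|]]] //= ?; case: j => [[|[|]]] //= ?; rewrite ?rmorphN/=.
- by transitivity (k1%:~R * l2%:~R - l1%:~R * k2%:~R : R); [ring|exact: det1R].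
- by ring.
- by ring.
- by transitivity (k1%:~R * l2%:~R - l1%:~R * k2%:~R : R); [ring|exact: det1R].
Qed.

Lemma tequiv_refl (L p : pt R) : tequiv L p p.
Proof. by exists (0, 0); apply: injective_projections => /=; ring. Qed.

(** The inverse of an integer matrix of determinant one has integer entries: the map
is a homeomorphism of the torus, with one sheet over the whole torus. *)
Lemma linmap_covering : smooth_finite_covering T2 Phi.
Proof.
split.
- by move=> i; rewrite crd_linmap; exact: smooth2_affine.
- by move=> Y Y'; exact: tequiv_linmap.
- exact: linmap_jac_unit.
- move=> x; exists setT; split => //; first by split => //; exact: openT.
  exists 0%N, (fun=> setT); split.
  + by move=> _; split => //; exact: openT.
  + by move=> i j _ _ _; rewrite !ord1.
  + by rewrite preimage_setT; apply/seteqP; split => // p _; exists 0.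
  move=> _; split => //.
  + by move=> Y Y' _ _ /(tequiv_linmap l2 (- l1) (- k2) k1); rewrite !PsiK.
  + by move=> {}x _; exists (Psi x) => //; rewrite PhiK; exact: tequiv_refl.
  + move=> W [oW sW] _.
    have -> : [set x | exists2 Y, W Y & tequiv T2 (Phi Y) x] = Psi @^-1` W.
      apply/seteqP; split => {}x /=.
        move=> [Y WY] /(tequiv_linmap l2 (- l1) (- k2) k1); rewrite PsiK => /sW; exact.
      by move=> Wx; exists (Psi x) => //; rewrite PhiK; exact: tequiv_refl.
    by apply: open_comp => // Y _; exact: continuous_linmap.
Qed.

Lemma linmap_const (c : R) : (covering_const T2 Phi (fun=> c) < +oo)%E.
Proof.
rewrite /covering_const !lte_add_pinfty//.
- apply: lte_sum_pinfty => i _; apply: lte_sum_pinfty => j _.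
  by under eq_fun do rewrite jac_linmap; exact: w2infnorm_cst.
- apply: lte_sum_pinfty => i _; apply: lte_sum_pinfty => j _.
  by under eq_fun do rewrite jac_linmap; exact: w2infnorm_cst.
- exact: w2infnorm_cst.
- exact: w2infnorm_cst.
Qed.

End linear_covering.

Section constant_direction.
Context {R : realType}.

Lemma unit_W2inf_cst (a : pt R) : enorm a = 1 -> unit_W2inf (fun=> a).
Proof.
move=> a1; split => //; first by move=> p; exact: cvg_cst.
by move=> i; exact: (@w2infnorm_cst R (crd i a)).
Qed.

(** Bezout coefficients of the primitive vector [l] give the first column.  The sign
[sz] enters both columns, which keeps the determinant equal to one, and [q] is
the constant [|l|]. *)
Lemma rational_covering (a : pt R) : enorm a = 1 -> rational_direction a ->
  admits_controlled_covering (fun=> a).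
Proof.
move=> a1 [[l1 l2] [/= l0 cop [sg E]]]; split; first exact: unit_W2inf_cst.
have [[m n] /= mn] := coprimezP _ _ cop.
(* The sign in [perp a]. *)
pose sz : int := (-1) ^+ sg.
have szR : sz%:~R = (-1) ^+ sg :> R by rewrite rmorphXn/= rmorphN1.
have sz2 : sz * sz = 1 by rewrite /sz -signr_addb addbb.
set q := enorm _ in E.
have q0 : 0 < q.
  rewrite /q /enorm sqrtr_gt0 /dotp big_ord_recl big_ord1 /crd /= -!expr2.
  move: l0; rewrite xpair_eqE negb_and => /orP[h|h].
    by rewrite ltr_pwDl ?sqr_ge0// exprn_even_gt0//= intr_eq0.
  by rewrite ltr_wpDl ?sqr_ge0// exprn_even_gt0//= intr_eq0.
exists T2, (linmap (sz * n) (sz * l1) (- (sz * m)) (sz * l2)), (fun=> q).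
have det1 : (sz * n) * (sz * l2) - (sz * l1) * (- (sz * m)) = 1.
  by transitivity ((sz * sz) * (m * l1 + n * l2)); [ring|rewrite sz2 mn].
split.
- by split; rewrite /T2 /= mulr_gt0// pi_gt0.
- exact: linmap_covering.
- by split => // p; exact: cvg_cst.
- move=> i Y; rewrite crd_linmap derive_affine !crd_ebase/= mulr0 add0r mulr1 E.
  have -> : q * crd i (((-1) ^+ sg / q) *: ((l1%:~R, l2%:~R) : R * R)) = (-1) ^+ sg * crd i (l1%:~R, l2%:~R).
    by rewrite crdZ mulrA mulrCA divff ?mulr1 ?gt_eqF.
  by rewrite !rmorphM/= szR /crd; case: (i == 0).
- exact: linmap_const.
Qed.

Lemma shear_defect_cst (a x : pt R) : shear_defect (fun=> a) x = 0.
Proof.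
rewrite /shear_defect.
have D i j : 'D_(ebase j) (crd i \o (perp \o (fun=> a))) x = 0 by exact: (@derive_cst _ _ _ (crd i (perp a))).
have Z i : \sum_(j < 2) crd j (perp a) * 'D_(ebase j) (crd i \o (perp \o (fun=> a))) x -
  (\sum_(j < 2) 'D_(ebase j) (crd j \o (perp \o (fun=> a))) x) * crd i (perp a) = 0.
  by rewrite !big1 ?mul0r ?subr0// => j _; rewrite D ?mulr0.
by rewrite /mkpt !Z.
Qed.

Lemma shear_small_cst (lam nu K b : R) (a : pt R) : 0 < nu -> shear_small lam nu K b (fun=> a).
Proof.
move=> nu0; rewrite /shear_small.
have -> : enorm \o shear_defect (fun=> a) = fun=> 0.
  apply/funext => x /=; rewrite shear_defect_cst /enorm /dotp big1 ?sqrtr0// => i _.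
  by rewrite /crd; case: (i == 0); rewrite /= mul0r.
have -> : linfnorm (fun _ : pt R => 0 : R) = 0%E by exact: (@Lnorm0 _ _ _ leb2 +oo%E).
by rewrite mule0 lee_fin divr_ge0// ltW.
Qed.

End constant_direction.

(** * The nudging term absorbs the inertial term *)

Section assembly.
Context {R : realType}.
Notation mu := (@lebesgue_measure R).

(** For [X = h2 / r2] and [X0 = 2 C A / nu], concavity of the logarithm gives
[ln (1 + X) <= ln (1 + X0) + X / X0].  The gain pays for the first term; as
[h2 <= C E], the second one contributes at most [nu / 4 * E]. *)
Lemma ln_gain (A nu C g r2 h2 E : R) : 0 < nu -> 0 <= A -> 0 < r2 -> r2 <= h2 ->
  h2 <= C * E -> 0 <= E -> A * (1 + ln (1 + 2 * C * A / nu)) / 2 <= g ->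
  A / 2 * (1 + ln (1 + h2 / r2)) * r2 - g * r2 <= nu / 4 * E.
Proof.
move=> nu0 A0 r0 rh hE E0 hg.
(* [0 < r2 <= h2 <= C * E] with [0 <= E]. *)
have C0 : 0 < C.
  rewrite ltNge; apply/negP => C0; have : C * E <= 0 by rewrite mulr_le0_ge0.
  lra.
move: A0; rewrite le_eqVlt => /orP[/eqP A0|A0].
  have g0 : 0 <= g by move: hg; rewrite -A0 !mul0r.
  rewrite -A0 !mul0r sub0r.
  have : 0 <= g * r2 by rewrite mulr_ge0// ltW.
  have : 0 <= nu / 4 * E by rewrite mulr_ge0// divr_ge0// ltW.
  lra.
set X0 := 2 * C * A / nu in hg.
have X00 : 0 < X0 by rewrite divr_gt0// !mulr_gt0.
set X := h2 / r2.
have X1 : 0 < X by rewrite divr_gt0//; lra.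
have lnX : ln (1 + X) <= ln (1 + X0) + X / X0.
  rewrite -lerBlDl -ln_div ?posrE; [|lra|lra].
  have q0 : 0 < (1 + X) / (1 + X0) by rewrite divr_gt0//; lra.
  have h : ln ((1 + X) / (1 + X0)) <= (1 + X) / (1 + X0) - 1.
    by rewrite -[X in ln X](subrK 1) addrC; apply: le_ln1Dx; lra.
  apply: (le_trans h); rewrite lerBlDr ler_pdivrMr; last lra.
  have X0n : X0 != 0 by rewrite gt_eqF.
  have := divfK X0n X; rewrite mulrDl mulrDr; set z := X / X0 => zX.
  have z0 : 0 <= z by rewrite divr_ge0// ltW.
  lra.
have AX : A * (X / X0) = nu * X / (2 * C).
  rewrite /X0; field.
  by rewrite !gt_eqF.
have Xr : X * r2 = h2 by rewrite /X divfK// gt_eqF.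
have h1 : A / 2 * (1 + ln (1 + X)) * r2 - g * r2 <= A / 2 * (X / X0) * r2.
  rewrite -mulrBl ler_pM2r//.
  have : A * ln (1 + X) <= A * (ln (1 + X0) + X / X0) by rewrite ler_pM2l.
  lra.
apply: (le_trans h1).
have -> : A / 2 * (X / X0) * r2 = (A * (X / X0)) * r2 / 2 by ring.
rewrite AX.
have -> : nu * X / (2 * C) * r2 / 2 = nu / 4 * ((X * r2) / C).
  by field; rewrite gt_eqF.
rewrite Xr ler_pM2l ?divr_gt0// ler_pdivrMr// mulrC; lra.
Qed.

Lemma ess_sup_from_ae (t0 U : R) (g : R -> R) : ess_sup_from t0 g = U%:E ->
  {ae mu, forall t, t0 <= t -> g t <= U}.
Proof.
move=> H; have := ess_sup_ge (mrestr leb1 (measurable_itv `[t0, +oo[)) (EFin \o g).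
rewrite -/(ess_sup_from t0 g) H => -[N [mN N0 PN]].
exists (N `&` `[t0, +oo[); split => //.
  by apply: measurableI => //; exact: measurable_itv.
move=> t /= /not_implyP[tt gU]; split; last by rewrite in_itv/= andbT.
by apply: PN => /=; rewrite lee_fin.
Qed.

Lemma l2_le_h1 (r : pt R -> R) : l2norm T2 r ^+ 2 <= h1norm T2 r ^+ 2.
Proof.
have s0 : 0 <= \sum_(j < 2) l2norm T2 (wd T2 j r) ^+ 2 by apply: sumr_ge0 => j _; exact: sqr_ge0.
rewrite /h1norm [leRHS]sqr_sqrtr; first by rewrite lerDl.
by apply: addr_ge0; [exact: sqr_ge0|exact: s0].
Qed.

Lemma absorb (nu lam V H x y b : R) : - b <= nu / 2 * V + x ->
  nu * lam * H <= nu * V -> x - y <= nu / 4 * V ->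
  - nu * V - b - y <= - (nu * lam / 4) * H.
Proof. by move=> *; lra. Qed.

(** The choice of [K] splits the inertial term into half of the dissipation and a
term in [e . a]; [ln_gain] covers the latter by the nudging and a quarter of the
dissipation, and Poincare's inequality applies to the last quarter. *)
Lemma dissipation (nu lam K C U1 g : R) (a : pt R) (u e : field R) : 0 < nu ->
  poincare_const lam -> trilinear_const lam (fun=> a) K -> friction_const (fun=> a) C ->
  space_V u -> space_V e -> norm_V u <= U1 ->
  let A := 2 * K / nu * U1 ^+ 2 in
  A * (1 + ln (1 + 2 * C * A / nu)) / 2 <= g ->
  - nu * norm_V e ^+ 2 - trilinear e u e - g * l2norm T2 (proj_on (fun=> a) e) ^+ 2 <=
    - (nu * lam / 4) * norm_H e ^+ 2.
Proof.
move=> nu0 [lam0 HP] [K0 HK] HC Vu Ve uU A hg.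
have /ler_normlP[tri _] := HK nu nu0 u e Vu Ve (shear_small_cst lam K (norm_H u) a nu0).
have He := HC e Ve; have Pe := HP e Ve.
set r := proj_on (fun=> a) e in tri He *.
have E0 : 0 <= norm_V e ^+ 2 := sqr_ge0 _.
have nuE : nu * lam * norm_H e ^+ 2 <= nu * norm_V e ^+ 2 by rewrite -mulrA ler_pM2l.
suff : K / nu * norm_V u ^+ 2 * log_factor r * l2norm T2 r ^+ 2 - g * l2norm T2 r ^+ 2 <= nu / 4 * norm_V e ^+ 2.
  exact: absorb tri nuE.
have u2 : norm_V u ^+ 2 <= U1 ^+ 2 by rewrite ler_sqr// nnegrE ?norm_V_ge0// (le_trans (norm_V_ge0 u)).
rewrite /log_factor; case: ifPn => [/eqP ->|r0].
  by rewrite expr0n/= !mulr0 subr0 mulr_ge0// divr_ge0// ltW.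
have r20 : 0 < l2norm T2 r ^+ 2 by rewrite exprn_even_gt0.
have hr := l2_le_h1 r.
have A0 : 0 <= A by rewrite /A mulr_ge0 ?sqr_ge0// divr_ge0// ?mulr_ge0// ltW.
have L0 : 0 <= 1 + ln (1 + h1norm T2 r ^+ 2 / l2norm T2 r ^+ 2).
  by rewrite addr_ge0// ln_ge0// lerDl divr_ge0// sqr_ge0.
apply: le_trans (ln_gain nu0 A0 r20 hr He E0 hg).
rewrite lerD2r ler_pM2r// ler_wpM2r//.
have -> : A / 2 = K / nu * U1 ^+ 2 by rewrite /A; field; rewrite gt_eqF.
by rewrite ler_wpM2l// divr_ge0// ltW.
Qed.

End assembly.

(** * Synchronization *)

Theorem corollary5p3 (R : realType) (nu lam1 Km Cfr t0 U0 U1 : R)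
  (f u0 : field R) (u : R -> field R) (a : pt R)
  (hnu : 0 < nu) (hlam : poincare_const lam1)
  (ha : enorm a = 1) (hrat : rational_direction a)
  (hK : trilinear_const lam1 (fun=> a) Km)
  (hC : friction_const (fun=> a) Cfr)
  (hf : space_H f) (hu0 : space_V u0) (hu : strong_NS nu f u0 u)
  (ht0 : 0 <= t0)
  (hU0 : ess_sup_from t0 (fun t => norm_H (u t)) = U0%:E)
  (hU1 : ess_sup_from t0 (fun t => norm_V (u t)) = U1%:E) :
  let m : field R := fun=> a in
  let Astar := 2 * Km / nu * U1 ^+ 2 in
  let Bstar := Astar * (1 + ln (1 + 2 * Cfr * Astar / nu)) in
  [/\ admits_controlled_covering m,
      forall x, shear_defect m x = 0,
      shear_small lam1 nu Km U0 m &
      forall mu : R, 0 < mu -> Bstar / 2 <= mu ->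
      forall (v0 : field R) (v : R -> field R), space_V v0 -> strong_nudged nu mu f m u v0 v ->
      forall t : R, t0 <= t ->
        norm_H (v t \- u t) ^+ 2 <=
        expR (- (nu * lam1 / 2) * (t - t0)) * norm_H (v t0 \- u t0) ^+ 2].
Proof.
move=> m Astar Bstar; have lam0 := hlam.1; split.
- exact: rational_covering.
- by move=> x; exact: shear_defect_cst.
- exact: shear_small_cst.
move=> mu mu0 hmu v0 v hv0 [vt [Sv v0E eqv]] t tt.
have [ut [Su u0E equ]] := hu.
have k0 : 0 <= nu * lam1 / 2 by rewrite divr_ge0// ltW// mulr_gt0.
apply: (energy_decay hlam Su Sv k0 ht0) => //.
apply: (aeS2 (ess_sup_from_ae hU1) (aeS2 equ eqv (fun t p q => conj p q))) => {tt} {}t uU [equt eqvt] tt.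
have t_gt0 : 0 < t by exact: le_lt_trans tt.
have [au [bu [Au Bu Eu]]] := equt t_gt0.
have [av [bv [p [Av Bv Pp Ev]]]] := eqvt t_gt0.
have T0 : 0 < t + 1 by rewrite addr_gt0.
have tT : t \in `]0, t + 1[ by rewrite in_itv/= t_gt0 ltrDl ltr01.
have [_ _ [/(_ t tT) Hut _ _] _] := Su _ T0.
have [_ _ [/(_ t tT) Hvt _ _] _] := Sv _ T0.
rewrite (energy_identity Hut Hvt Au Bu Av Bv Pp Eu Ev).
have -> : nu * lam1 / 2 / 2 = nu * lam1 / 4 by field.
have Vu := dom_A_V Au.1; have Vv := dom_A_V Av.1.
exact: (dissipation hnu hlam hK hC Vu (space_VB Vv Vu) (uU (ltW tt)) hmu).
Qed.
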